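(* Let $d\ge1$, $K\subset\mathbb{R}^d$ compact convex with volume one, $(\theta_t)_{t\ge1}$ positive reals with $\lim_{t\to\infty}t^2\theta_t^d=\infty$, and $a>0$. Let $\mu_t$ be either a homogeneous Poisson process of intensity $t$ on $K$ or a binomial process of $\lceil t\rceil$ independent uniform points in $K$, $t\ge1$, and let $$\xi_{t,a}:=\frac12\sum_{(x,y)\in\mu^2_{t,\neq}}\mathbf{1}\big(\|x-y\|\le\min\{\theta_t,t^{-2/d}a\}\big)\,\delta_{(x+y)/2}.$$ Let $\zeta$ be a Poisson process on $K$ with intensity measure $\frac{\kappa_d}{2}a^d\,\mathrm{vol}|_K$. Then $t_0:=\sup(\{t\ge1:t^2\theta_t^d<a^d\}\cup\{1\})<\infty$, and there is a constant $C>0$ depending only on $a$, $d$ and $K$ such that $$\mathbf{d}_{\mathbf{KR}}(\xi_{t,a},\zeta)\le C\,t^{-\min\{2/d,1\}},\qquad t>t_0.$$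
   Context: $\kappa_d$ is the volume of the $d$-dimensional unit ball; $\mathrm{vol}|_K$ is Lebesgue measure restricted to $K$; $\mu^2_{t,\neq}$ the pairs of distinct points of $\mu_t$. For counting measures, $\mathbf{d}_{\mathbf{TV}}(\omega_1,\omega_2):=\sup\{|\omega_1(A)-\omega_2(A)|:\omega_1(A),\omega_2(A)<\infty\}$; for point processes $\xi,\zeta$, $\mathbf{d}_{\mathbf{KR}}(\xi,\zeta):=\inf_{\mathbb{C}}\int\mathbf{d}_{\mathbf{TV}}(\omega_1,\omega_2)\,\mathbb{C}(d(\omega_1,\omega_2))$ over all couplings $\mathbb{C}$ of their distributions. *)

(* Defs.v *)
From HB Require Import structures.
From mathcomp Require Import all_boot all_order all_algebra.
From mathcomp Require Import all_classical all_reals all_analysis.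

Set Implicit Arguments.
Unset Strict Implicit.
Unset Printing Implicit Defensive.

Import Order.TTheory GRing.Theory Num.Theory.
Import numFieldTopology.Exports numFieldNormedType.Exports.
Local Open Scope classical_set_scope.
Local Open Scope ring_scope.

Section Defs.
Variable R : realType.

(* Euclidean norm (the matrix topology of MathComp uses the max norm,
   so the Euclidean norm is defined explicitly). *)
Definition eucl_norm d (x : 'rV[R]_d) : R :=
  Num.sqrt (\sum_(i < d) x ord0 i ^+ 2).

Definition borel d : set (set 'rV[R]_d) := <<s [set A : set 'rV[R]_d | @open 'rV[R]_d A] >>.

(* Defined by iterated integration (Tonelli): on Borel sets this is the
   d-dimensional Lebesgue measure.  vol 0 is the Dirac mass on the unique
   point of R^0. *)
Definition rsection d (B : set 'rV[R]_d.+1) (x : R) : set 'rV[R]_d :=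
  [set y | B (row_mx (\row_(_ < 1) x) y)].

Fixpoint vol (d : nat) : set 'rV[R]_d -> \bar R :=
  match d return set 'rV[R]_d -> \bar R with
  | 0 => fun B => if `[< B !=set0 >] then 1%E else 0%E
  | d'.+1 => fun B =>
      (\int[@lebesgue_measure R]_x vol (@rsection d' B x))%E
  end.

Definition kappa d : R := fine (vol [set x : 'rV[R]_d | eucl_norm x <= 1]).

(* A (finite) counting measure on R^d is represented by a finite sequence
   of points (with multiplicities); omega(A) = number of entries in A. *)
Definition config d := seq 'rV[R]_d.
HB.instance Definition _ d := Choice.on (config d).
HB.instance Definition _ d := isPointed.Build (config d) [::].

Definition cnt d (A : set 'rV[R]_d) (s : config d) : nat :=
  count (fun x => `[< A x >]) s.

Definition cnt_gen d : set (set (config d)) :=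
  [set C | exists B k, borel B /\ C = cnt B @^-1` [set k]].
  
Definition Config d := g_sigma_algebraType (@cnt_gen d).

Definition dTV d (s1 s2 : config d) : \bar R :=
  ereal_sup [set (`| (cnt A s1)%:R - (cnt A s2)%:R | : R)%:E | A in @borel d].

Definition coupling d (dO1 dO2 : measure_display)
  (O1 : measurableType dO1) (O2 : measurableType dO2)
  (P1 : probability O1 R) (P2 : probability O2 R)
  (eta1 : O1 -> Config d) (eta2 : O2 -> Config d)
  (Q : probability (Config d * Config d)%type R) : Prop :=
  (forall A : set (Config d), measurable A ->
      Q (fst @^-1` A) = P1 (eta1 @^-1` A)) /\
  (forall A : set (Config d), measurable A ->
      Q (snd @^-1` A) = P2 (eta2 @^-1` A)).

Definition dKR d (dO1 dO2 : measure_display)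
  (O1 : measurableType dO1) (O2 : measurableType dO2)
  (P1 : probability O1 R) (P2 : probability O2 R)
  (eta1 : O1 -> Config d) (eta2 : O2 -> Config d) : \bar R :=
  ereal_inf [set (\int[Q]_z dTV z.1 z.2)%E
            | Q in [set Q | coupling P1 P2 eta1 eta2 Q]].

Definition poisson_pmf' (r : R) (k : nat) : R :=
  r ^+ k / k`!%:R * expR (- r).

Definition poisson_process d (dO : measure_display) (O : measurableType dO)
  (P : probability O R) (eta : O -> Config d) (lam : set 'rV[R]_d -> R) : Prop :=
  measurable_fun setT eta /\
  (forall B, borel B -> forall k,
      P (eta @^-1` (cnt B @^-1` [set k])) = (poisson_pmf' (lam B) k)%:E) /\
  (forall m (B : nat -> set 'rV[R]_d) (k : nat -> nat),
      (forall i, (i < m)%N -> borel (B i)) ->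
      (forall i j, (i < m)%N -> (j < m)%N -> i <> j -> [disjoint B i & B j]) ->
      P (\bigcap_(i in [set i | (i < m)%N]) (eta @^-1` (cnt (B i) @^-1` [set k i])))
      = (\prod_(i < m) P (eta @^-1` (cnt (B i) @^-1` [set k i])))%E).

(* Binomial process of n independent points uniformly distributed in K
   (with vol K = 1, so the uniform law on K is vol restricted to K). *)
Definition binomial_process d (dO : measure_display) (O : measurableType dO)
  (P : probability O R) (eta : O -> Config d) (K : set 'rV[R]_d) (n : nat) : Prop :=
  measurable_fun setT eta /\
  exists X : nat -> O -> 'rV[R]_d,
    (forall i B, borel B -> measurable (X i @^-1` B)) /\
    (forall (B : nat -> set 'rV[R]_d), (forall i, (i < n)%N -> borel (B i)) ->
      P (\bigcap_(i in [set i | (i < n)%N]) (X i @^-1` B i))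
      = (\prod_(i < n) vol (B i `&` K))%E) /\
    (forall w, eta w = mkseq (fun i => X i w) n).

(* (1/2) sum over ordered pairs of distinct points = sum over index pairs
   i < j; each close pair contributes the Dirac mass at its midpoint. *)
Definition midpoints d (r : R) (s : config d) : config d :=
  [seq 2^-1 *: (nth 0 s p.1 + nth 0 s p.2)
  | p <- [seq (i, j) | i <- iota 0 (size s), j <- iota 0 (size s)]
  & (p.1 < p.2)%N && (eucl_norm (nth 0 s p.1 - nth 0 s p.2) <= r)].

End Defs.

(* Main.v *)
(** Let [lam = kappa a^d / 2] and [r = a t^(-2/d)]. For [t > t0] the cut-off [theta t] is inactive, so the process is that of the midpoints of the pairs at distance at most [r], and a given point is [r]-close to another one with probability at most [b = kappa r^d = 2 lam / t^2].

Let [m'] be [1 / b] times the law of the midpoint of two uniform points, restricted to the event that they are [r]-close. It is dominated by the uniform law on [K] (translation invariance and convexity) and misses only a mass [O(r)] (shifting a convex body by [v] loses volume [O(|v|)]). The laws of both processes dominate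
  [nu = sum_k exp(-lam) lam^k / k! max(0, 1 - C (k+1)^2 / t) m'^k],
where [m'^k] is the law of [k] points drawn from [m'] (of total mass at most 1), restricted to configurations without [2 r]-close pairs. For the Poisson process of intensity [lam] this is clear. For the midpoint process, the Mecke formula splits off the [k] close pairs one by one; as their midpoints are more than [2 r] apart, the only remaining requirement is that the other points create no close pair, which has probability at least [prod_j max(0, 1 - j b)].

Coupling the two laws along the diagonal on [nu] and independently on the remainders bounds the expected total variation by [E|xi| + E|zeta| - 2 int |s| nu(ds)], and each of the three terms is [lam + O(t^(-min(2/d, 1)))]. *)

Require Import Defs.
From HB Require Import structures.
From mathcomp Require Import all_boot all_order all_algebra.
From mathcomp Require Import all_classical all_reals all_analysis.
From mathcomp Require Import measurable_realfun.
From mathcomp Require Import ring lra zify.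
Import Order.TTheory GRing.Theory Num.Theory.
Import numFieldTopology.Exports numFieldNormedType.Exports.
Local Open Scope classical_set_scope.
Local Open Scope ring_scope.

Set Implicit Arguments.
Unset Strict Implicit.
Unset Printing Implicit Defensive.

(** * Euclidean space as a Borel space *)

(** The sigma-algebra on configurations is generated by counts, so a law is determined by the counts
    on finite partitions. Hence both input processes become mixtures [sum_n p n * iid m n] of laws
    of [n] independent points, and the coupling uses only two facts about [p]: a lower bound for the
    sum of [p n * (n ^_ (2 k))] times the survival bound, and [sum_n p n * n (n - 1) <= t^2 + t].
    The factor [exp(-lam)] comes from the survival product: with about [t] points, the numbers [j b]
    add up to about [b t^2 / 2 = lam]. This sum has to be exact to leading order; what remains is
    [O((k + 1)^2 / t)]. Since only a lower bound on the laws is wanted, configurations with clusters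
    of three or more points are discarded, and no conditional law given the close pairs is ever
    needed. Three losses fix the rate: [1 / t] from the weights, [O(r) = O(t^(-2/d))] from the
    boundary of [K], and [kappa (2 r)^d = O(t^(-2))] from midpoints that are close to each other.
    Each is multiplied by a polynomial in the number [k] of pairs, whose Poisson expectation is
    finite. *)

Definition RV (R : realType) (d : nat) :=
  g_sigma_algebraType [set A : set 'rV[R]_d | @open 'rV[R]_d A].

Section coordinates.
Context {R : realType}.

Lemma measurable_coord d (i : 'I_d) :
  measurable_fun setT (fun x : RV R d => (x : 'rV[R]_d) ord0 i).
Proof.
apply: (measurability _ (RGenOpens.measurableE R)) => _ [_ [a [b ->] <-]].
rewrite setTI; apply: sub_sigma_algebra => /=.
apply: (@open_comp 'rV[R]_d R (fun x => x ord0 i)); last exact: interval_open.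
by move=> x _; exact: coord_continuous.
Qed.

(** An open set is the union of the countably many boxes with rational centre and half-width
    [1 / (n + 1)] that it contains, and the preimage of a box is a finite intersection of conditions
    on single coordinates. *)
Lemma measurable_fun_RV d dT (T : measurableType dT) (f : T -> RV R d) :
  (forall i, measurable_fun setT (fun w => (f w : 'rV[R]_d) ord0 i)) ->
  measurable_fun setT f.
Proof.
move=> mf; apply: (@measurability _ _ _ (RV R d) setT f _ erefl) => _ [A oA <-].
rewrite setTI.
pose box (p : 'rV[rat]_d * nat) : set 'rV[R]_d :=
  [set y | forall i, `|ratr (p.1 ord0 i) - y ord0 i| < p.2.+1%:R^-1].
have mbox p : measurable (f @^-1` box p).
  rewrite (_ : _ @^-1` _ = \bigcap_(i in [set: 'I_d])
      ((fun w => (f w : 'rV[R]_d) ord0 i) @^-1`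
        [set y | `|ratr (p.1 ord0 i) - y| < p.2.+1%:R^-1])); last first.
    by apply/seteqP; split => [w /= h i _ //=|w /= h i]; exact: h.
  apply: fin_bigcap_measurable => // i _.
  rewrite -[X in measurable X]setTI; apply: mf => //.
  apply: open_measurable.
  rewrite (_ : [set y | _] = ball (ratr (p.1 ord0 i) : R) p.2.+1%:R^-1)//.
  exact: ball_open.
rewrite (_ : f @^-1` A = \bigcup_(p in [set: 'rV[rat]_d * nat])
                (if `[< box p `<=` A >] then f @^-1` box p else set0)).
  apply: countable_bigcupT_measurable => [|p]; first exact: countableP.
  by case: ifP.
apply/seteqP; split => [w Aw|w [p _ /=]]; last first.
  by case: asboolP => // pA; exact: pA.
have [e /= e0 eA] : nbhs_ball (f w : 'rV[R]_d) A.
  by rewrite nbhs_ballE; apply: open_nbhs_nbhs; split.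
(* The rational centre is within [1 / (n + 1) < e / 2] of [f w], and the points of the box are as
   near to the centre, so the box stays in the [e]-ball around [f w]. *)
pose n := Num.truncn (2 / e).
have n0 : (n.+1%:R^-1 : R) < e / 2.
  rewrite -(invrK (e / 2)) ltf_pV2 ?posrE ?invr_gt0 ?divr_gt0//.
  by rewrite invf_div; exact: truncnS_gt.
have hq (i : 'I_d) : exists q : rat, `|ratr q - (f w : 'rV[R]_d) ord0 i| < n.+1%:R^-1.
  have [|q] := @rat_in_itvoo R ((f w : 'rV[R]_d) ord0 i)
    ((f w : 'rV[R]_d) ord0 i + n.+1%:R^-1); first by rewrite ltrDl.
  move=> /itvP qi; exists q; rewrite gtr0_norm ?subr_gt0 ?qi// ltrBlDl.
  by rewrite qi.
pose q : 'rV[rat]_d := \row_i xget 0 [set q : rat | `|ratr q - (f w : 'rV[R]_d) ord0 i| < n.+1%:R^-1].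
have qP i : `|ratr (q ord0 i) - (f w : 'rV[R]_d) ord0 i| < n.+1%:R^-1.
  rewrite mxE; case: xgetP => [y _ //|no]; have [q' hq'] := hq i.
  by have := no q' hq'.
have sA : box (q, n) `<=` A.
  move=> y yb; apply: eA; split => // i j; rewrite ord1 /ball/=.
  rewrite (_ : _ - _ = (ratr (q ord0 j) - y ord0 j) -
     (ratr (q ord0 j) - (f w : 'rV[R]_d) ord0 j)); last ring.
  rewrite (le_lt_trans (ler_normB _ _))// [ltRHS]splitr ltrD//.
    exact: (lt_trans (yb j)).
  exact: lt_trans (qP j) _.
by exists (q, n) => //; rewrite asboolT.
Qed.

Definition vcons {d} (p : measurableTypeR R * RV R d) : RV R d.+1 :=
  row_mx (\row_(_ < 1) (p.1 : R)) (p.2 : 'rV[R]_d) : 'rV[R]_(1 + d).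

Lemma vcons0 d (p : measurableTypeR R * RV R d) :
  (vcons p : 'rV[R]_d.+1) ord0 ord0 = p.1.
Proof.
have := @row_mxEl R 1 1 d (\row_(_ < 1) (p.1 : R)) (p.2 : 'rV[R]_d) ord0 ord0.
rewrite mxE => <-; rewrite /vcons.
by congr (fun_of_matrix _ _ _); exact: val_inj.
Qed.

Lemma vconsS d (p : measurableTypeR R * RV R d) i :
  (vcons p : 'rV[R]_d.+1) ord0 (lift ord0 i) = (p.2 : 'rV[R]_d) ord0 i.
Proof.
have := @row_mxEr R 1 1 d (\row_(_ < 1) (p.1 : R)) (p.2 : 'rV[R]_d) ord0 i.
by move=> <-; rewrite /vcons; congr (fun_of_matrix _ _ _); exact: val_inj.
Qed.

Definition vuncons {d} (x : RV R d.+1) : measurableTypeR R * RV R d :=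
  ((x : 'rV[R]_d.+1) ord0 ord0, \row_i (x : 'rV[R]_d.+1) ord0 (lift ord0 i)).

Lemma vconsK d : cancel (@vcons d) vuncons.
Proof.
move=> p; rewrite /vuncons vcons0; case: p => x y; congr pair.
by apply/rowP => i; rewrite mxE vconsS.
Qed.

Lemma measurable_vcons d : measurable_fun setT (@vcons d).
Proof.
apply: measurable_fun_RV => i; case: (unliftP ord0 i) => [j ->|->].
  apply: (eq_measurable_fun ((fun x : RV R d => (x : 'rV[R]_d) ord0 j) \o snd)).
    by move=> p _; rewrite vconsS.
  exact: measurableT_comp (@measurable_coord d j) measurable_snd.
by apply: (eq_measurable_fun fst) => [p _|]; [rewrite vcons0|exact: measurable_fst].
Qed.

Lemma measurable_vuncons d : measurable_fun setT (@vuncons d).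
Proof.
apply: measurable_fun_pair; first exact: measurable_coord.
apply: measurable_fun_RV => i.
apply: (eq_measurable_fun (fun x : RV R d.+1 => (x : 'rV[R]_d.+1) ord0 (lift ord0 i))).
  by move=> p _; rewrite mxE.
exact: measurable_coord.
Qed.

Lemma measurable_RVD d dT (T : measurableType dT) (f g : T -> RV R d) :
  measurable_fun setT f -> measurable_fun setT g ->
  measurable_fun setT (fun w => (f w : 'rV[R]_d) + (g w : 'rV[R]_d) : RV R d).
Proof.
move=> mf mg; apply: measurable_fun_RV => i.
apply: (eq_measurable_fun (fun w => (f w : 'rV[R]_d) ord0 i + (g w : 'rV[R]_d) ord0 i)).
  by move=> w _; rewrite mxE.
by apply: measurable_funD; exact: (measurableT_comp (@measurable_coord d i)).
Qed.

Lemma measurable_RVZ d dT (T : measurableType dT) (a : R) (f : T -> RV R d) :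
  measurable_fun setT f ->
  measurable_fun setT (fun w => a *: (f w : 'rV[R]_d) : RV R d).
Proof.
move=> mf; apply: measurable_fun_RV => i.
apply: (eq_measurable_fun (fun w => a * (f w : 'rV[R]_d) ord0 i)).
  by move=> w _; rewrite mxE.
by apply: measurable_funM => //; exact: (measurableT_comp (@measurable_coord d i)).
Qed.

Lemma measurable_RVB d dT (T : measurableType dT) (f g : T -> RV R d) :
  measurable_fun setT f -> measurable_fun setT g ->
  measurable_fun setT (fun w => (f w : 'rV[R]_d) - (g w : 'rV[R]_d) : RV R d).
Proof.
move=> mf mg; apply: (eq_measurable_fun
  (fun w => (f w : 'rV[R]_d) + (-1 *: (g w : 'rV[R]_d)) : RV R d)).
  by move=> w _; rewrite scaleN1r.
by apply: measurable_RVD => //; exact: measurable_RVZ.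
Qed.

Lemma measurable_eucl_norm d : measurable_fun setT (fun x : RV R d => eucl_norm (x : 'rV[R]_d)).
Proof.
apply: (@measurableT_comp _ _ _ _ _ _ (@Num.sqrt R)).
  by apply: continuous_measurable_fun; exact: sqrt_continuous.
apply: measurable_sum => i; apply: measurable_funX; exact: measurable_coord.
Qed.

End coordinates.

(** * Push-forward and product measures *)

Lemma measurable_preim d1 d2 (T1 : measurableType d1) (T2 : measurableType d2)
    (f : T1 -> T2) (A : set T2) :
  measurable_fun setT f -> measurable A -> measurable (f @^-1` A).
Proof. by move=> mf mA; rewrite -[X in measurable X]setTI; exact: mf. Qed.

Section measure_constructions.
Context {R : realType}.

Definition pushm d1 d2 (T1 : measurableType d1) (T2 : measurableType d2)
    (m : {measure set T1 -> \bar R}) (f : T1 -> T2)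
    (mf : measurable_fun setT f) : set T2 -> \bar R := pushforward m f.

Section pushm_measure.
Context d1 d2 (T1 : measurableType d1) (T2 : measurableType d2)
  (m : {measure set T1 -> \bar R}) (f : T1 -> T2) (mf : measurable_fun setT f).

Let pushm0 : pushm m mf set0 = 0%E.
Proof. by rewrite /pushm /pushforward preimage_set0 measure0. Qed.

Let pushm_ge0 A : (0 <= pushm m mf A)%E.
Proof. exact: measure_ge0. Qed.

Let pushm_sigma_additive : semi_sigma_additive (pushm m mf).
Proof.
by rewrite /pushm; exact: measure_semi_sigma_additive.
Qed.

HB.instance Definition _ := isMeasure.Build _ _ _
  (pushm m mf) pushm0 pushm_ge0 pushm_sigma_additive.

End pushm_measure.

Definition finm d (T : measurableType d) (mu : {measure set T -> \bar R})
    (h : (mu setT < +oo)%E) : set T -> \bar R := mu.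

Section finm_measure.
Context d (T : measurableType d) (mu : {measure set T -> \bar R})
  (h : (mu setT < +oo)%E).

HB.instance Definition _ := Measure.on (finm h).
HB.instance Definition _ := Measure_isFinite.Build _ _ _ (finm h)
  (lty_fin_num_fun h).

End finm_measure.

Definition prodm d1 d2 (T1 : measurableType d1) (T2 : measurableType d2)
    (m1 : {sigma_finite_measure set T1 -> \bar R})
    (m2 : {sigma_finite_measure set T2 -> \bar R}) : set (T1 * T2) -> \bar R :=
  (m1 \x m2)%E.

Section prodm_measure.
Context d1 d2 (T1 : measurableType d1) (T2 : measurableType d2)
  (m1 : {sigma_finite_measure set T1 -> \bar R})
  (m2 : {sigma_finite_measure set T2 -> \bar R}).

HB.instance Definition _ := Measure.on (prodm m1 m2).

Let prodm_sigma_finite : sigma_finite setT (prodm m1 m2).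
Proof.
have /sigma_finiteP[F [FT ndF Foo]] := sigma_finiteT m1.
have /sigma_finiteP[G [GT ndG Goo]] := sigma_finiteT m2.
exists (fun n => F n `*` G n).
  apply/esym; rewrite -subTset => -[x y] _.
  have [i _ Fx] : (\bigcup_i F i) x by rewrite -FT.
  have [j _ Gy] : (\bigcup_i G i) y by rewrite -GT.
  exists (maxn i j) => //; split => /=.
    by move: x Fx; apply/subsetPset/ndF/leq_maxl.
  by move: y Gy; apply/subsetPset/ndG/leq_maxr.
move=> n; have [mF Fn] := Foo n; have [mG Gn] := Goo n.
split; first exact: measurableX.
by rewrite /prodm product_measure1E// lte_mul_pinfty// ge0_fin_numE.
Qed.

HB.instance Definition _ := Measure_isSigmaFinite.Build _ _ _ (prodm m1 m2)
  prodm_sigma_finite.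

End prodm_measure.

Lemma ge0_integral_pushm d1 d2 (T1 : measurableType d1) (T2 : measurableType d2)
    (m : {measure set T1 -> \bar R}) (f : T1 -> T2)
    (mf : measurable_fun setT f) (g : T2 -> \bar R) :
  measurable_fun setT g -> (forall y, (0 <= g y)%E) ->
  (\int[pushm m mf]_y g y = \int[m]_x g (f x))%E.
Proof.
by move=> mg g0; rewrite /pushm ge0_integral_pushforward.
Qed.

Lemma prodmX d1 d2 (T1 : measurableType d1) (T2 : measurableType d2)
    (m1 : {sigma_finite_measure set T1 -> \bar R})
    (m2 : {sigma_finite_measure set T2 -> \bar R}) A B :
  measurable A -> measurable B -> (prodm m1 m2 (A `*` B) = m1 A * m2 B)%E.
Proof. by move=> mA mB; rewrite /prodm product_measure1E. Qed.

Lemma prodmT d1 d2 (T1 : measurableType d1) (T2 : measurableType d2)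
    (m1 : {sigma_finite_measure set T1 -> \bar R})
    (m2 : {sigma_finite_measure set T2 -> \bar R}) :
  (prodm m1 m2 setT = m1 setT * m2 setT)%E.
Proof. by rewrite -setXTT prodmX. Qed.

Lemma ge0_integral_prodm d1 d2 (T1 : measurableType d1) (T2 : measurableType d2)
    (m1 : {sigma_finite_measure set T1 -> \bar R})
    (m2 : {sigma_finite_measure set T2 -> \bar R}) (f : T1 * T2 -> \bar R) :
  measurable_fun setT f -> (forall z, (0 <= f z)%E) ->
  (\int[prodm m1 m2]_z f z = \int[m1]_x \int[m2]_y f (x, y))%E.
Proof. by move=> mf f0; rewrite /prodm fubini_tonelli1. Qed.

End measure_constructions.

(** * Lebesgue measure on Euclidean space *)

Section volume.
Context {R : realType}.
Local Open Scope ereal_scope.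

Lemma rsectionE d (B : set (RV R d.+1)) (x : R) :
  rsection B x = (fun y : RV R d => vcons (x : measurableTypeR R, y)) @^-1` B.
Proof. by []. Qed.

Lemma measurable_rsection d (B : set (RV R d.+1)) (x : R) :
  measurable B -> measurable (rsection B x : set (RV R d)).
Proof.
move=> mB; rewrite rsectionE -[X in measurable X]setTI.
by apply: measurableT_comp => //; exact: measurable_vcons.
Qed.

(** [vol] is a bare recursive function, so it is compared with a measure built alongside: in
    dimension [d + 1], the push-forward under [vcons] of the product of Lebesgue measure with the
    measure in dimension [d]. Agreement on measurable sets suffices to transfer additivity and
    sigma-finiteness to [volm]. *)
Lemma vol_exists d : exists m : {sigma_finite_measure set RV R d -> \bar R},
  forall B : set (RV R d), measurable B -> vol B = m B.
Proof.
elim: d => [|d [m mE]].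
  exists (\d_ (0%R : RV R 0)) => B _ /=; rewrite diracE.
  case: asboolP => [[x Bx]|B0].
    by rewrite mem_set// -(_ : x = 0%R)//; apply/rowP => -[].
  by rewrite memNset// => B0'; apply: B0; exists 0%R.

pose m' := pushm (prodm (@lebesgue_measure R) m) (@measurable_vcons R d).
have m'_sigma : sigma_finite setT m'.
  have [F FT Foo] : sigma_finite setT (prodm (@lebesgue_measure R) m) by exact: sigma_finiteT.
  exists (fun n => @vuncons R d @^-1` (F n)).
    by rewrite -preimage_bigcup -FT preimage_setT.
  move=> n; have [mF Fn] := Foo n; split.
    by rewrite -[X in measurable X]setTI; exact: measurable_vuncons.
  rewrite /m' /pushm /pushforward -comp_preimage.
  by rewrite (_ : vuncons \o vcons = id) ?preimage_id//; apply/funext; exact: vconsK.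
pose m2 : {sigma_finite_measure set RV R d.+1 -> \bar R} :=
  HB.pack m' (Measure_isSigmaFinite.Build _ _ _ m' m'_sigma).
exists m2 => B mB; rewrite /m2 /= /m' /pushm /pushforward /prodm /product_measure1.
apply: eq_integral => x _; rewrite mE; last exact: measurable_rsection.
by congr (m _); apply/seteqP; split => y; rewrite /xsection/= ?inE.
Qed.

Definition volm d : set (RV R d) -> \bar R := @vol R d.

Let volm0 d : volm (@set0 (RV R d)) = 0.
Proof. by have [m mE] := vol_exists d; rewrite /volm mE// measure0. Qed.

Let volm_ge0 d (B : set (RV R d)) : 0 <= volm B.
Proof.
elim: d B => [|d ih] B; rewrite /volm /=; first by case: ifP.
by apply: integral_ge0 => x _; exact: ih.
Qed.

Let volm_sigma_additive d : semi_sigma_additive (@volm d).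
Proof.
have [m mE] := vol_exists d.
move=> F mF tF mU; rewrite /volm mE//.
rewrite (_ : (fun n => _) = (fun n => \sum_(0 <= i < n) m (F i))).
  exact: measure_semi_sigma_additive.
by apply/funext => n; apply: eq_bigr => i _; rewrite mE.
Qed.

HB.instance Definition _ d := isMeasure.Build _ _ _ (@volm d)
  (@volm0 d) (@volm_ge0 d) (@volm_sigma_additive d).

Let volm_sigma_finite d : sigma_finite setT (@volm d).
Proof.
have [m mE] := vol_exists d; have [F FT Foo] := sigma_finiteT m.
exists F => // n; have [mF Fn] := Foo n; split => //.
by rewrite /volm mE.
Qed.

HB.instance Definition _ d := Measure_isSigmaFinite.Build _ _ _ (@volm d)
  (@volm_sigma_finite d).

Lemma volmS d (B : set (RV R d.+1)) :
  volm B = \int[@lebesgue_measure R]_x volm (rsection B x : set (RV R d)).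
Proof. by []. Qed.

Lemma measurable_volm_rsection d (B : set (RV R d.+1)) : measurable B ->
  measurable_fun setT
    (fun x : measurableTypeR R => volm (rsection B x : set (RV R d))).
Proof.
move=> mB; have mcB : measurable (@vcons R d @^-1` B).
  by rewrite -[X in measurable X]setTI; exact: measurable_vcons.
apply: eq_measurable_fun (measurable_fun_xsection (@volm d) mcB) => x _.
by congr (volm _); apply/seteqP; split => y; rewrite /xsection/= ?inE.
Qed.

(** Uniqueness of Lebesgue measure: the scaled push-forward has the right value on half-open
    intervals. For negative [s] the preimage is half-open on the other side, hence two cases. *)
Lemma lebesgue_measure_affine (s v : R) (A : set (measurableTypeR R)) :
  (s != 0)%R -> measurable A ->
  (`|s|%:E * lebesgue_measure ((fun x => s * x + v)%R @^-1` A) = lebesgue_measure A).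
Proof.
move=> s0 mA.
have mf : measurable_fun setT ((fun x => s * x + v)%R : measurableTypeR R -> measurableTypeR R).
  by apply: measurable_funD => //; exact: measurable_funM.
pose m := mscale (NngNum (normr_ge0 s)) (pushm (@lebesgue_measure R) mf).
transitivity (m A); first by [].
apply/esym/lebesgue_measure_unique => // _ [[a b]] _ <-.
change (lebesgue_measure `]a, b]%classic = `|s|%:E *
  lebesgue_measure ((fun x : measurableTypeR R => (s * x + v)%R) @^-1` `]a, b]%classic)).
case: (ltP 0 s)%R => [sp|]; last rewrite le_eqVlt (negPf s0)/= => sn.
- rewrite [X in _ * lebesgue_measure X](_ : _ = `]((a - v) / s)%R, ((b - v) / s)%R]%classic); last first.
    apply/seteqP; split => x /=; rewrite !in_itv/= ltr_pdivrMr// ler_pdivlMr// (mulrC x).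
      move=> /andP[h1 h2]; apply/andP; split; lra.
    by move=> /andP[? ?]; apply/andP; split; lra.
  rewrite !lebesgue_measure_itv/= !lte_fin ltr_pM2r ?invr_gt0// ltrBlDr subrK.
  case: ifP => ab; last by rewrite mule0.
  rewrite -!EFinB -EFinM gtr0_norm//; congr (_%:E); field; lra.
- rewrite [X in _ * lebesgue_measure X](_ : _ = `[((b - v) / s)%R, ((a - v) / s)%R[%classic); last first.
    apply/seteqP; split => x /=; rewrite !in_itv/= ltr_ndivlMr// ler_ndivrMr// (mulrC x).
      by move=> /andP[? ?]; apply/andP; split; lra.
    by move=> /andP[? ?]; apply/andP; split; lra.
  rewrite !lebesgue_measure_itv/= !lte_fin ltr_nM2r ?invr_lt0// ltrBlDr subrK.
  case: ifP => ab; last by rewrite mule0.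
  rewrite -!EFinB -EFinM ltr0_norm//; congr (_%:E); field; lra.
Qed.

Lemma ge0_integral_affine (s v : R) (f : measurableTypeR R -> \bar R) :
  (s != 0)%R -> measurable_fun setT f -> (forall x, 0 <= f x) ->
  `|s|%:E * \int[lebesgue_measure]_x f (s * x + v)%R = \int[lebesgue_measure]_x f x.
Proof.
move=> s0 mf f0.
have ma : measurable_fun setT ((fun x => s * x + v)%R : measurableTypeR R -> measurableTypeR R).
  by apply: measurable_funD => //; exact: measurable_funM.
pose m := mscale (NngNum (normr_ge0 s)) (pushm (@lebesgue_measure R) ma).
transitivity (\int[m]_x f x).
  by rewrite ge0_integral_mscale//= ge0_integral_pushm.
apply: eq_measure_integral => A mA _.
exact: lebesgue_measure_affine.
Qed.

Lemma measurable_affine d (s : R) (v : 'rV[R]_d) :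
  measurable_fun setT (fun x : RV R d => (s *: (x : 'rV[R]_d) + v)%R : RV R d).
Proof. by apply: measurable_RVD => //; exact: measurable_RVZ. Qed.

(** Induction on the dimension: the outer integral yields one factor [|s|] by substitution, and each
    section of the preimage is the affine preimage of a section of [A]. *)
Lemma volm_affine d (s : R) (v : 'rV[R]_d) (A : set (RV R d)) :
  (s != 0)%R -> measurable A ->
  (`|s| ^+ d)%:E * volm ((fun x : RV R d => (s *: (x : 'rV[R]_d) + v)%R : RV R d) @^-1` A)
  = volm A.
Proof.
move=> s0; elim: d v A => [|d ih] v A mA.
  rewrite expr0 mul1e; congr volm; apply/seteqP; split => x /=;
    by rewrite (_ : (s *: x + v)%R = x)//; apply/rowP => -[].
pose v0 := v ord0 ord0; pose v' : 'rV[R]_d := \row_i v ord0 (lift ord0 i).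
have mA' := measurable_preim (measurable_affine s v) mA.
have mg := measurable_volm_rsection mA'.
rewrite !volmS exprSr EFinM -muleA.
rewrite -(ge0_integral_affine v0 s0 (measurable_volm_rsection mA))//.
rewrite muleCA -ge0_integralZl//.
congr (_ * _).
apply: eq_integral => x _; rewrite -[RHS](ih v'); last exact: measurable_rsection.
congr (_ * volm _); apply/seteqP.
suff E y : (s *: (vcons (x : measurableTypeR R, y) : 'rV[R]_d.+1) + v)%R =
    vcons ((s * x + v0)%R : measurableTypeR R, (s *: y + v')%R : RV R d).
  by split => y; rewrite !rsectionE /= E.
apply/rowP => i; case: (unliftP ord0 i) => [j ->|->].
  rewrite [LHS]mxE [X in (X + _)%R]mxE.
  apply: etrans (esym (vconsS _ _)); rewrite /= [in RHS]mxE [X in _ = (X + _)%R]mxE.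
  by rewrite [X in _ = (_ + X)%R]mxE; congr (s * _ + _)%R; exact: vconsS.
rewrite [LHS]mxE [X in (X + _)%R]mxE.
apply: etrans (esym (vcons0 _)) => /=.
by congr (s * _ + _)%R; exact: vcons0.
Qed.

End volume.

(** * Euclidean balls and convex bodies *)

Section geometry.
Context {R : realType}.
Local Open Scope ereal_scope.

Lemma eucl_norm_ge0 d (x : 'rV[R]_d) : (0 <= eucl_norm x)%R.
Proof. exact: sqrtr_ge0. Qed.

Lemma eucl_normZ d (s : R) (x : 'rV[R]_d) :
  (eucl_norm (s *: x) = `|s| * eucl_norm x)%R.
Proof.
rewrite /eucl_norm; under eq_bigr do rewrite mxE exprMn.
by rewrite -mulr_sumr sqrtrM ?sqr_ge0// sqrtr_sqr.
Qed.

Lemma eucl_normN d (x : 'rV[R]_d) : eucl_norm (- x)%R = eucl_norm x.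
Proof. by rewrite -scaleN1r eucl_normZ normrN normr1 mul1r. Qed.

Lemma eucl_distC d (x y : 'rV[R]_d) : eucl_norm (x - y)%R = eucl_norm (y - x)%R.
Proof. by rewrite -eucl_normN opprB. Qed.

Lemma coord_le_eucl d (x : 'rV[R]_d) i : (`|x ord0 i| <= eucl_norm x)%R.
Proof.
rewrite -sqrtr_sqr ler_sqrt ?sumr_ge0// => [|j _]; last exact: sqr_ge0.
by rewrite (bigD1 i)//= lerDl sumr_ge0// => j _; exact: sqr_ge0.
Qed.

Lemma eucl_norm_eq0 d (x : 'rV[R]_d) : eucl_norm x = 0%R -> x = 0%R.
Proof.
move=> x0; apply/rowP => i; rewrite mxE; apply/normr0_eq0.
by apply/eqP; rewrite eq_le normr_ge0 andbT -x0 coord_le_eucl.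
Qed.

(* Cauchy--Schwarz through the discriminant of [t |-> |x + t y|^2]. *)
Lemma eucl_normD d (x y : 'rV[R]_d) :
  (eucl_norm (x + y) <= eucl_norm x + eucl_norm y)%R.
Proof.
have sq (z : 'rV[R]_d) : (eucl_norm z ^+ 2 = \sum_(i < d) z ord0 i ^+ 2)%R.
  by rewrite sqr_sqrtr// sumr_ge0// => i _; exact: sqr_ge0.
have [y0|yn0] := eqVneq (eucl_norm y) 0%R.
  by rewrite (eucl_norm_eq0 y0) addr0 lerDl eucl_norm_ge0.
have yp : (0 < eucl_norm y)%R by rewrite lt_def yn0 eucl_norm_ge0.
set p := (\sum_(i < d) x ord0 i * y ord0 i)%R.
have E t : (eucl_norm (x + t *: y) ^+ 2 =
    eucl_norm x ^+ 2 + 2 * t * p + t ^+ 2 * eucl_norm y ^+ 2)%R.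
  rewrite !sq !mulr_sumr -!big_split/=; apply: eq_bigr => i _.
  by rewrite !mxE; ring.
have E0 t : (0 <= eucl_norm x ^+ 2 + 2 * t * p + t ^+ 2 * eucl_norm y ^+ 2)%R.
  by rewrite -E sqr_ge0.
have CS : (p <= eucl_norm x * eucl_norm y)%R.
  have := E0 (- (eucl_norm x / eucl_norm y))%R.
  rewrite sqrrN expr_div_n divfK ?expf_neq0// => h.
  suff : (0 <= 2 * eucl_norm x * (eucl_norm x * eucl_norm y - p))%R.
    have [x0|xn0] := eqVneq (eucl_norm x) 0%R.
      have -> : p = 0%R.
        by rewrite /p (eucl_norm_eq0 x0) big1// => i _; rewrite mxE mul0r.
      by rewrite x0 mul0r.
    by rewrite pmulr_rge0 ?mulr_gt0// ?lt_def ?xn0 ?eucl_norm_ge0// subr_ge0.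
  move: (mulr_ge0 h (ltW yp)); congr (_ <= _)%R; field; exact: yn0.
rewrite -(@ler_pXn2r _ 2)// ?nnegrE ?addr_ge0 ?eucl_norm_ge0//.
have := E 1%R; rewrite scale1r => ->; nra.
Qed.

Lemma eucl_distD d (z x y : 'rV[R]_d) :
  (eucl_norm (x - y) <= eucl_norm (x - z) + eucl_norm (z - y))%R.
Proof. by apply: le_trans (eucl_normD _ _); rewrite addrA subrK. Qed.

Definition cube d (M : R) : set (RV R d) :=
  [set x | forall i, (`|(x : 'rV[R]_d) ord0 i| <= M)%R].

Lemma measurable_cube d M : measurable (@cube d M).
Proof.
rewrite (_ : @cube d M = \bigcap_(i in [set: 'I_d])
   (fun x : RV R d => (x : 'rV[R]_d) ord0 i) @^-1` `[(- M)%R, M]%classic).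
  apply: fin_bigcap_measurable => // i _.
  exact: measurable_preim (@measurable_coord R d i) _.
by apply/seteqP; split => x /= h i; have := h i; rewrite /= in_itv/= -ler_norml//; exact.
Qed.

Lemma volm_cube d M : volm (@cube d M) < +oo.
Proof.
elim: d => [|d ih]; first by rewrite /volm/=; case: ifP => _; rewrite ltry.
rewrite volmS.
have E (x : R) : volm (rsection (@cube d.+1 M) x : set (RV R d)) =
    (\1_(`[(- M)%R, M]%classic) x)%:E * volm (@cube d M).
  rewrite indicE; have [|] := boolP (x \in `[(- M)%R, M]%classic).
    rewrite inE /= in_itv/= -ler_norml => xM; rewrite mul1e; congr volm.
    rewrite rsectionE; apply/seteqP; split => y /= h i.
      by have := h (lift ord0 i); rewrite vconsS.
    by case: (unliftP ord0 i) => [j ->|->]; rewrite ?vconsS ?vcons0.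
  move=> xM; rewrite mul0e (_ : rsection _ _ = set0) ?measure0//.
  rewrite rsectionE -subset0 => y /= /(_ ord0); rewrite vcons0/= ler_norml => h.
  by move: xM; rewrite notin_setE/= in_itv.
under eq_integral do rewrite E.
rewrite ge0_integralZr//; last exact/measurable_EFinP/measurable_indic.
rewrite integral_indic// setIT.
change (lebesgue_measure `[(- M)%R, M]%classic * volm (@cube d M) < +oo).
rewrite lebesgue_measure_itv/= lte_mul_pinfty//.
- by case: ifP => // MM; rewrite -EFinB lee_fin subr_ge0; apply: ltW; rewrite -lte_fin.
- by case: ifP.
Qed.

Definition eball d (r : R) : set (RV R d) :=
  [set u | (eucl_norm (u : 'rV[R]_d) <= r)%R].

Lemma measurable_eball d r : measurable (@eball d r).
Proof.
rewrite (_ : eball r = (fun u : RV R d => eucl_norm (u : 'rV[R]_d)) @^-1` `]-oo, r]%classic).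
  exact: measurable_preim (@measurable_eucl_norm R d) _.
by apply/seteqP; split => x; rewrite /= in_itv.
Qed.

(** The enclosing cube shows the volume to be finite, so that the [fine] in [kappa] loses nothing;
    the rest is scaling from the unit ball. *)
Lemma volm_eball d r : (0 < r)%R -> volm (@eball d r) = (kappa R d * r ^+ d)%:E.
Proof.
move=> r0; have E : volm (@eball d 1%R) = (kappa R d)%:E.
  rewrite /kappa fineK// ge0_fin_numE; last exact: (measure_ge0 (@volm R d)).
  apply: le_lt_trans (volm_cube d 1).
  apply: (@le_measure _ _ _ (@volm R d)); rewrite ?inE.
  - exact: measurable_eball.
  - exact: measurable_cube.
  by move=> x /= x1 i; apply: le_trans x1; exact: coord_le_eucl.
have := volm_affine (0%R : 'rV[R]_d) (invr_neq0 (lt0r_neq0 r0)) (@measurable_eball d 1%R).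
rewrite E gtr0_norm ?invr_gt0// (_ : _ @^-1` _ = eball r); last first.
  apply/seteqP; split => x /=; rewrite /eball/= addr0 eucl_normZ gtr0_norm ?invr_gt0//;
    by rewrite ler_pdivrMl// mulr1.
have fin : volm (@eball d r) \is a fin_num.
  rewrite ge0_fin_numE//; apply: le_lt_trans (volm_cube d r).
  apply: le_measure; rewrite ?inE.
  - exact: measurable_eball.
  - exact: measurable_cube.
  by move=> x /= x1 i; apply: le_trans x1; exact: coord_le_eucl.
rewrite -(fineK fin) -EFinM => -[] <-; congr (_%:E).
by rewrite mulrAC exprVn mulVf ?mul1r// expf_neq0// gt_eqF.
Qed.

Lemma kappa_ge0 d : (0 <= kappa R d)%R.
Proof. by rewrite /kappa fine_ge0//; exact: (measure_ge0 (@volm R d)). Qed.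

Lemma volm_shift d (v : 'rV[R]_d) (A : set (RV R d)) : measurable A ->
  volm ((fun x : RV R d => ((x : 'rV[R]_d) + v)%R : RV R d) @^-1` A) = volm A.
Proof.
move=> mA; rewrite -[RHS](volm_affine v (oner_neq0 _) mA) normr1 expr1n mul1e.
by congr volm; apply/seteqP; split => x /=; rewrite scale1r.
Qed.

Lemma convex_setP d (K : set 'rV[R]_d) : convex_set K ->
  forall (l : R) (x y : 'rV[R]_d), (0 <= l <= 1)%R -> K x -> K y ->
  K (l *: x + (1 - l) *: y)%R.
Proof.
move=> cK l x y /andP[l0 l1] Kx Ky.
have := cK x y (Itv01 l0 l1); rewrite !inE => /(_ Kx Ky).
by rewrite /conv/=.
Qed.

(* The translates [(K + j v) \ (K + (j + 1) v)] of [K \ (K + v)] are pairwise disjoint by convexity, so that about [1/|v|] of them fit into a fixed cube. *)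
Lemma volm_convex_shift d (K : set 'rV[R]_d) :
  compact K -> convex_set K -> exists2 C : R, (0 <= C)%R &
  forall v : 'rV[R]_d,
    volm ([set x | K x /\ ~ K (x - v)%R] : set (RV R d)) <= (C * eucl_norm v)%:E.
Proof.
move=> kK cK.
have clK : closed K by apply: compact_closed => //; exact: norm_hausdorff.
have mK : measurable (K : set (RV R d)).
  rewrite -[K]setCK; apply: measurableC; apply: sub_sigma_algebra => /=.
  exact: closed_openC.
have [M M0 KM] : exists2 M : R, (0 <= M)%R & K `<=` @cube d M.
  have [M [Mr KM]] := compact_bounded kK.
  exists (`|M| + 1)%R => [|x Kx i]; first by rewrite addr_ge0.
  have : (`|x| <= `|M| + 1)%R.
    by apply: KM => //; rewrite (le_lt_trans (ler_norm _))// ltrDl.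
  apply: le_trans; rewrite [leRHS]/Num.norm/= mx_normrE.
  apply/bigmax_geP; right => /=.
  by exists (ord0, i).
pose D (v : 'rV[R]_d) j : set (RV R d) :=
  [set x | K ((x : 'rV[R]_d) - v *+ j)%R /\ ~ K ((x : 'rV[R]_d) - v *+ j.+1)%R].
have mD v j : measurable (D v j).
  have mv (w : 'rV[R]_d) : measurable_fun setT
      (fun x : RV R d => ((x : 'rV[R]_d) - w)%R : RV R d) by exact: measurable_RVD.
  apply: measurableI; first exact: (measurable_preim (mv _) mK).
  exact: measurableC (measurable_preim (mv _) mK).
have D0E v : [set x | K x /\ ~ K (x - v)%R] = D v 0%N.
  by apply/seteqP; split => x; rewrite /D /= mulr0n subr0 mulr1n.
have vD v j : volm (D v j) = volm (D v 0%N).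
  rewrite -(volm_shift (v *+ j)%R (mD v j)); congr volm.
  apply/seteqP; split => x; rewrite /D/= addrK mulr0n subr0 mulr1n mulrS opprD;
  by rewrite addrACA subrr addr0.
have dD v : trivIset setT (D v).
  apply/trivIsetP => i j _ _; wlog ij : i j / (i < j)%N.
    move=> h; rewrite neq_ltn => /orP[ij|ij]; first by apply: h => //; rewrite neq_ltn ij.
    by rewrite setIC; apply: h => //; rewrite neq_ltn ij.
  move=> _; rewrite -subset0 => x [[K1 nK] [K2 _]]; apply: nK.
  (* The point [x - (i + 1) v] lies on the segment from [x - i v] to [x - j v], whose ends are both
     in [K]. *)
  pose l : R := ((j - i.+1)%:R / (j - i)%:R)%R.
  have ji0 : ((j - i)%:R != 0 :> R)%R by rewrite pnatr_eq0; lia.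
  have -> : (x - v *+ i.+1 = l *: (x - v *+ i) + (1 - l) *: (x - v *+ j))%R.
    have -> : (v *+ j = v *+ i + (j - i)%:R *: v)%R.
      by rewrite scaler_nat -mulrnDr; congr (_ *+ _)%R; lia.
    have -> : (v *+ i.+1 = v *+ i + v)%R by rewrite mulrSr.
    rewrite !opprD !addrA; move: (x - v *+ i)%R => y.
    rewrite scalerBr addrA -scalerDl subrKC scale1r scalerA.
    rewrite (_ : _ * _ = 1)%R ?scale1r// /l subnS -subn1 natrB ?subn_gt0//.
    by field.
  apply: convex_setP => //; rewrite divr_ge0//= ler_pdivrMr ?mul1r ?ler_nat ?ltr0n; lia.
have [B B0 vB] : exists2 B : R, (0 <= B)%R & volm (@cube d (M + 1)) = B%:E.
  exists (fine (volm (@cube d (M + 1)))); first exact/fine_ge0/measure_ge0.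
  by rewrite fineK// ge0_fin_numE// volm_cube.
exists B => // v; rewrite D0E.
have Dfin : volm (D v 0%N) \is a fin_num.
  rewrite ge0_fin_numE//; apply: le_lt_trans (volm_cube d M).
  apply: le_measure; rewrite ?inE//; first exact: measurable_cube.
  by rewrite -D0E => x [/KM].
have [v0|vn0] := eqVneq (eucl_norm v) 0%R.
  rewrite v0 mulr0 (_ : D v 0%N = set0) ?measure0//.
  by rewrite -subset0 -D0E => x []; rewrite (eucl_norm_eq0 v0) subr0.
have vp : (0 < eucl_norm v)%R by rewrite lt_def vn0 eucl_norm_ge0.
(* For [j < J] the hypothesis gives [j |v| <= 1], so the [j]-th translate stays in the cube enlarged
   by one. *)
have bnd J : (J%:R * eucl_norm v <= 1 + eucl_norm v)%R ->
    J%:R%:E * volm (D v 0%N) <= B%:E.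
  move=> Jv; rewrite -vB.
  apply: (@le_trans _ _ (volm (\big[setU/set0]_(i < J) D v i))); last first.
    apply: le_measure; rewrite ?inE.
    - exact: bigsetU_measurable.
    - exact: measurable_cube.
    move=> x; rewrite -bigcup_mkord => -[j /= jJ [Kx _]] i.
    have := KM _ Kx i; rewrite !mxE => h.
    rewrite -(subrK ((v *+ j)%R ord0 i) ((x : 'rV[R]_d) ord0 i)) (le_trans (ler_normD _ _))// lerD//.
    have -> : (v *+ j)%R ord0 i = (v ord0 i *+ j)%R by rewrite mulmxnE.
    rewrite normrMn -mulr_natl.
    apply: (@le_trans _ _ (j%:R * eucl_norm v)%R).
      by rewrite ler_wpM2l ?ler0n// coord_le_eucl.
    suff : (j.+1%:R * eucl_norm v <= 1 + eucl_norm v)%R by rewrite -natr1; lra.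
    by apply: le_trans Jv; rewrite ler_wpM2r ?eucl_norm_ge0// ler_nat.
  suff -> : volm (\big[setU/set0]_(i < J) D v i) = J%:R%:E * volm (D v 0%N) by [].
  transitivity (\sum_(i < J) volm (D v i)).
    apply: measure_semi_additive_ord => //; last exact: bigsetU_measurable.
    by apply/trivIsetP => i j _ _ ij; move/trivIsetP : (dD v); exact.
  under eq_bigr do rewrite vD -(fineK Dfin).
  by rewrite sumEFin sumr_const card_ord -{2}(fineK Dfin) -EFinM mulr_natl.
(* This number of translates exceeds [1 / |v|], so each of them has volume at most [B |v|]. *)
have := bnd (Num.truncn (eucl_norm v)^-1).+1.
rewrite -natr1 mulrDl mul1r lerD2r -ler_pdivlMr// mul1r truncn_le invr_ge0 eucl_norm_ge0.
move=> /(_ isT); rewrite natr1 -(fineK Dfin) -EFinM !lee_fin => h.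
have Jv := truncnS_gt (eucl_norm v)^-1.
rewrite -ler_pdivrMr//; apply: le_trans h; rewrite mulrC ler_wpM2r ?(ltW Jv)//.
by rewrite fine_ge0.
Qed.

End geometry.

(** * Configurations and midpoints *)

Section nat_valued.
Context {R : realType} d (T : measurableType d).

Lemma measurable_fun_nat2 d' (T' : measurableType d') (f g : T -> nat)
    (F : nat -> nat -> T') :
  measurable_fun setT f -> measurable_fun setT g ->
  measurable_fun setT (fun w => F (f w) (g w)).
Proof.
move=> mf mg _ A mA; rewrite setTI.
rewrite (_ : _ @^-1` A = \bigcup_i \bigcup_j
    (if `[< A (F i j) >] then f @^-1` [set i] `&` g @^-1` [set j] else set0)).
  apply: bigcupT_measurable => i; apply: bigcupT_measurable => j.
  by case: ifP => // _; apply: measurableI; exact: measurable_preim.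
apply/seteqP; split => [w Aw|w [i _ [j _]]].
  by exists (f w) => //; exists (g w) => //; rewrite asboolT.
by case: asboolP => // AF [/= -> ->].
Qed.

Lemma measurable_fun_nat1 d' (T' : measurableType d') (f : T -> nat)
    (F : nat -> T') :
  measurable_fun setT f -> measurable_fun setT (fun w => F (f w)).
Proof. by move=> mf; exact: (measurable_fun_nat2 (fun i _ => F i) mf mf). Qed.

Lemma measurable_fun_natE (f : T -> nat) :
  measurable_fun setT (fun w => (f w)%:R%:E : \bar R) -> measurable_fun setT f.
Proof.
move=> mf _ A _; rewrite setTI.
rewrite (_ : f @^-1` A = \bigcup_(i in A)
    (fun w => (f w)%:R%:E : \bar R) @^-1` [set i%:R%:E]).
  by apply: bigcup_measurable => i _; apply: measurable_preim mf _; exact: emeasurable_set1.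
apply/seteqP; split => [w Aw|w [i Ai] /= []]; first by exists (f w).
by move=> /eqP; rewrite eqr_nat /= => /eqP ->.
Qed.

Lemma measurable_fun_setE (f : T -> bool) :
  measurable [set w | f w] -> measurable_fun setT f.
Proof.
move=> mf; apply: (measurable_fun_bool true).
by rewrite setTI (_ : _ @^-1` _ = [set w | f w])//; apply/seteqP; split => w //= ->.
Qed.

End nat_valued.

Section config_measurability.
Context {R : realType} {d : nat}.
Implicit Types (s : Config R d) (A B : set (RV R d)).

Definition cdist (x y : RV R d) : R := eucl_norm ((x : 'rV[R]_d) - y).
Definition closeb (r : R) (x y : RV R d) : bool := cdist x y <= r.
Definition mid (x y : RV R d) : RV R d := 2^-1 *: ((x : 'rV[R]_d) + y).

Lemma cdistC x y : cdist x y = cdist y x.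
Proof. exact: eucl_distC. Qed.

Lemma closebC r x y : closeb r x y = closeb r y x.
Proof. by rewrite /closeb cdistC. Qed.

Lemma midC x y : mid x y = mid y x.
Proof. by rewrite /mid addrC. Qed.

Lemma cnt_cons A x s : cnt A (x :: s) = (`[< A x >] + cnt A s)%N.
Proof. by []. Qed.

Lemma cnt_cat A s s' : cnt A (s ++ s') = (cnt A s + cnt A s')%N.
Proof. exact: count_cat. Qed.

Lemma cntT s : cnt setT s = size s.
Proof. by rewrite /cnt (eq_count (a2 := predT)) ?count_predT// => x; rewrite /= asboolT. Qed.

Lemma cnt_le_size A s : (cnt A s <= size s)%N.
Proof. exact: count_size. Qed.

Lemma cnt_perm A s s' : perm_eq s s' -> cnt A s = cnt A s'.
Proof. by move/permP; exact. Qed.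

Lemma midpoints_rows r s : midpoints r s =
  flatten [seq [seq mid (nth 0 s i) (nth 0 s j)
    | j <- iota 0 (size s) & (i < j)%N && closeb r (nth 0 s i) (nth 0 s j)]
    | i <- iota 0 (size s)].
Proof.
rewrite /midpoints filter_flatten map_flatten -!map_comp; congr flatten.
by apply: eq_map => i /=; rewrite filter_map -map_comp.
Qed.

(** Index [0] contributes the pairs of [x] with [s], and all other indices shift down by one. This
    recursion on lists stands in for the index-based definition in what follows. *)
Lemma midpoints_cons r (x : RV R d) s :
  midpoints r (x :: s : config R d) =
  [seq mid x y | y <- s & closeb r x y] ++ midpoints r s.
Proof.
rewrite !midpoints_rows /= -[1%N]/(1 + 0)%N iotaDl -!map_comp; congr (_ ++ _).
  rewrite filter_map -map_comp -[in RHS](mkseq_nth (0 : RV R d) s) /mkseq.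
  by rewrite filter_map -map_comp; congr map; exact: eq_filter.
congr flatten; apply: eq_map => i /=.
by rewrite filter_map -map_comp; congr map; exact: eq_filter.
Qed.

Definition cmid (A : set (RV R d)) r x y : nat := closeb r x y && `[< A (mid x y) >].

Lemma cmidC A r x y : cmid A r x y = cmid A r y x.
Proof. by rewrite /cmid closebC midC. Qed.

Lemma cnt_midpoints_cons A r (x : RV R d) s :
  cnt A (midpoints r (x :: s : config R d)) =
  (\sum_(y <- s) cmid A r x y + cnt A (midpoints r s))%N.
Proof.
rewrite midpoints_cons cnt_cat; congr addn.
rewrite /cnt count_map count_filter -sum1_count big_mkcond/=.
by apply: eq_bigr => y _; rewrite /cmid andbC; case: (_ && _).
Qed.

(** Double counting: the sum over all ordered pairs sees each close pair twice, plus the diagonal.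
    It expresses the count of midpoints through symmetric sums over the configuration, whose
    measurability is accessible. *)
Lemma sum_cmid A r s :
  (\sum_(x <- s) \sum_(y <- s) cmid A r x y =
   (cnt A (midpoints r s)).*2 + \sum_(x <- s) cmid A r x x)%N.
Proof.
elim: s => [|x s ih]; first by rewrite !big_nil.
have E : (\sum_(j <- s) \sum_(y <- x :: s) cmid A r j y =
    \sum_(j <- s) cmid A r x j + \sum_(j <- s) \sum_(y <- s) cmid A r j y)%N.
  by rewrite -big_split/=; apply: eq_bigr => j _; rewrite big_cons cmidC.
rewrite !big_cons cnt_midpoints_cons E ih doubleD; lia.
Qed.

(** Configurations are lists, but counts do not see their order; the permutation-invariant sets form
    a sigma-algebra that contains the generators. This is what allows points to be reordered in the
    Mecke formula. *)
Lemma measurable_config_invariant (D : set (Config R d)) s s' :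
  measurable D -> perm_eq s s' -> D s -> D s'.
Proof.
move=> mD ss'; suff : (D s <-> D s') by case.
pose I : set (set (Config R d)) := [set D | forall s s', perm_eq s s' -> D s <-> D s'].
suff : I D by exact.
move: D mD; apply: smallest_sub; last first.
  by move=> _ [B [k [_ ->]]] t t' tt'; rewrite /= (cnt_perm _ tt').
split => // [A IA t t' tt'|F IF t t' tt'].
  by rewrite setTD; have := IA _ _ tt'; rewrite /setC/=; tauto.
by split => -[i _ Fi]; exists i => //; [exact/(IF i _ _ tt')|exact/(IF i _ _ tt')].
Qed.

Lemma measurable_fun_invariant (f : Config R d -> \bar R) s s' :
  measurable_fun setT f -> perm_eq s s' -> f s = f s'.
Proof.
move=> mf ss'; apply/esym.
apply: (@measurable_config_invariant (f @^-1` [set f s]) s s') => //.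
by apply: measurable_preim mf _; exact: emeasurable_set1.
Qed.

Lemma measurable_cnt B : measurable B ->
  measurable_fun setT (cnt B : Config R d -> nat).
Proof.
move=> mB _ A _; rewrite setTI.
rewrite (_ : _ @^-1` A = \bigcup_(i in A) cnt B @^-1` [set i]).
  by apply: bigcup_measurable => i _; apply: sub_sigma_algebra; exists B, i.
apply/seteqP; split => [t At|t [i Ai] /= ti]; first by exists (cnt B t).
by rewrite /= ti.
Qed.

Lemma measurable_fun_config dT (T : measurableType dT) (f : T -> Config R d) :
  (forall B, measurable B -> measurable_fun setT (fun w => cnt B (f w))) ->
  measurable_fun setT f.
Proof.
move=> mf; apply: (@measurability _ _ _ (Config R d) setT f _ erefl).
move=> _ [_ [B [k [mB ->]]] <-].
by rewrite setTI; exact: (measurable_preim (mf B mB) (A := [set k])).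
Qed.

Definition ptm s : {measure set RV R d -> \bar R} :=
  msum (fun i => \d_(nth (0 : RV R d) s i)) (size s).

Lemma cnt_sum A s : cnt A s = (\sum_(x <- s) `[< A x >])%N.
Proof. by rewrite /cnt -sum1_count big_mkcond; apply: eq_bigr => x _; case: asboolP. Qed.

Lemma ptmE s A : ptm s A = (cnt A s)%:R%:E.
Proof.
rewrite cnt_sum (big_nth (0 : RV R d)) big_mkord natr_sum -sumEFin.
apply: eq_bigr => i _; change (\d_(nth (0 : RV R d) s i) A = (`[< A (nth 0 s i) >] : nat)%:R%:E :> \bar R).
by rewrite diracE; case: asboolP => h; [rewrite mem_set|rewrite memNset].
Qed.

Lemma integral_ptm s (f : RV R d -> \bar R) :
  measurable_fun setT f -> (forall x, (0 <= f x)%E) ->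
  (\int[ptm s]_x f x = \sum_(x <- s) f x)%E.
Proof.
move=> mf f0; rewrite /ptm ge0_integral_measure_sum//.
under eq_bigr do rewrite integral_dirac// diracT mul1e.
by rewrite [RHS](big_nth (0 : RV R d)) big_mkord.
Qed.

(** * Sums over the points of a random configuration, as kernel integrals *)

Section sum_over_config.
Import HBNNSimple.
Context dT (T : measurableType dT) (g : T -> Config R d) (mg : measurable_fun setT g).

Definition kptm (w : T) : {measure set RV R d -> \bar R} := ptm (g w).

Let measurable_kptm U : measurable U -> measurable_fun setT (kptm ^~ U).
Proof.
move=> mU; under eq_fun do rewrite /kptm ptmE.
apply: (measurable_fun_nat1 (fun n => n%:R%:E : \bar R)).
exact: (measurableT_comp (measurable_cnt mU) mg).
Qed.

HB.instance Definition _ := isKernel.Build _ _ _ _ R kptm measurable_kptm.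

Lemma measurable_sum_config (h : T * RV R d -> \bar R) :
  measurable_fun setT h -> (forall z, (0 <= h z)%E) ->
  measurable_fun setT (fun w => \sum_(x <- g w) h (w, x))%E.
Proof.
move=> mh h0.
apply: (eq_measurable_fun (fun w => \int[kptm w]_x h (w, x))%E) => [w _|].
  by rewrite integral_ptm//; exact: measurableT_comp.
pose h_ := nnsfun_approx measurableT mh.
apply: (measurable_fun_xsection_integral h _ h_).
- by move=> a b ab; exact/nd_nnsfun_approx.
- by move=> z; exact/cvg_nnsfun_approx.
- move=> n r.
  suff H (A : set (T * RV R d)) : measurable A ->
      measurable_fun setT (fun w => kptm w (xsection A w)).
    by apply: H; exact: measurable_funPTI.
  move=> mA; have bnd w : exists M : R, forall U, measurable U ->
      (mrestr (kptm w) measurableT U < M%:E)%E.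
    exists (size (g w)).+1%:R => U mU.
    by rewrite /mrestr setIT /kptm ptmE lte_fin ltr_nat ltnS cnt_le_size.
  have [_ +] := measurable_prod_subset_xsection_kernel bnd mA.
  by apply: eq_measurable_fun => w _; rewrite /mrestr setIT.
Qed.

Lemma measurable_natsum_config (h : T * RV R d -> nat) :
  measurable_fun setT h -> measurable_fun setT (fun w => \sum_(x <- g w) h (w, x))%N.
Proof.
move=> mh; apply: (@measurable_fun_natE R).
apply: (eq_measurable_fun (fun w => \sum_(x <- g w) (h (w, x))%:R%:E)%E).
  by move=> w _; rewrite sumEFin natr_sum.
apply: (measurable_sum_config (h := fun z => (h z)%:R%:E)) => //.
exact: (measurable_fun_nat1 (fun n => n%:R%:E : \bar R)).
Qed.

End sum_over_config.

Lemma measurable_closeb dT (T : measurableType dT) (f g : T -> RV R d) r :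
  measurable_fun setT f -> measurable_fun setT g ->
  measurable_fun setT (fun w => closeb r (f w) (g w)).
Proof.
move=> mf mg; apply: measurable_fun_ler => //.
exact: (measurableT_comp (@measurable_eucl_norm R d) (measurable_RVB mf mg)).
Qed.

Lemma measurable_mid dT (T : measurableType dT) (f g : T -> RV R d) :
  measurable_fun setT f -> measurable_fun setT g ->
  measurable_fun setT (fun w => mid (f w) (g w)).
Proof. by move=> mf mg; apply: measurable_RVZ; exact: measurable_RVD. Qed.

Lemma measurable_cmid dT (T : measurableType dT) (f g : T -> RV R d) A r :
  measurable A -> measurable_fun setT f -> measurable_fun setT g ->
  measurable_fun setT (fun w => cmid A r (f w) (g w)).
Proof.
move=> mA mf mg; rewrite /cmid.
apply: (@measurableT_comp _ _ _ _ _ _ nat_of_bool) => //.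
apply: measurable_and; first exact: measurable_closeb.
apply: measurable_fun_setE.
rewrite (_ : mkset _ = (fun w => mid (f w) (g w)) @^-1` A).
  exact: measurable_preim (measurable_mid mf mg) mA.
by apply/seteqP; split => w /asboolP.
Qed.

(** By [sum_cmid], a count of midpoints is half the difference of two measurable sums; the
    subtraction in [nat] is exact there. *)
Lemma measurable_midpoints r :
  measurable_fun setT (midpoints r : Config R d -> Config R d).
Proof.
apply: measurable_fun_config => B mB.
have m2 : measurable_fun setT (fun s : Config R d =>
    \sum_(x <- s) \sum_(y <- s) cmid B r x y)%N.
  apply: (@measurable_natsum_config _ (Config R d) id (@measurable_id _ _ _)
    (fun z : Config R d * RV R d => \sum_(y <- z.1) cmid B r z.2 y)%N).
  apply: (@measurable_natsum_config _ _ fst measurable_fst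
    (fun z : (Config R d * RV R d) * RV R d => cmid B r z.1.2 z.2)).
  by apply: measurable_cmid => //; exact: measurableT_comp.
have m1 : measurable_fun setT (fun s : Config R d => \sum_(x <- s) cmid B r x x)%N.
  apply: (@measurable_natsum_config _ (Config R d) id (@measurable_id _ _ _)
    (fun z : Config R d * RV R d => cmid B r z.2 z.2)).
  exact: measurable_cmid.
apply: (eq_measurable_fun (fun s : Config R d =>
  ((\sum_(x <- s) \sum_(y <- s) cmid B r x y) - \sum_(x <- s) cmid B r x x)./2)%N).
  by move=> s _; rewrite sum_cmid addnK doubleK.
exact: (measurable_fun_nat2 (fun i j => (i - j)./2) m2 m1).
Qed.

Definition ccons (z : RV R d * Config R d) : Config R d := z.1 :: z.2.

Lemma measurable_ccons : measurable_fun setT ccons.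
Proof.
apply: measurable_fun_config => B mB.
apply: (measurable_fun_nat2 (T' := nat) addn).
  apply: (@measurableT_comp _ _ _ _ _ _ nat_of_bool) => //.
  apply: measurable_fun_setE.
  rewrite (_ : mkset _ = fst @^-1` B).
    exact: measurable_preim measurable_fst mB.
  by apply/seteqP; split => w /asboolP.
exact: (measurableT_comp (measurable_cnt mB)).
Qed.

Lemma measurable_fun_ccons dT (T : measurableType dT) (f : T -> RV R d) (g : T -> Config R d) :
  measurable_fun setT f -> measurable_fun setT g ->
  measurable_fun setT (fun w => f w :: g w : Config R d).
Proof.
by move=> mf mg; exact: (measurableT_comp measurable_ccons (measurable_fun_pair mf mg)).
Qed.

Lemma measurable_size : measurable_fun setT (size : Config R d -> nat).
Proof. by apply: eq_measurable_fun (measurable_cnt measurableT) => s _; rewrite cntT. Qed.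

End config_measurability.

(** * Independent points and the Mecke formula *)

Section integral_lemmas.
Context {R : realType} d (T : measurableType d).
Local Open Scope ereal_scope.

(* No measurability is needed: the integral of a nonnegative function is a supremum over the simple functions below it. *)
Lemma ge0_le_integralT (mu : {measure set T -> \bar R}) (f g : T -> \bar R) :
  (forall x, 0 <= f x) -> (forall x, f x <= g x) ->
  \int[mu]_x f x <= \int[mu]_x g x.
Proof.
move=> f0 fg; have g0 x : 0 <= g x by apply: le_trans (f0 x) (fg x).
rewrite !ge0_integralTE//; apply: le_ereal_sup => _ [h hf <-] /=.
by exists h => // x; apply: le_trans (hf x) (fg x).
Qed.

Lemma ge0_integral_cstl (mu : {measure set T -> \bar R}) (k : R) (f : T -> \bar R) :
  (0 <= k)%R -> measurable_fun setT f -> (forall x, 0 <= f x) ->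
  \int[mu]_x (k%:E * f x) = k%:E * \int[mu]_x f x.
Proof. by move=> k0 mf f0; rewrite ge0_integralZl// lee_fin. Qed.

Lemma measurable_fun_integral_snd d2 (T2 : measurableType d2)
    (m : {sigma_finite_measure set T2 -> \bar R}) (f : T * T2 -> \bar R) :
  measurable_fun setT f -> (forall z, 0 <= f z) ->
  measurable_fun setT (fun x => \int[m]_y f (x, y)).
Proof. by move=> mf f0; exact: measurable_fun_fubini_tonelli_F. Qed.

Lemma measurable_section d2 d3 (T2 : measurableType d2) (T3 : measurableType d3)
    (f : T * T2 -> T3) x :
  measurable_fun setT f -> measurable_fun setT (fun y => f (x, y)).
Proof. by move=> mf; apply: (measurableT_comp mf); exact: measurable_fun_pair. Qed.

End integral_lemmas.
Arguments measurable_fun_integral_snd {R d T d2 T2 m f}.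

Section iid_config.
Context {R : realType} {d : nat}.
Local Open Scope ereal_scope.
Implicit Types (m : {finite_measure set RV R d -> \bar R}).

Lemma pushm_ccons_fin m (mu : {finite_measure set Config R d -> \bar R}) :
  pushm (prodm m mu) (@measurable_ccons R d) setT < +oo.
Proof.
change (prodm m mu setT < +oo).
by rewrite prodmT lte_mul_pinfty// ?fin_num_measure// -ge0_fin_numE// fin_num_measure.
Qed.

(** The [n]-fold product of [m], carried by lists of length [n]. Only finiteness of [m] is required,
    since the sub-probability [m'] is also plugged in. *)
Fixpoint iid m (n : nat) : {finite_measure set Config R d -> \bar R} :=
  match n with
  | 0 => \d_([::] : Config R d)
  | n'.+1 => finm (pushm_ccons_fin m (iid m n'))
  end.

Lemma iid0 m (F : Config R d -> \bar R) : measurable_fun setT F ->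
  \int[iid m 0]_s F s = F [::].
Proof. by move=> mF; rewrite /= integral_dirac// diracT mul1e. Qed.

Lemma iidS m n (F : Config R d -> \bar R) :
  measurable_fun setT F -> (forall s, 0 <= F s) ->
  \int[iid m n.+1]_s F s = \int[m]_x \int[iid m n]_s F (x :: s : Config R d).
Proof.
move=> mF F0; rewrite /= /finm ge0_integral_pushm// ge0_integral_prodm//.
exact: (measurableT_comp mF (@measurable_ccons R d)).
Qed.

Lemma measurable_cons_fun (x : RV R d) (F : Config R d -> \bar R) :
  measurable_fun setT F -> measurable_fun setT (fun s : Config R d => F (x :: s : Config R d)).
Proof.
by move=> mF; apply: (measurableT_comp mF); exact: measurable_fun_ccons.
Qed.

Lemma measurable_int_iid m n (F : Config R d -> \bar R) :
  measurable_fun setT F -> (forall s, 0 <= F s) ->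
  measurable_fun setT (fun x : RV R d => \int[iid m n]_s F (x :: s : Config R d)).
Proof.
move=> mF F0.
apply: (measurable_fun_integral_snd (f := fun z : RV R d * Config R d => F (z.1 :: z.2))) => //.
exact: (measurableT_comp mF (@measurable_ccons R d)).
Qed.

Lemma eq_iid m n (F G : Config R d -> \bar R) :
  measurable_fun setT F -> measurable_fun setT G ->
  (forall s, 0 <= F s) -> (forall s, 0 <= G s) ->
  (forall s, size s = n -> F s = G s) ->
  \int[iid m n]_s F s = \int[iid m n]_s G s.
Proof.
elim: n F G => [|n ih] F G mF mG F0 G0 FG; first by rewrite !iid0// FG.
rewrite !iidS//; apply: eq_integral => x _; apply: ih => //.
- exact: measurable_cons_fun.
- exact: measurable_cons_fun.
- by move=> s sn; apply: FG; rewrite /= sn.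
Qed.

Lemma iid_measure m n : iid m n setT = (fine (m setT) ^+ n)%:E.
Proof.
elim: n => [|n ih]; first by rewrite /= diracT.
change (prodm m (iid m n) setT = (fine (m setT) ^+ n.+1)%:E).
rewrite prodmT exprS EFinM fineK ?fin_num_measure//.
by congr (_ * _); exact: ih.
Qed.

Lemma le_iid m1 m2 n (F : Config R d -> \bar R) :
  (forall A, measurable A -> m1 A <= m2 A) ->
  measurable_fun setT F -> (forall s, 0 <= F s) ->
  \int[iid m1 n]_s F s <= \int[iid m2 n]_s F s.
Proof.
move=> m12; elim: n F => [|n ih] F mF F0; first by rewrite !iid0.
rewrite !iidS//.
apply: (@le_trans _ _ (\int[m1]_x \int[iid m2 n]_s F (x :: s : Config R d))).
  apply: ge0_le_integralT => [x|x]; first exact: integral_ge0.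
  by apply: ih => //; exact: measurable_cons_fun.
apply: ge0_le_measure_integral => //.
- by move=> x; exact: integral_ge0.
- exact: measurable_int_iid.
Qed.

(** Each of the [n + 1] points plays the distinguished role equally often. The induction separates
    the first point: either it is the distinguished one ([I]), or another one is ([J]), and
    exchanging the two integrals shows that both have the same integral. *)
Lemma mecke m n (h : RV R d * Config R d -> \bar R) :
  measurable_fun setT h -> (forall z, 0 <= h z) ->
  \int[iid m n.+1]_s (\sum_(x <- s) h (x, s)) =
  n.+1%:R%:E * \int[m]_x \int[iid m n]_s h (x, x :: s : Config R d).
Proof.
have msum (f : RV R d * Config R d -> \bar R) : measurable_fun setT f ->
    (forall z, 0 <= f z) -> measurable_fun setT (fun s : Config R d => \sum_(x <- s) f (x, s)).
  move=> mf f0; apply: (@measurable_sum_config _ _ _ (Config R d) id (@measurable_id _ _ _)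
    (fun z : Config R d * RV R d => f (z.2, z.1))) => //.
  by apply: (measurableT_comp mf); exact: measurable_fun_pair.
have sum0 (f : RV R d * Config R d -> \bar R) : (forall z, 0 <= f z) ->
    forall (t s : Config R d), 0 <= \sum_(x <- t) f (x, s).
  by move=> f0 t s; exact: sume_ge0.
have mhcons (f : RV R d * Config R d -> \bar R) : measurable_fun setT f ->
    measurable_fun setT (fun z : RV R d * Config R d => f (z.1, z.1 :: z.2 : Config R d)).
  move=> mf; apply: (measurableT_comp mf); apply: measurable_fun_pair => //.
  exact: measurable_fun_ccons.
elim: n h => [|n ih] h mh h0.
  rewrite iidS//; [|exact: msum|by move=> s; exact: sum0].
  rewrite mul1e; apply: eq_integral => x _; rewrite !iid0//.
  - by rewrite big_seq1.
  - exact: (measurable_section x (mhcons _ mh)).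
  - exact: (measurable_cons_fun x (msum _ mh h0)).
have mc := mhcons _ mh.
rewrite iidS//; [|exact: msum|by move=> s; exact: sum0].
pose I (x : RV R d) : \bar R := \int[iid m n.+1]_s h (x, x :: s : Config R d).
pose J (x : RV R d) : \bar R := \int[m]_y \int[iid m n]_s h (y, y :: x :: s : Config R d).
have mcc : measurable_fun setT (fun z : (RV R d * RV R d) * Config R d =>
    h (z.1.2, z.1.2 :: z.1.1 :: z.2 : Config R d)).
  apply: (measurableT_comp mh); apply: measurable_fun_pair.
    exact: (measurableT_comp measurable_snd measurable_fst).
  apply: measurable_fun_ccons.
    exact: (measurableT_comp measurable_snd measurable_fst).
  apply: measurable_fun_ccons => //.
  exact: (measurableT_comp measurable_fst measurable_fst).
have mccI : measurable_fun setT (fun z : RV R d * RV R d =>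
    \int[iid m n]_s h (z.2, z.2 :: z.1 :: s : Config R d)).
  exact: (measurable_fun_integral_snd mcc).
have mI : measurable_fun setT I.
  exact: (measurable_fun_integral_snd mc).
have mJ : measurable_fun setT J.
  apply: (measurable_fun_integral_snd mccI) => // z; exact: integral_ge0.
transitivity (\int[m]_x (I x + n.+1%:R%:E * J x)).
  apply: eq_integral => x _.
  have mhx : measurable_fun setT (fun z : RV R d * Config R d => h (z.1, x :: z.2 : Config R d)).
    by apply: (measurableT_comp mh); apply: measurable_fun_pair => //; exact: measurable_fun_ccons.
  under eq_integral do rewrite big_cons.
  rewrite ge0_integralD//; last 3 first.
  - exact: (measurable_section _ mc).
  - by move=> s _; exact: sum0.
  - exact: (msum (fun z => h (z.1, x :: z.2 : Config R d)) mhx).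
  congr (_ + _).
  rewrite (ih (fun z => h (z.1, x :: z.2 : Config R d)))//.
  congr (_ * _); apply: eq_integral => y _; apply: eq_integral => s _ /=.
  (* The first two points come in the other order, which a measurable function of the configuration
     does not see. *)
  apply: (@measurable_fun_invariant _ _ (fun s : Config R d => h (y, s))).
    exact: (measurable_section _ mh).
  by apply/permP => p /=; lia.
rewrite ge0_integralD//; last 3 first.
- by move=> x _; exact: integral_ge0.
- by move=> x _; rewrite mule_ge0//; apply: integral_ge0 => y _; exact: integral_ge0.
- exact: measurable_funeM.
rewrite ge0_integral_cstl//; last first.
  by move=> x; apply: integral_ge0 => y _; exact: integral_ge0.
have -> : \int[m]_x J x = \int[m]_y I y.
  rewrite (fubini_tonelli _ mccI)//; last by move=> z; exact: integral_ge0.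
  apply: eq_integral => y _; rewrite /I iidS//.
  exact: (measurable_section _ mc).
by rewrite -{1}(mul1e (\int[m]_y I y)) -ge0_muleDl// -EFinD -[1%R]/1%:R -natrD add1n.
Qed.

End iid_config.

(** * Splitting off close pairs *)

Lemma measurable_setb d (T : measurableType d) (p : T -> bool) :
  measurable_fun setT p -> measurable [set x | p x].
Proof. by move=> mp; exact: (measurable_preim mp (A := [set true])). Qed.

Section indicators.
Context {R : realType}.
Local Open Scope ereal_scope.

Definition ind (b : bool) : \bar R := (b%:R)%:E.

Lemma ind_ge0 b : 0 <= ind b.
Proof. by case: b; rewrite /ind lee_fin. Qed.

Lemma ind_andb a b : ind (a && b) = ind a * ind b.
Proof. by case: a; case: b; rewrite /ind /= ?mul1e ?mul0e. Qed.

Lemma indT : ind true = 1. Proof. by []. Qed.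
Lemma indF : ind false = 0. Proof. by []. Qed.

Lemma measurable_ind d (T : measurableType d) (p : T -> bool) :
  measurable_fun setT p -> measurable_fun setT (fun w => ind (p w)).
Proof. by move=> mp; apply: (@measurableT_comp _ _ _ _ _ _ ind). Qed.

Lemma integral_ind d (T : measurableType d) (mu : {measure set T -> \bar R})
    (p : T -> bool) : measurable_fun setT p ->
  \int[mu]_x ind (p x) = mu [set x | p x].
Proof.
move=> mp; rewrite -[in RHS](setIT [set x | p x]) -integral_indic//; last exact: measurable_setb.
apply: eq_integral => x _; rewrite /ind indicE; congr (_%:R%:E).
by case: (boolP (p x)) => h; [rewrite mem_set|rewrite memNset//; exact/negP].
Qed.

Context {d : nat}.

Lemma measurable_all_config dT (T : measurableType dT) (g : T -> Config R d)
    (p : T * RV R d -> bool) :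
  measurable_fun setT g -> measurable_fun setT p ->
  measurable_fun setT (fun w => all (fun x => p (w, x)) (g w)).
Proof.
move=> mg mp.
apply: (eq_measurable_fun (fun w => \sum_(x <- g w) ~~ p (w, x) == 0)%N).
  move=> w _.
  by elim: (g w) => [|x s ih]; rewrite ?big_nil// big_cons /= -ih addn_eq0; case: (p _).
apply: (measurable_fun_nat1 (fun n => n == 0)%N).
apply: (measurable_natsum_config mg (h := fun z => ~~ p z)).
by apply: (@measurableT_comp _ _ _ _ _ _ (fun b : bool => ~~ b : nat)).
Qed.

Lemma measurable_size_midpoints r :
  measurable_fun setT (fun s : Config R d => size (midpoints r s)).
Proof.
exact: (measurableT_comp (@measurable_size R d) (@measurable_midpoints R d r)).
Qed.

Definition farp (r : R) (Y : seq (RV R d)) (x : RV R d) : bool :=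
  all (fun y => ~~ closeb r x y) Y.

Definition far (r : R) (Y s : seq (RV R d)) : bool := all (farp r Y) s.

Lemma measurable_farp r Y : measurable_fun setT (farp r Y).
Proof.
elim: Y => [|y Y ih]; first exact: measurable_cst.
apply: measurable_and => //; apply: (@measurableT_comp _ _ _ _ _ _ negb) => //.
exact: measurable_closeb.
Qed.

Lemma measurable_far r Y : measurable_fun setT (far r Y : Config R d -> bool).
Proof.
apply: (@measurable_all_config _ (Config R d) id (fun z => farp r Y z.2)) => //.
exact: (measurableT_comp (measurable_farp r Y)).
Qed.

Lemma measurable_size_eq r k :
  measurable_fun setT (fun s : Config R d => size (midpoints r s) == k).
Proof.
exact: (measurable_fun_nat1 (fun n => n == k) (measurable_size_midpoints r)).
Qed.

Lemma far_cons r x Y s :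
  far r (x :: Y) s = ~~ has (closeb r x) s && far r Y s.
Proof.
elim: s => [//|z s ih] /=; rewrite ih closebC negb_or.
by case: (closeb r x z); case: (farp r Y z); case: (has _ _); case: (far r Y s).
Qed.

Lemma midpoints_cons_far r x (s : Config R d) : ~~ has (closeb r x) s ->
  midpoints r (x :: s : Config R d) = midpoints r s.
Proof. by move=> h; rewrite midpoints_cons; move: h; rewrite has_filter negbK => /eqP ->. Qed.

Lemma size_midpoints_cons r x (s : Config R d) :
  size (midpoints r (x :: s : Config R d)) = (count (closeb r x) s + size (midpoints r s))%N.
Proof. by rewrite midpoints_cons size_cat size_map size_filter. Qed.

Lemma size_midpoints0_cons r x (s : Config R d) :
  (size (midpoints r (x :: s : Config R d)) == 0%N) =
  ~~ has (closeb r x) s && (size (midpoints r s) == 0%N).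
Proof. by rewrite size_midpoints_cons addn_eq0 has_count lt0n negbK. Qed.

Lemma midpoints_pair_far r x y (s : Config R d) :
  closeb r x y -> ~~ has (closeb r x) s -> ~~ has (closeb r y) s ->
  midpoints r (x :: y :: s : Config R d) = mid x y :: midpoints r s.
Proof.
move=> cxy xs ys; rewrite midpoints_cons /= cxy midpoints_cons_far//=.
by move: xs; rewrite has_filter negbK => /eqP ->.
Qed.

End indicators.

(** * Probability that independent points create no close pair *)

Section survival.
Context {R : realType} {d : nat}.
Local Open Scope ereal_scope.
Variables (m : {finite_measure set RV R d -> \bar R}) (r b : R).
Hypotheses (m1 : m setT = 1) (b0 : (0 <= b)%R).
Hypothesis mb : forall x, m [set y | closeb r x y] <= b%:E.

(* A lower bound for the probability that [n] independent points, added to [c] given ones, create no close pair. *)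
Definition surv (c n : nat) : R := (\prod_(j < n) Num.max 0 (1 - (c + j)%:R * b))%R.

Lemma survS c n : surv c n.+1 = (Num.max 0 (1 - c%:R * b) * surv c.+1 n)%R.
Proof.
rewrite /surv big_ord_recl/= addn0; congr (_ * _)%R.
by apply: eq_bigr => j _; rewrite /bump/= add1n addnS addSn.
Qed.

Lemma surv_ge0 c n : (0 <= surv c n)%R.
Proof. by apply: prodr_ge0 => j _; rewrite le_max lexx. Qed.

Lemma measurable_closeset x : measurable ([set y | closeb r x y] : set (RV R d)).
Proof.
by apply: measurable_setb; exact: measurable_closeb.
Qed.

(** Union bound: each point of [Y] forbids a set of mass at most [b]. *)
Lemma measure_farp Y : (1 - (size Y)%:R * b)%:E <= m [set x | farp r Y x].
Proof.
elim: Y => [|y Y ih].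
  by rewrite mul0r subr0 -m1 le_measure ?inE//; exact: measurable_setb (measurable_farp _ _).
have mf Z : measurable ([set x | farp r Z x] : set (RV R d)).
  exact: measurable_setb (measurable_farp _ _).
rewrite -(@leeD2rE _ b%:E)// -EFinD /= -natr1 mulrDl mul1r opprD addrA subrK.
apply: (le_trans ih).
apply: (@le_trans _ _ (m ([set x | farp r (y :: Y) x] `|` [set x | closeb r y x]))).
  apply: le_measure; rewrite ?inE//; first by apply: measurableU => //; exact: measurable_closeset.
  move=> x /= fx; rewrite /farp/= [closeb r x y]closebC.
  by case: (boolP (closeb r y x)); [right|left].
apply: (@le_trans _ _ (m [set x | farp r (y :: Y) x] + m [set x | closeb r y x])).
  by apply: measureU2 => //; exact: measurable_closeset.
by apply: leeD2l; exact: mb.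
Qed.

(** Points are added one at a time, and each joins the list of points that the later ones must
    avoid; hence the induction is for all [Y]. *)
Lemma surv_iid n Y :
  (surv (size Y) n)%:E <=
  \int[iid m n]_s (ind (size (midpoints r s) == 0)%N * ind (far r Y s)).
Proof.
have mF Z : measurable_fun setT (fun s : Config R d =>
    ind (size (midpoints r s) == 0)%N * ind (far r Z s) : \bar R).
  apply: emeasurable_funM; apply: measurable_ind; first exact: measurable_size_eq.
  exact: measurable_far.
have F0 Z (s : Config R d) :
    (0 : \bar R) <= ind (size (midpoints r s) == 0)%N * ind (far r Z s).
  by rewrite mule_ge0// ind_ge0.
elim: n Y => [|n ih] Y; first by rewrite iid0// /surv big_ord0 mul1e.
rewrite iidS// survS.
apply: (@le_trans _ _ (\int[m]_x (ind (farp r Y x) * (surv (size Y).+1 n)%:E))).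
  have mi : measurable_fun setT (fun x : RV R d => ind (farp r Y x) : \bar R).
    exact: measurable_ind (measurable_farp r Y).
  have i0 (x : RV R d) : setT x -> (0 : \bar R) <= ind (farp r Y x).
    by move=> _; exact: ind_ge0.
  rewrite (ge0_integralZr _ measurableT mi i0)//; last by rewrite lee_fin surv_ge0.
  rewrite EFinM lee_wpmul2r ?lee_fin ?surv_ge0//.
  have -> : \int[m]_x ind (farp r Y x) = m [set x | farp r Y x].
    exact: integral_ind (measurable_farp r Y).
  rewrite EFin_max ge_max measure_ge0/=.
  exact: measure_farp.
apply: ge0_le_integralT => x.
  by rewrite mule_ge0 ?ind_ge0// lee_fin surv_ge0.
have [fx|fx] := boolP (farp r Y x); last first.
  by rewrite mul0e; apply: integral_ge0 => s _; exact: F0.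
rewrite mul1e; apply: le_trans (ih (x :: Y)) _.
apply: ge0_le_integralT => s; first exact: F0.
rewrite far_cons size_midpoints0_cons /= fx /= !ind_andb.
rewrite muleCA muleA.
exact: lexx.
Qed.

End survival.

(** * The Mecke formula for close pairs, and its iteration *)

Section edges.
Context {R : realType} {d : nat}.
Local Open Scope ereal_scope.
Variables (m : {finite_measure set RV R d -> \bar R}) (r : R).
Hypothesis r0 : (0 <= r)%R.

Lemma closeb_refl (x : RV R d) : closeb r x x.
Proof.
rewrite /closeb /cdist subrr /eucl_norm big1 ?sqrtr0// => i _.
by rewrite mxE expr0n.
Qed.

(** Handshake lemma for the graph of close pairs. The [- 1] removes the point itself, which is
    always counted, so the truncated subtraction is exact. *)
Lemma sum_degrees (s : Config R d) :
  (\sum_(x <- s) (\sum_(y <- s) closeb r x y - 1) = (size (midpoints r s)).*2)%N.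
Proof.
have := sum_cmid setT r s; rewrite cntT.
have E x y : cmid setT r x y = closeb r x y.
  by rewrite /cmid asboolT// andbT.
under eq_bigr do under eq_bigr do rewrite E.
under [X in _ = (_ + X)%N]eq_bigr do rewrite E closeb_refl.
move=> H; apply/eqP; rewrite -(eqn_add2r (\sum_(x <- s) true)%N) -H -big_split/=.
rewrite !big_seq; apply/eqP; apply: eq_bigr => x xs; rewrite subnK//.
by rewrite (big_rem x)//= closeb_refl.
Qed.

(** By the handshake lemma the left side is a sum over points of their degrees. One application of
    [mecke] extracts [x]; its degree is then a sum over the remaining points, from which a second
    application extracts [y]. *)
Lemma mecke_pairs n (G : Config R d -> \bar R) :
  measurable_fun setT G -> (forall s, 0 <= G s) ->
  \int[iid m n.+2]_s ((size (midpoints r s)).*2%:R%:E * G s) =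
  (n.+2 * n.+1)%:R%:E * \int[m]_x \int[m]_y \int[iid m n]_s
     (ind (closeb r x y) * G (x :: y :: s : Config R d)).
Proof.
move=> mG G0.
have mdeg : measurable_fun setT (fun z : RV R d * Config R d =>
    \sum_(y <- z.2) closeb r z.1 y)%N.
  apply: (@measurable_natsum_config _ _ _ _ snd measurable_snd
    (fun z : (RV R d * Config R d) * RV R d => closeb r z.1.1 z.2 : nat)).
  apply: (@measurableT_comp _ _ _ _ _ _ nat_of_bool) => //.
  apply: measurable_closeb => //.
  exact: (measurableT_comp measurable_fst measurable_fst).
pose h (z : RV R d * Config R d) : \bar R :=
  (\sum_(y <- z.2) closeb r z.1 y - 1)%N%:R%:E * G z.2.
have mh : measurable_fun setT h.
  apply: emeasurable_funM.
    exact: (measurable_fun_nat1 (fun n => (n - 1)%N%:R%:E : \bar R) mdeg).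
  exact: measurableT_comp.
have h0 z : 0 <= h z by rewrite mule_ge0// lee_fin.
transitivity (\int[iid m n.+2]_s \sum_(x <- s) h (x, s)).
  by apply: eq_integral => s _; rewrite -sum_degrees natr_sum -sumEFin ge0_sume_distrl.
rewrite mecke// natrM EFinM -muleA; congr (_ * _).
rewrite -ge0_integral_cstl//; last first.
- by move=> x; apply: integral_ge0 => y _; apply: integral_ge0 => s _; rewrite mule_ge0 ?ind_ge0.
- apply: (measurable_fun_integral_snd (f := fun z : RV R d * RV R d =>
     \int[iid m n]_s (ind (closeb r z.1 z.2) * G (z.1 :: z.2 :: s : Config R d)))).
    apply: (measurable_fun_integral_snd (f := fun z : (RV R d * RV R d) * Config R d =>
     (ind (closeb r z.1.1 z.1.2) * G (z.1.1 :: z.1.2 :: z.2 : Config R d)))).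
      apply: emeasurable_funM.
        apply: measurable_ind; apply: measurable_closeb.
          exact: (measurableT_comp measurable_fst measurable_fst).
        exact: (measurableT_comp measurable_snd measurable_fst).
      apply: (measurableT_comp mG); apply: measurable_fun_ccons.
        exact: (measurableT_comp measurable_fst measurable_fst).
      apply: measurable_fun_ccons => //.
      exact: (measurableT_comp measurable_snd measurable_fst).
    by move=> z; rewrite mule_ge0 ?ind_ge0.
  by move=> z; apply: integral_ge0 => s _; rewrite mule_ge0 ?ind_ge0.
apply: eq_integral => x _.
pose h2 (z : RV R d * Config R d) : \bar R :=
  ind (closeb r x z.1) * G (x :: z.2 : Config R d).
have mh2 : measurable_fun setT h2.
  apply: emeasurable_funM; first by apply: measurable_ind; exact: measurable_closeb.
  by apply: (measurableT_comp mG); exact: measurable_fun_ccons.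
have h20 z : 0 <= h2 z by rewrite mule_ge0 ?ind_ge0.
transitivity (\int[iid m n.+1]_s \sum_(y <- s) h2 (y, s)).
  apply: eq_integral => s _; rewrite /h /h2 /= big_cons closeb_refl add1n subn1/=.
  by rewrite natr_sum -sumEFin ge0_sume_distrl.
by rewrite mecke.
Qed.

Section lower_bound.
Variables (m' : {finite_measure set RV R d -> \bar R}) (b : R).
Hypotheses (m1 : m setT = 1) (b0 : (0 <= b)%R).
Hypothesis mb : forall x, m [set y | closeb r x y] <= b%:E.
Hypothesis mm' : forall g : RV R d -> \bar R,
  measurable_fun setT g -> (forall z, 0 <= g z) ->
  b%:E * \int[m']_z g z <= \int[m]_x \int[m]_y (ind (closeb r x y) * g (mid x y)).

Definition sepF (F : Config R d -> \bar R) W (z : Config R d) : \bar R :=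
  F z * (ind (size (midpoints (2 * r) z) == 0)%N * ind (far (2 * r) W z)).

Definition edgeF k (F : Config R d -> \bar R) Y (s : Config R d) : \bar R :=
  F (midpoints r s : Config R d) * (ind (size (midpoints r s) == k) * ind (far r Y s)).

Lemma measurable_sepF F W : measurable_fun setT F -> measurable_fun setT (sepF F W).
Proof.
move=> mF; apply: emeasurable_funM => //; apply: emeasurable_funM; apply: measurable_ind.
  exact: measurable_size_eq.
exact: measurable_far.
Qed.

Lemma measurable_edgeF k F Y : measurable_fun setT F -> measurable_fun setT (edgeF k F Y).
Proof.
move=> mF; apply: emeasurable_funM.
  exact: (measurableT_comp mF (@measurable_midpoints R d r)).
apply: emeasurable_funM; apply: measurable_ind.
  exact: measurable_size_eq.
exact: measurable_far.
Qed.

Lemma sepF_ge0 F W s : (forall s, 0 <= F s) -> 0 <= sepF F W s.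
Proof. by move=> F0; rewrite !mule_ge0 ?ind_ge0. Qed.

Lemma edgeF_ge0 k F Y s : (forall s, 0 <= F s) -> 0 <= edgeF k F Y s.
Proof. by move=> F0; rewrite !mule_ge0 ?ind_ge0. Qed.

Definition conscfg (F : Config R d -> \bar R) (z : RV R d) (s : Config R d) : \bar R :=
  F (z :: s : Config R d).

Lemma sepF_cons F W z s : sepF F W (z :: s : Config R d) =
  ind (farp (2 * r) W z) * sepF (conscfg F z) (z :: W) s.
Proof.
rewrite /sepF size_midpoints0_cons /= far_cons !ind_andb /conscfg.
rewrite [RHS]muleCA; congr (_ * _).
move: (ind (~~ _)) (ind (size _ == _)) (ind (far _ _ _)) (ind (farp _ _ _)) => p q u v.
by rewrite (muleCA v) (muleC p) -!muleA; congr (_ * _); rewrite muleCA.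
Qed.

(* If the pair [x, y] is close and its midpoint is [2 r]-far from [W], then both endpoints are [r]-far from every point within [r / 2] of [W]. *)
Lemma farp_mid x y (Y W : seq (RV R d)) : closeb r x y ->
  all (fun u => has (closeb (r / 2) u) W) Y ->
  farp (2 * r) W (mid x y) -> farp r Y x.
Proof.
move=> cxy /allP YW /allP fW; apply/allP => u uY; apply/negP => cxu.
have /hasP[w wW cuw] := YW _ uY.
have /negP := fW _ wW; apply; rewrite /closeb /cdist.
apply: le_trans (eucl_distD x _ _) _.
have h1 : (eucl_norm ((mid x y : 'rV[R]_d) - x) <= r / 2)%R.
  rewrite (_ : _ - _ = 2^-1 *: ((y : 'rV[R]_d) - x))%R; last first.
    by apply/rowP => i; rewrite !mxE; field.
  rewrite eucl_normZ gtr0_norm// mulrC ler_pM2r//.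
  by move: cxy; rewrite closebC.
have h2 : (eucl_norm ((x : 'rV[R]_d) - w) <= r + r / 2)%R.
  by apply: le_trans (eucl_distD u _ _) _; exact: lerD.
by apply: le_trans (lerD h1 h2) _; lra.
Qed.

(* Induction on [k]: [mecke_pairs] splits off one close pair at a time, [Y] collecting the endpoints already split off and [W] their midpoints. *)
Lemma edgeF_lower k n F Y W :
  measurable_fun setT F -> (forall s, 0 <= F s) ->
  all (fun u => has (closeb (r / 2) u) W) Y ->
  (((k.*2 + n) ^_ k.*2)%:R * (b / 2) ^+ k * surv b (size Y + k.*2) n)%:E *
     \int[iid m' k]_z sepF F W z <=
  (k`!)%:R%:E * \int[iid m (k.*2 + n)]_s edgeF k F Y s.
Proof.
elim: k n F Y W => [|k ih] n F Y W mF F0 YW.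
  rewrite iid0; last exact: measurable_sepF.
  rewrite /= ffactn0 expr0 !(mulr1, mul1r) addn0 mul1e /sepF /= !mule1 muleC.
  apply: (@le_trans _ _ (F [::] * \int[iid m n]_s
      (ind (size (midpoints r s) == 0)%N * ind (far r Y s)))).
    by rewrite lee_wpmul2l//; exact: surv_iid.
  rewrite -ge0_integralZl//.
  - apply: ge0_le_integralT => s; first by rewrite !mule_ge0 ?ind_ge0.
    rewrite /edgeF; have [/eqP/size0nil ->//|] := boolP (size (midpoints r s) == 0)%N.
    by rewrite !mul0e !mule0.
  - apply: emeasurable_funM; apply: measurable_ind; first exact: measurable_size_eq.
    exact: measurable_far.
  - by move=> s _; rewrite mule_ge0 ?ind_ge0.
set N := (k.*2 + n)%N; rewrite doubleS !addSn -/N.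
pose G := edgeF k.+1 F Y.
have mG : measurable_fun setT G by exact: measurable_edgeF.
have G0 s : 0 <= G s by exact: edgeF_ge0.
(* On the support of [G] there are exactly [k + 1] close pairs, so the factor in [mecke_pairs] is
   constant. *)
have E2 : (k.+1).*2%:R%:E * \int[iid m N.+2]_s G s =
   (N.+2 * N.+1)%:R%:E * \int[m]_x \int[m]_y \int[iid m N]_s
     (ind (closeb r x y) * G (x :: y :: s : Config R d)).
  rewrite -mecke_pairs// -ge0_integral_cstl//; apply: eq_integral => s _.
  rewrite /G /edgeF; have [/eqP ->//|] := boolP (size (midpoints r s) == k.+1).
  by rewrite !mul0e !mule0.
pose c : R := (((k.*2 + n) ^_ k.*2)%:R * (b / 2) ^+ k * surv b (size Y + (k.*2).+2) n)%R.
have c0 : (0 <= c)%R.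
  rewrite /c !mulr_ge0 ?surv_ge0 ?exprn_ge0// divr_ge0//.
pose Z (z : RV R d) := \int[iid m' k]_s sepF (conscfg F z) (z :: W) s.
have mZ : measurable_fun setT (fun z : RV R d => ind (farp (2 * r) W z) * Z z).
  apply: (eq_measurable_fun (fun z : RV R d => \int[iid m' k]_s sepF F W (z :: s : Config R d))).
    move=> z _; under eq_integral do rewrite sepF_cons.
    rewrite ge0_integralZl// ?ind_ge0//; last by move=> s _; apply: sepF_ge0 => ?; exact: F0.
    by apply: measurable_sepF; exact: measurable_cons_fun.
  by apply: measurable_int_iid; [exact: measurable_sepF|move=> s; exact: sepF_ge0].
have Z0 z : 0 <= Z z by apply: integral_ge0 => s _; apply: sepF_ge0 => ?; exact: F0.
(* The induction hypothesis for a fixed close pair: its midpoint is fed to [F] and added to [W], its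
   two endpoints are added to [Y]. *)
have key x y : closeb r x y ->
    c%:E * (ind (farp (2 * r) W (mid x y)) * Z (mid x y)) <=
    (k`!)%:R%:E * \int[iid m N]_s G (x :: y :: s : Config R d).
  move=> cxy; have [fW|fW] := boolP (farp (2 * r) W (mid x y)); last first.
    rewrite mul0e mule0 mule_ge0// ?lee_fin//.
    by apply: integral_ge0 => s _; exact: G0.
  rewrite mul1e.
  have fx : farp r Y x by apply: farp_mid cxy YW fW.
  have fy : farp r Y y.
    by apply: (@farp_mid y x) YW _; [rewrite closebC|rewrite midC].
  have hc u : closeb r x y -> (u = x \/ u = y) -> closeb (r / 2) u (mid x y).
    move=> _ uxy; rewrite /closeb /cdist.
    have -> : eucl_norm ((u : 'rV[R]_d) - mid x y) = (2^-1 * eucl_norm ((x : 'rV[R]_d) - y))%R.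
      have e : (2^-1 = `|2^-1| :> R)%R by rewrite gtr0_norm.
      case: uxy => ->; rewrite e -eucl_normZ.
        by congr eucl_norm; apply/rowP => i; rewrite !mxE; field.
      by rewrite -eucl_normN; congr eucl_norm; apply/rowP => i; rewrite !mxE; field.
    by rewrite mulrC ler_pM2r.
  have YW' : all (fun u => has (closeb (r / 2) u) (mid x y :: W)) (x :: y :: Y).
    rewrite /= !hc//=; [|by right|by left].
    by apply: sub_all YW => u; rewrite /= => ->; rewrite orbT.
  have := ih n (conscfg F (mid x y)) (x :: y :: Y) (mid x y :: W)
    (measurable_cons_fun (mid x y) mF) (fun s => F0 _) YW'.
  rewrite /= addSnnS addSnnS; move/le_trans; apply.
  rewrite lee_wpmul2l ?lee_fin//; apply: ge0_le_integralT => s.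
    by apply: edgeF_ge0 => ?; exact: F0.
  rewrite /G /edgeF !far_cons.
  (* If some remaining point is close to [x] or [y], the left side vanishes through its [far]
     factor; otherwise the pair is isolated and contributes exactly its midpoint. *)
  have [xs|] := boolP (has (closeb r x) s); first by rewrite !mule0; exact: edgeF_ge0.
  have [ys|] := boolP (has (closeb r y) s); first by rewrite !mule0 => _; exact: edgeF_ge0.
  by move=> ys xs; rewrite midpoints_pair_far//= fx fy eqSS.
have kf : (0 < k`!%:R :> R)%R by rewrite ltr0n fact_gt0.
have step : (c * b)%:E * \int[iid m' k.+1]_z sepF F W z <=
    (k`!)%:R%:E * \int[m]_x \int[m]_y \int[iid m N]_s
     (ind (closeb r x y) * G (x :: y :: s : Config R d)).
  have g0 z : 0 <= ind (farp (2 * r) W z) * Z z by rewrite mule_ge0 ?ind_ge0.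
  have -> : \int[iid m' k.+1]_z sepF F W z = \int[m']_z (ind (farp (2 * r) W z) * Z z).
    rewrite iidS; [|exact: measurable_sepF|by move=> s; exact: sepF_ge0].
    apply: eq_integral => z _; under eq_integral do rewrite sepF_cons.
    rewrite ge0_integralZl// ?ind_ge0//; last by move=> s _; apply: sepF_ge0 => ?; exact: F0.
    by apply: measurable_sepF; exact: measurable_cons_fun.
  (* The constant [c / k!] is moved into the integrand so that [mm'] applies to the whole function
     of the midpoint. *)
  have -> : (c * b)%:E * \int[m']_z (ind (farp (2 * r) W z) * Z z) =
      (k`!)%:R%:E * (b%:E * \int[m']_z ((c / k`!%:R)%:E * (ind (farp (2 * r) W z) * Z z))).
    rewrite ge0_integral_cstl//; last by rewrite divr_ge0// ltW.
    by rewrite !muleA -!EFinM; congr (_%:E * _); field; exact: lt0r_neq0.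
  rewrite lee_wpmul2l ?lee_fin ?ler0n//.
  apply: le_trans (mm' _ _) _; first exact: measurable_funeM.
    by move=> z; rewrite mule_ge0// lee_fin divr_ge0// ltW.
  apply: ge0_le_integralT => x.
    apply: integral_ge0 => y _; rewrite mule_ge0 ?ind_ge0// mule_ge0//.
    by rewrite lee_fin divr_ge0// ltW.
  apply: ge0_le_integralT => y.
    by rewrite mule_ge0 ?ind_ge0// mule_ge0// lee_fin divr_ge0// ltW.
  have [cxy|cxy] := boolP (closeb r x y); last first.
    rewrite mul0e; apply: integral_ge0 => s _.
    by rewrite mul0e.
  rewrite mul1e; under eq_integral do rewrite mul1e.
  rewrite mulrC EFinM -muleA.
  apply: (@le_trans _ _ ((k`!%:R^-1)%:E * ((k`!)%:R%:E * \int[iid m N]_s G (x :: y :: s : Config R d)))).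
    by rewrite lee_wpmul2l ?key// lee_fin invr_ge0 ltW.
  by rewrite muleA -EFinM mulVf ?lt0r_neq0// mul1e.
(* Bookkeeping of constants: the two new points give [(N + 2) (N + 1)], their pair being unordered
   gives [b / 2], and the factor [2 (k + 1)] of [E2] turns [k!] into [(k + 1)!]. *)
rewrite !ffactSS.
rewrite (_ : (_ * _ * _)%R = ((N.+2 * N.+1)%:R / 2 * (c * b))%R); last first.
  by rewrite /c exprS -/N !natrM; field.
rewrite EFinM -muleA.
apply: (@le_trans _ _ (((N.+2 * N.+1)%:R / 2)%:E * ((k`!)%:R%:E * \int[m]_x \int[m]_y \int[iid m N]_s
     (ind (closeb r x y) * G (x :: y :: s : Config R d))))).
  by rewrite lee_wpmul2l// lee_fin divr_ge0.
rewrite (_ : ((N.+2 * N.+1)%:R / 2)%:E * _ = (k`!%:R / 2)%:E * ((k.+1).*2%:R%:E * \int[iid m N.+2]_s G s)); last first.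
  by rewrite E2 !muleA -!EFinM; congr (_%:E * _); field.
rewrite muleA -EFinM lee_wpmul2r ?integral_ge0//.
by rewrite lee_fin factS natrM -mul2n natrM (_ : _ / 2 * _ = k.+1%:R * k`!%:R)%R//; field.
Qed.

End lower_bound.
End edges.

(** * The law of the midpoint of a close pair *)

Section restriction.
Context {R : realType} d (T : measurableType d).
Local Open Scope ereal_scope.

Lemma ge0_integral_mrestr (mu : {measure set T -> \bar R}) (D : set T)
    (mD : measurable D) (f : T -> \bar R) :
  measurable_fun setT f -> (forall x, 0 <= f x) ->
  \int[mrestr mu mD]_x f x = \int[mu]_x (ind `[< D x >] * f x).
Proof.
move=> mf f0.
rewrite (@ge0_negligible_integral _ _ _ (mrestr mu mD) setT (~` D))//; last 2 first.
- exact: measurableC.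
- by change (mu (~` D `&` D) = 0); rewrite setICl measure0.
rewrite setTD setCK.
rewrite (eq_measure_integral mu); last first.
  by move=> A mA AD; change (mu (A `&` D) = mu A); rewrite setIidl.
rewrite integral_mkcond; apply: eq_integral => x _; rewrite patchE.
by case: asboolP => xD; [rewrite mem_set// mul1e|rewrite memNset// mul0e].
Qed.

Lemma measurable_asbool (A : set T) : measurable A ->
  measurable_fun setT (fun x => `[< A x >]).
Proof.
move=> mA; apply: measurable_fun_setE.
by rewrite (_ : [set w | _] = A)//; apply/seteqP; split => w /asboolP.
Qed.

End restriction.

Section convex_body.
Context {R : realType} {d : nat}.
Local Open Scope ereal_scope.

Lemma ge0_integral_volm_affine (s : R) (v : 'rV[R]_d) (f : RV R d -> \bar R) :
  (s != 0)%R -> measurable_fun setT f -> (forall x, 0 <= f x) ->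
  (`|s| ^+ d)%:E * \int[@volm R d]_x f (s *: (x : 'rV[R]_d) + v)%R =
  \int[@volm R d]_x f x.
Proof.
move=> s0 mf f0.
pose m := mscale (NngNum (exprn_ge0 d (normr_ge0 s)))
  (pushm (@volm R d) (measurable_affine s v)).
transitivity (\int[m]_x f x).
  by rewrite ge0_integral_mscale//= ge0_integral_pushm.
by apply: eq_measure_integral => A mA _; exact: volm_affine.
Qed.

Variables (K : set 'rV[R]_d).
Hypotheses (kK : compact K) (cK : convex_set K) (vK : vol K = 1).

Lemma measurable_compact_RV : measurable (K : set (RV R d)).
Proof.
rewrite -[K]setCK; apply: measurableC; apply: sub_sigma_algebra => /=.
by apply: closed_openC; apply: compact_closed => //; exact: norm_hausdorff.
Qed.
Let mK := measurable_compact_RV.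

Lemma volK_fin : mrestr (@volm R d) mK setT < +oo.
Proof. by rewrite /mrestr setTI /volm vK ltry. Qed.

Definition volK : set (RV R d) -> \bar R := finm volK_fin.
HB.instance Definition _ := FiniteMeasure.on volK.

Lemma volKE A : volK A = vol (A `&` K).
Proof. by []. Qed.

Lemma volKT : volK setT = 1.
Proof. by rewrite volKE setTI vK. Qed.

Lemma integral_volK (f : RV R d -> \bar R) :
  measurable_fun setT f -> (forall x, 0 <= f x) ->
  \int[volK]_x f x = \int[@volm R d]_x (ind `[< K x >] * f x).
Proof. exact: ge0_integral_mrestr. Qed.

Lemma measurable_indK dT (T : measurableType dT) (f : T -> RV R d) :
  measurable_fun setT f ->
  measurable_fun setT (fun w => ind `[< K (f w) >] : \bar R).
Proof.
move=> mf; apply: measurable_ind.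
exact: (measurableT_comp (measurable_asbool mK) mf).
Qed.

(** Some ball contains [K] and so has volume at least one; by scaling its volume is a multiple of
    [kappa]. *)
Lemma kappa_gt0 : (0 < kappa R d)%R.
Proof.
have [M M0 KM] : exists2 M : R, (0 < M)%R & K `<=` @eball R d M.
  have [M [Mr KM]] := compact_bounded kK.
  pose N := (`|M| + 1)%R; have N0 : (0 < N)%R by rewrite ltr_wpDl.
  exists (Num.sqrt (d.+1%:R * N ^+ 2))%R => [|x Kx].
    by rewrite sqrtr_gt0 mulr_gt0// exprn_gt0.
  rewrite /eball /= /eucl_norm ler_wsqrtr//.
  have : (`|x| <= N)%R.
    by apply: KM => //; rewrite (le_lt_trans (ler_norm _))// ltrDl.
  rewrite [leLHS]/Num.norm/= mx_normrE => xN.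
  apply: (@le_trans _ _ (\sum_(i < d) N ^+ 2)%R).
    apply: ler_sum => i _; rewrite -real_normK ?num_real// lerXn2r ?nnegrE ?(ltW N0)//.
    by apply: le_trans xN; apply/bigmax_geP; right => /=; exists (ord0, i).
  by rewrite sumr_const card_ord -[leLHS]mulr_natl ler_wpM2r ?sqr_ge0 ?ler_nat.
rewrite lt_def kappa_ge0 andbT; apply/eqP => k0.
have : 1 <= volm (@eball R d M).
  rewrite -vK -[vol K]/(volm (K : set (RV R d))); apply: le_measure; rewrite ?inE//.
  exact: measurable_eball.
by rewrite volm_eball// k0 mul0r lee_fin ler10.
Qed.

(* Substitution [y = x - u], followed by Tonelli. *)
Lemma integral_pairs (g : RV R d * RV R d -> \bar R) :
  measurable_fun setT g -> (forall z, 0 <= g z) ->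
  \int[volK]_x \int[volK]_y g (x, y) =
  \int[@volm R d]_u \int[@volm R d]_x
    (ind `[< K x >] * (ind `[< K ((x : 'rV[R]_d) - u)%R >] * g (x, (x : 'rV[R]_d) - u)%R)).
Proof.
move=> mg g0.
have mg1 : measurable_fun setT (fun x : RV R d => \int[volK]_y g (x, y)).
  exact: measurable_fun_integral_snd.
have mg2 (x : RV R d) : measurable_fun setT (fun y : RV R d => g (x, y)).
  exact: measurable_section.
rewrite integral_volK//; last by move=> x; exact: integral_ge0.
have md : measurable_fun setT (fun z : RV R d * RV R d => ((z.1 : 'rV[R]_d) - z.2)%R : RV R d).
  exact: measurable_RVB.
pose H (z : RV R d * RV R d) : \bar R :=
  ind `[< K ((z.1 : 'rV[R]_d) - z.2)%R >] * g (z.1, (z.1 : 'rV[R]_d) - z.2)%R.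
have mH : measurable_fun setT H.
  apply: emeasurable_funM; first exact: measurable_indK.
  by apply: (measurableT_comp mg); exact: measurable_fun_pair.
have H0 z : 0 <= H z by rewrite mule_ge0 ?ind_ge0.
pose G (z : RV R d * RV R d) : \bar R := ind `[< K z.1 >] * H z.
have mG : measurable_fun setT G.
  by apply: emeasurable_funM => //; exact: measurable_indK.
rewrite -(fubini_tonelli G mG); last by move=> z; rewrite mule_ge0 ?ind_ge0.
apply: eq_integral => x _; rewrite /G /=.
rewrite (ge0_integralZl _ measurableT (measurable_section x mH))//; last exact: ind_ge0.
congr (_ * _); rewrite integral_volK//.
have nz : (-1 != 0 :> R)%R by rewrite oppr_eq0 oner_eq0.
rewrite -(ge0_integral_volm_affine x nz).
- rewrite normrN1 expr1n mul1e; apply: eq_integral => u _.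
  by rewrite /H /= scaleN1r addrC.
- by apply: emeasurable_funM => //; exact: measurable_indK.
- by move=> y; rewrite mule_ge0 ?ind_ge0.
Qed.

Section midpoint_measure.
Variable r : R.
Hypothesis r0 : (0 < r)%R.

Let b : R := (kappa R d * r ^+ d)%R.

Lemma volK_ball x : volK [set y | closeb r x y] <= b%:E.
Proof.
rewrite -(volm_eball d r0) -(volm_shift (- (x : 'rV[R]_d))%R (@measurable_eball R d r)).
apply: (@le_trans _ _ (volm ([set y | closeb r x y] : set (RV R d)))).
  rewrite volKE; apply: le_measure; rewrite ?inE//.
    by apply: measurableI => //; exact: measurable_closeset.
  exact: measurable_closeset.
rewrite le_measure ?inE//.
- exact: measurable_closeset.
- exact: measurable_preim (measurable_RVD _ _) (@measurable_eball R d r).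
by move=> y; rewrite /= closebC.
Qed.

Definition closeset : set (RV R d * RV R d) := [set z | closeb r z.1 z.2].

Lemma measurable_closeset2 : measurable closeset.
Proof. by apply: measurable_setb; exact: measurable_closeb. Qed.

Lemma measurable_mid2 : measurable_fun setT (fun z : RV R d * RV R d => mid z.1 z.2).
Proof. exact: measurable_mid. Qed.

Let b_gt0 : (0 < b)%R.
Proof. by rewrite mulr_gt0 ?kappa_gt0// exprn_gt0. Qed.

Let binv_ge0 : (0 <= b^-1)%R.
Proof. by rewrite invr_ge0 ltW. Qed.

Let pairm := mscale (NngNum binv_ge0)
  (pushm (mrestr (prodm volK volK) measurable_closeset2) measurable_mid2).

Let pairm_fin : pairm setT < +oo.
Proof.
change (b^-1%:E * prodm volK volK (setT `&` closeset) < +oo).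
rewrite setTI lte_mul_pinfty//.
apply: (@le_lt_trans _ _ (prodm volK volK setT)).
  by apply: le_measure; rewrite ?inE//; exact: measurable_closeset2.
by rewrite prodmT; change (volK setT * volK setT < +oo); rewrite volKT mule1 ltry.
Qed.

(** Dividing by [b], and not by the true probability of a close pair, is what makes this measure lie
    below [volK]; the boundary effect then shows up only as missing mass. *)
Definition midm : set (RV R d) -> \bar R := finm pairm_fin.
HB.instance Definition _ := FiniteMeasure.on midm.

Lemma integral_midm (g : RV R d -> \bar R) :
  measurable_fun setT g -> (forall z, 0 <= g z) ->
  b%:E * \int[midm]_z g z = \int[volK]_x \int[volK]_y (ind (closeb r x y) * g (mid x y)).
Proof.
move=> mg g0.
have mgm : measurable_fun setT (fun z : RV R d * RV R d => g (mid z.1 z.2)).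
  exact: (measurableT_comp mg measurable_mid2).
have -> : \int[midm]_z g z = b^-1%:E *
    \int[pushm (mrestr (prodm volK volK) measurable_closeset2) measurable_mid2]_z g z.
  exact: (ge0_integral_mscale _ measurableT (NngNum binv_ge0) mg).
rewrite muleA -EFinM divff ?gt_eqF// mul1e ge0_integral_pushm// ge0_integral_mrestr//.
transitivity (\int[prodm volK volK]_z (ind (closeb r z.1 z.2) * g (mid z.1 z.2))).
  by apply: eq_integral => z _; congr (ind _ * _); exact: asboolb.
rewrite (@ge0_integral_prodm _ _ _ _ _ volK volK (fun z => ind (closeb r z.1 z.2) * g (mid z.1 z.2)))//.
- apply: emeasurable_funM => //; apply: measurable_ind; exact: measurable_closeb.
- by move=> z; rewrite mule_ge0 ?ind_ge0.
Qed.

Let cdist_sub (x u : RV R d) : closeb r x ((x : 'rV[R]_d) - u)%R = (eucl_norm (u : 'rV[R]_d) <= r)%R.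
Proof. by rewrite /closeb /cdist opprB addrC subrK. Qed.

Let measurable_ball : measurable_fun setT (fun u : RV R d => (eucl_norm (u : 'rV[R]_d) <= r)%R).
Proof. by apply: measurable_fun_ler => //; exact: measurable_eucl_norm. Qed.

Let integral_ball : \int[@volm R d]_u ind (eucl_norm (u : 'rV[R]_d) <= r)%R = b%:E.
Proof. by rewrite integral_ind// -[RHS](volm_eball d r0). Qed.

Let integral_pairs_mid (g : RV R d -> \bar R) :
  measurable_fun setT g -> (forall z, 0 <= g z) ->
  b%:E * \int[midm]_z g z = \int[@volm R d]_u \int[@volm R d]_x
    (ind `[< K x >] * (ind `[< K ((x : 'rV[R]_d) - u)%R >] *
       (ind (eucl_norm (u : 'rV[R]_d) <= r)%R * g (mid x ((x : 'rV[R]_d) - u)%R)))).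
Proof.
move=> mg g0; rewrite integral_midm//.
rewrite (@integral_pairs (fun z => ind (closeb r z.1 z.2) * g (mid z.1 z.2))).
- by apply: eq_integral => u _; apply: eq_integral => x _; rewrite /= cdist_sub.
- apply: emeasurable_funM; first by apply: measurable_ind; exact: measurable_closeb.
  exact: (measurableT_comp mg measurable_mid2).
- by move=> z; rewrite mule_ge0 ?ind_ge0.
Qed.

(** For a fixed difference [u] of the pair, the midpoint is the translate [x - u / 2], which lies in
    [K] by convexity; so each [u] contributes at most [volK A]. Integrating [u] over a ball of
    volume [b] cancels the normalisation. *)
Lemma midm_le A : measurable A -> midm A <= volK A.
Proof.
move=> mA; rewrite -(@lee_pmul2l _ b%:E)// ?lte_fin//.
have mi : measurable_fun setT (fun z : RV R d => ind `[< A z >] : \bar R).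
  by apply: measurable_ind; exact: measurable_asbool.
have -> : midm A = \int[midm]_z ind `[< A z >].
  rewrite integral_ind; last exact: measurable_asbool.
  by congr midm; apply/seteqP; split => z /asboolP.
rewrite integral_pairs_mid//; last by move=> z; exact: ind_ge0.
rewrite -integral_ball -ge0_integralZr//; last 2 first.
- exact: measurable_ind.
- by move=> u _; exact: ind_ge0.
apply: ge0_le_integralT => u.
  by apply: integral_ge0 => x _; rewrite !mule_ge0 ?ind_ge0.
have [ur|ur] := boolP (eucl_norm (u : 'rV[R]_d) <= r)%R; last first.
  rewrite indF mul0e integral0_eq// => x _.
  by rewrite mul0e !mule0.
rewrite indT mul1e volKE.
have mAK : measurable (A `&` K : set (RV R d)) by exact: measurableI.
rewrite -[leRHS](volm_shift (- (2^-1 *: (u : 'rV[R]_d)))%R mAK).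
have ms : measurable_fun setT (fun x : RV R d => ((x : 'rV[R]_d) - 2^-1 *: (u : 'rV[R]_d))%R : RV R d).
  exact: measurable_RVD.
have mp := measurable_preim ms mAK.
apply: (@le_trans _ _ (\int[@volm R d]_x ind `[< (A `&` K) ((x : 'rV[R]_d) - 2^-1 *: u)%R >])).
  apply: ge0_le_integralT => x; first by rewrite !mule_ge0 ?ind_ge0.
  case: asboolP => Kx; last by rewrite mul0e ind_ge0.
  case: asboolP => Ku; last by rewrite mul0e mule0 ind_ge0.
  have E : mid x ((x : 'rV[R]_d) - u)%R = ((x : 'rV[R]_d) - 2^-1 *: u)%R.
    by apply/rowP => i; rewrite !mxE; field.
  rewrite !mul1e E; case: asboolP => Am; last by rewrite ind_ge0.
  rewrite asboolT//; split => //; rewrite -E.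
  have h01 : (0 <= (2^-1 : R) <= 1)%R by apply/andP; split; lra.
  have := convex_setP cK h01 Kx Ku; congr K.
  by apply/rowP => i; rewrite !mxE; field.
rewrite integral_ind; last exact: (measurableT_comp (measurable_asbool mAK) ms).
apply: le_measure; rewrite ?inE//.
  exact: measurable_setb (measurableT_comp (measurable_asbool mAK) ms).
by move=> x /asboolP.
Qed.

(** For a fixed difference [u], the admissible [x] form the intersection of [K] with [K + u], which
    misses at most [C |u| <= C r] of the unit volume of [K]. *)
Lemma midm_mass (C : R) : (0 <= C)%R ->
  (forall v : 'rV[R]_d, volm ([set x | K x /\ ~ K (x - v)%R] : set (RV R d)) <= (C * eucl_norm v)%:E) ->
  (1 - C * r)%:E <= midm setT.
Proof.
move=> C0 hC.
have [h|h] := leP (1 - C * r)%R 0%R; first by rewrite (@le_trans _ _ 0)// lee_fin.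
rewrite -(@lee_pmul2l _ b%:E)// ?lte_fin//.
have -> : midm setT = \int[midm]_z 1 by rewrite integral_cst// mul1e.
rewrite integral_pairs_mid// -integral_ball -ge0_integralZr//; last 3 first.
- exact: measurable_ind.
- by move=> u _; exact: ind_ge0.
- by rewrite lee_fin ltW.
apply: ge0_le_integralT => u; first by rewrite mule_ge0 ?ind_ge0// lee_fin ltW.
have [ur|ur] := boolP (eucl_norm (u : 'rV[R]_d) <= r)%R; last first.
  by rewrite mul0e; apply: integral_ge0 => x _; rewrite !mule_ge0 ?ind_ge0.
rewrite mul1e.
have mv : measurable_fun setT (fun x : RV R d => ((x : 'rV[R]_d) - u)%R : RV R d).
  exact: measurable_RVD.
have mKu := measurable_preim mv mK.
rewrite (_ : (fun x => _) = (fun x : RV R d =>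
    ind (`[< K x >] && `[< K ((x : 'rV[R]_d) - u)%R >]))); last first.
  by apply/funext => x; rewrite !mule1 ind_andb.
rewrite integral_ind; last first.
  apply: measurable_and; first exact: measurable_asbool.
  exact: (measurableT_comp (measurable_asbool mK) mv).
rewrite (_ : mkset _ = K `&` ((fun x : RV R d => ((x : 'rV[R]_d) - u)%R : RV R d) @^-1` K)); last first.
  by apply/seteqP; split => x /=; [move=> /andP[/asboolP ? /asboolP ?]|move=> [? ?]; rewrite !asboolT].
rewrite EFinB leeBlDr//.
set L := (X in X + _); rewrite -[X in X <= _]vK.
have -> : vol K = volm ([set x | K x /\ ~ K (x - u)%R] : set (RV R d)) + L.
  exact: (measureDI (@volm R d) mK mKu).
rewrite addeC leeD2l//; apply: le_trans (hC u) _.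
by rewrite lee_fin ler_wpM2l.
Qed.

End midpoint_measure.

End convex_body.

(** * Laws of Poisson and binomial processes *)

Section config_law.
Context {R : realType} {d : nat}.
Local Open Scope ereal_scope.

Definition cnt_event (I : finType) (A : I -> set (RV R d)) (k : I -> nat) :
  set (Config R d) := [set s | forall i, cnt (A i) s = k i].

Lemma measurable_cnt_event (I : finType) (A : I -> set (RV R d)) k :
  (forall i, measurable (A i)) -> measurable (cnt_event A k).
Proof.
move=> mA; rewrite (_ : cnt_event A k =
    \bigcap_(i in [set: I]) (cnt (A i) @^-1` [set k i] : set (Config R d))).
  apply: fin_bigcap_measurable => // i _.
  exact: (measurable_preim (measurable_cnt (mA i)) (A := [set k i])).
by apply/seteqP; split => s h i; [move=> _|]; exact: h.
Qed.

(** The cells of the partition generated by the first [n] sets, indexed by membership patterns. *)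
Definition atom (n : nat) (B : nat -> set (RV R d)) (e : {ffun 'I_n -> bool}) :
  set (RV R d) := [set x | forall i : 'I_n, `[< B i x >] = e i].

Lemma measurable_atom n (B : nat -> set (RV R d)) e : (forall i, (i < n)%N -> measurable (B i)) ->
  measurable (@atom n B e).
Proof.
move=> mB; rewrite (_ : atom B e = \bigcap_(i in [set: 'I_n]) (if e i then B i else ~` B i)).
  apply: fin_bigcap_measurable => // i _; case: ifP => _; first exact: mB.
  by apply: measurableC; exact: mB.
apply/seteqP; split => x h i; have := h i.
  by move=> <- _; case: asboolP.
by case: (e i) => /(_ Logic.I) ? //=; [rewrite asboolT|rewrite asboolF].
Qed.

Lemma cnt_atom n (B : nat -> set (RV R d)) (i : 'I_n) (s : Config R d) :
  cnt (B i) s = (\sum_(e : {ffun 'I_n -> bool} | e i) cnt (atom B e) s)%N.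
Proof.
elim: s => [|x s ih]; first by rewrite big1.
rewrite cnt_cons ih.
under [RHS]eq_bigr do rewrite cnt_cons.
rewrite big_split/=; congr addn.
pose e0 : {ffun 'I_n -> bool} := [ffun i : 'I_n => `[< B i x >]].
have E e : `[< atom B e x >] = (e == e0).
  apply/asboolP/eqP => [h|-> i']; last by rewrite ffunE.
  by apply/ffunP => i'; rewrite ffunE h.
under eq_bigr do rewrite E.
have [Bx|Bx] := asboolP (B i x).
  rewrite (bigD1 e0) /= ?ffunE ?asboolT// eqxx big1// => e /andP[_ /negPf ->//].
by rewrite big1// => e ei; case: eqP => // ee; move: ei; rewrite ee ffunE asboolF.
Qed.

(** Events prescribing finitely many counts are stable under intersection, so they determine a
    finite measure. The sets counted may overlap; refining them into their atoms reduces the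
    comparison to partitions. *)
Lemma config_measure_unique (m1 m2 : {measure set (Config R d) -> \bar R}) :
  m1 setT < +oo ->
  (forall (I : finType) (A : I -> set (RV R d)) k,
    (forall i, measurable (A i)) -> (forall x, exists2 i, A i x & forall j, A j x -> j = i) ->
    m1 (cnt_event A k) = m2 (cnt_event A k)) ->
  forall D, measurable D -> m1 D = m2 D.
Proof.
move=> m1oo m12.
pose cyl n (B : nat -> set (RV R d)) (k : nat -> nat) : set (Config R d) :=
  [set s | forall i, (i < n)%N -> cnt (B i) s = k i].
pose G : set (set (Config R d)) := [set D | exists n B k,
  (forall i, (i < n)%N -> measurable (B i)) /\ D = cyl n B k].
have mcyl n B k : (forall i, (i < n)%N -> measurable (B i)) -> measurable (cyl n B k).
  move=> mB; rewrite (_ : cyl n B k =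
      \bigcap_(i in [set i | (i < n)%N]) (cnt (B i) @^-1` [set k i] : set (Config R d))).
    apply: fin_bigcap_measurable; first exact: finite_II.
    by move=> i /= iln; exact: (measurable_preim (measurable_cnt (mB i iln)) (A := [set k i])).
  by apply/seteqP; split.
have GT : G setT.
  by exists 0%N, (fun=> setT), (fun=> 0%N); split => //; apply/seteqP; split.
have sG : <<s G >> = @measurable _ (Config R d).
  apply/seteqP; split.
    apply: smallest_sub; first exact: sigma_algebra_measurable.
    by move=> _ [n [B [k [mB ->]]]]; exact: mcyl.
  apply: smallest_sub; first exact: smallest_sigma_algebra.
  move=> _ [B [k [mB ->]]]; apply: sub_sigma_algebra.
  exists 1%N, (fun=> B), (fun=> k); split => //.
  by apply/seteqP; split => [s /= <-//|s /= /(_ 0%N isT)].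
move=> D mD; apply: (g_sigma_algebra_measure_unique G _ (fun=> setT)) => //.
- by move=> _ [n [B [k [mB ->]]]]; exact: mcyl.
- by rewrite bigcup_const.
- move=> _ _ [n1 [B1 [k1 [mB1 ->]]]] [n2 [B2 [k2 [mB2 ->]]]].
  exists (n1 + n2)%N, (fun i => if (i < n1)%N then B1 i else B2 (i - n1)%N),
    (fun i => if (i < n1)%N then k1 i else k2 (i - n1)%N); split.
    move=> i ilt; case: ifPn; first exact: mB1.
    by rewrite -leqNgt => ni; apply: mB2; rewrite ltn_subLR.
  apply/seteqP; split => [s [h1 h2] i ilt|s h].
    case: ifPn => i1; first exact: h1.
    by apply: h2; rewrite ltn_subLR// leqNgt.
  split => i ilt; first by have := h i (ltn_addr _ ilt); rewrite ilt.
  have := h (n1 + i)%N; rewrite ltn_add2l => /(_ ilt).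
  by rewrite ltnNge leq_addr/= addKn.
- move=> _ [n [B [k [mB ->]]]].
  (* A cylinder is the countable disjoint union of the events fixing all atom counts [q] compatible
     with [k]; the vectors [q] are enumerated through [pickle]. *)
  pose cond (q : {ffun {ffun 'I_n -> bool} -> nat}) :=
    [forall i : 'I_n, (\sum_(e : {ffun 'I_n -> bool} | e i) q e == k i)%N].
  pose F j : set (Config R d) := if @pickle_inv {ffun {ffun 'I_n -> bool} -> nat} j is Some q then
     (if cond q then cnt_event (@atom n B) q else set0) else set0.
  have mF j : measurable (F j).
    rewrite /F; case: pickle_inv => // q; case: ifP => // _.
    by apply: measurable_cnt_event => e; exact: measurable_atom.
  have tF : trivIset setT F.
    apply/trivIsetP => i j _ _ ij; rewrite -subset0 => s [].
    rewrite /F; have := @pickle_invK {ffun {ffun 'I_n -> bool} -> nat} i.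
    have := @pickle_invK {ffun {ffun 'I_n -> bool} -> nat} j.
    case: (pickle_inv i) => //= q1; case: (pickle_inv j) => //= q2 pj pi.
    case: ifP => // _ h1; case: ifP => // _ h2.
    move: ij; rewrite -pi -pj; apply/negP; rewrite negbK; apply/eqP; congr pickle.
    by apply/ffunP => e; rewrite -h1 -h2.
  have -> : cyl n B k = \bigcup_j F j.
    apply/seteqP; split => s.
      move=> h; pose q : {ffun {ffun 'I_n -> bool} -> nat} := [ffun e => cnt (atom B e) s].
      exists (pickle q) => //; rewrite /F pickleK_inv ifT; first by move=> e; rewrite ffunE.
      apply/forallP => i; rewrite -(h i)// cnt_atom; apply/eqP.
      by apply: eq_bigr => e _; rewrite ffunE.
    move=> [j _]; rewrite /F; case: pickle_inv => // q; case: ifP => // /forallP cq h i iln.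
    rewrite (cnt_atom B (Ordinal iln)) -(eqP (cq (Ordinal iln))).
    by apply: eq_bigr => e _; exact: h.
  rewrite !measure_semi_bigcup//; [|exact: bigcup_measurable|exact: bigcup_measurable].
  apply: eq_eseriesr => j _; rewrite /F; case: pickle_inv => [q|]; last by rewrite !measure0.
  case: ifP => _; last by rewrite !measure0.
  apply: m12 => [e|x]; first exact: measurable_atom.
  exists [ffun i : 'I_n => `[< B i x >]] => [i|e h]; first by rewrite ffunE.
  by apply/ffunP => i; rewrite ffunE h.
- by rewrite sG.
Qed.

(** * Multinomial counts of independent points *)

Section iid_counts.
Variable m : {finite_measure set RV R d -> \bar R}.
Variables (I : finType) (A : I -> set (RV R d)).
Hypothesis mA : forall i, measurable (A i).
Hypothesis partA : forall x, exists2 i, A i x & forall j, A j x -> j = i.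

(** What the other points must satisfy once one point has fallen into cell [a]. The case [k a = 0]
    is set apart because truncated subtraction would yield a wrong event. *)
Definition cnt_event_cons (k : I -> nat) (a : I) : set (Config R d) :=
  if k a == 0%N then set0 else cnt_event A (fun i => k i - (i == a))%N.

Lemma measurable_cnt_event_cons k a : measurable (cnt_event_cons k a).
Proof.
by rewrite /cnt_event_cons; case: ifP => // _; exact: measurable_cnt_event.
Qed.

Lemma cnt_event_consP k a x s : A a x ->
  cnt_event A k (x :: s : Config R d) <-> cnt_event_cons k a s.
Proof.
move=> Aax; have E i : `[< A i x >] = (i == a).
  have [j _ hj] := partA x; rewrite (hj a Aax).
  by apply/asboolP/eqP => [/hj//|->]; rewrite -(hj a Aax).
rewrite /cnt_event_cons; split.
  move=> h; case: eqP => [k0|_ i /=]; first by have := h a; rewrite cnt_cons E eqxx k0.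
  by rewrite -(h i) cnt_cons E addKn.
case: eqP => // k0 h i; rewrite cnt_cons E (h i).
have [->|ia] := eqVneq i a; last by rewrite subn0.
by rewrite subnKC// lt0n; exact/eqP.
Qed.

Lemma iid_cnt_eventS n k : iid m n.+1 (cnt_event A k) =
  \sum_(a : I) (m (A a) * iid m n (cnt_event_cons k a)).
Proof.
have ie (D : set (Config R d)) j : measurable D -> iid m j D = \int[iid m j]_s ind `[< D s >].
  move=> mD; rewrite integral_ind; last exact: measurable_asbool.
  by congr (iid m j _); apply/seteqP; split => s /asboolP.
have mi (D : set (Config R d)) : measurable D ->
    measurable_fun setT (fun s : Config R d => ind `[< D s >] : \bar R).
  by move=> mD; apply: measurable_ind; exact: measurable_asbool.
have mE := measurable_cnt_event k mA.
rewrite ie// iidS//; [|exact: mi|by move=> s; exact: ind_ge0].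
transitivity (\int[m]_x \sum_(a : I)
    (ind `[< A a x >] * iid m n (cnt_event_cons k a))).
  apply: eq_integral => x _; have [a Aa ha] := partA x.
  rewrite (bigD1 a)//= big1 ?adde0; last first.
    move=> j ja; rewrite asboolF ?mul0e// => /ha ja'.
    by rewrite ja' eqxx in ja.
  rewrite asboolT// mul1e ie; last exact: measurable_cnt_event_cons.
  apply: eq_integral => s _; congr ind; apply/asboolP/asboolP;
  by move/(cnt_event_consP k s Aa).
rewrite ge0_integral_sum//; last 2 first.
- by move=> a; apply: emeasurable_funM => //; apply: measurable_ind; exact: measurable_asbool.
- by move=> a x _; rewrite mule_ge0 ?ind_ge0.
apply: eq_bigr => a _; rewrite ge0_integralZr//; last 2 first.
- by apply: measurable_ind; exact: measurable_asbool.
- by move=> x _; exact: ind_ge0.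
congr (_ * _); rewrite integral_ind; last exact: measurable_asbool.
by congr (m _); apply/seteqP; split => x /asboolP.
Qed.

(** The multinomial distribution. Conditioning on the cell [a] of the first point produces the
    factor [k a], and these factors add up to [n + 1], which completes the factorial. *)
Lemma iid_cnt_event n k : iid m n (cnt_event A k) =
  (if (\sum_i k i == n)%N then n`!%:R * \prod_i (fine (m (A i)) ^+ k i / (k i)`!%:R) else 0)%:E.
Proof.
elim: n k => [|n ih] k.
  rewrite /= diracE; case: eqP => [/eqP|ki].
    rewrite sum_nat_eq0 => /forallP/= k0; rewrite mem_set.
      by rewrite big1 ?mulr1// => i _; rewrite (eqP (k0 i)) expr0 divr1.
    by move=> i; rewrite (eqP (k0 i)).
  rewrite memNset// => h; apply: ki; rewrite big1// => i _.
  by rewrite -(h i).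
rewrite iid_cnt_eventS.
have E a : m (A a) * iid m n (cnt_event_cons k a) =
  (if (\sum_i k i == n.+1)%N then n`!%:R * ((k a)%:R * \prod_i (fine (m (A i)) ^+ k i / (k i)`!%:R)) else 0)%:E.
  rewrite /cnt_event_cons; case: eqP => [->|/eqP ka].
    by rewrite measure0 mule0 mul0r mulr0; case: ifP.
  have Ek : (\sum_i k i)%N = (\sum_i (k i - (i == a))).+1%N.
    rewrite (bigD1 a)//= [in RHS](bigD1 a)//= eqxx.
    rewrite -addSn -subSn ?lt0n// subn1/=; congr addn.
    by apply: eq_bigr => i /negPf ->; rewrite subn0.
  rewrite ih Ek eqSS; case: ifP => _; last by rewrite mule0.
  rewrite -{1}(@fineK _ (m (A a))) ?fin_num_measure// -EFinM; congr (_%:E).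
  rewrite (bigD1 a)//= [in RHS](bigD1 a)//= eqxx.
  rewrite (eq_bigr (fun i => fine (m (A i)) ^+ k i / (k i)`!%:R)%R); last first.
    by move=> i /negPf ->; rewrite subn0.
  move: (\prod_(i | i != a) _)%R => Q.
  case: (k a) ka => // j _; rewrite subn1/= factS natrM exprS.
  have jf : (j`!%:R != 0 :> R)%R by rewrite pnatr_eq0 -lt0n fact_gt0.
  by field; rewrite jf addrC natr1 pnatr_eq0.
rewrite (eq_bigr _ (fun a _ => E a)).
rewrite sumEFin; congr (_%:E); case: eqP => kn; last by rewrite big1.
rewrite -mulr_sumr -mulr_suml -natr_sum kn factS natrM.
by rewrite mulrA (mulrC n`!%:R).
Qed.

End iid_counts.
End config_law.

Lemma mkseqSl (T : Type) (f : nat -> T) n :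
  mkseq f n.+1 = f 0%N :: mkseq (fun i => f i.+1) n.
Proof. by rewrite /mkseq /= -[1%N]addn0 iotaDl -map_comp. Qed.

(** * Poisson and binomial processes as mixtures of independent points *)

Section laws.
Context {R : realType} {d : nat}.
Local Open Scope ereal_scope.

Lemma measure_split dT (T : measurableType dT) (mu : {measure set T -> \bar R})
    (I : finType) (A : I -> set (RV R d)) (S : set T) (f : T -> RV R d) :
  (forall i, measurable (A i)) ->
  (forall x, exists2 i, A i x & forall j, A j x -> j = i) ->
  measurable S -> measurable_fun setT f ->
  mu S = \sum_(a : I) mu (S `&` f @^-1` A a).
Proof.
move=> mA partA mS mf.
have mSa a : measurable (S `&` f @^-1` A a) by apply: measurableI => //; exact: measurable_preim.
have mi (D : set T) : measurable D -> \int[mu]_x ind `[< D x >] = mu D.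
  move=> mD; rewrite integral_ind; last exact: measurable_asbool.
  by congr (mu _); apply/seteqP; split => x /asboolP.
rewrite -mi//; under [RHS]eq_bigr do rewrite -mi//.
rewrite -ge0_integral_sum//; last 2 first.
- by move=> a; apply: measurable_ind; exact: measurable_asbool.
- by move=> a x _; exact: ind_ge0.
apply: eq_integral => x _; have [a Aa ha] := partA (f x).
rewrite (bigD1 a)//= big1 ?adde0 => [|j ja].
  by congr ind; apply/asboolP/asboolP => [//|[]].
rewrite asboolF// => -[_ /ha ja'].
by rewrite ja' eqxx in ja.
Qed.

Variable m : {finite_measure set RV R d -> \bar R}.
Hypothesis m1 : m setT = 1.

Lemma partition_mass (I : finType) (A : I -> set (RV R d)) :
  (forall i, measurable (A i)) ->
  (forall x, exists2 i, A i x & forall j, A j x -> j = i) ->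
  (\sum_i fine (m (A i)) = 1)%R.
Proof.
move=> mA partA; apply: EFin_inj; rewrite -sumEFin.
apply: (@etrans _ _ (m setT)); last exact: m1.
rewrite (measure_split m mA partA measurableT (@measurable_id _ _ setT)).
by apply: eq_bigr => a _; rewrite fineK ?fin_num_measure// setTI.
Qed.

Lemma poisson_pmf'_ge0 (t : R) n : (0 <= t)%R -> (0 <= poisson_pmf' t n)%R.
Proof. by move=> t0; rewrite /poisson_pmf' mulr_ge0 ?expR_ge0// divr_ge0// exprn_ge0. Qed.

(** Poisson splitting: a Poisson total distributed multinomially over the cells gives independent
    Poisson counts. *)
Lemma prod_poisson_pmf' (I : finType) (p : I -> R) (k : I -> nat) (t : R) :
  (\sum_i p i = 1)%R ->
  (poisson_pmf' t (\sum_i k i)%N * ((\sum_i k i)%N`!%:R * \prod_i (p i ^+ k i / (k i)`!%:R)) =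
   \prod_i poisson_pmf' (t * p i) (k i))%R.
Proof.
move=> p1; rewrite /poisson_pmf' [RHS]big_split/=.
have -> : (\prod_i expR (- (t * p i)) = expR (- t))%R.
  rewrite -[in RHS](mulr1 t) -[in RHS]p1 mulr_sumr -sumrN.
  by rewrite (big_morph _ (@expRD R) (@expR0 R)).
have -> : (\prod_i ((t * p i) ^+ k i / (k i)`!%:R) =
    t ^+ (\sum_i k i)%N * \prod_i (p i ^+ k i / (k i)`!%:R))%R.
  rewrite -prodrXr -big_split/=; apply: eq_bigr => i _.
  by rewrite exprMn mulrA.
have : ((\sum_i k i)%N`!%:R != 0 :> R)%R by rewrite pnatr_eq0 -lt0n fact_gt0.
by move=> ?; field.
Qed.

(** On a partition the counts determine the total [N], so a single term of the mixture survives, and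
    it is evaluated by Poisson splitting. *)
Lemma poisson_process_law dO (O : measurableType dO) (P : probability O R)
    (eta : O -> Config R d) (t : R) : (0 <= t)%R ->
  poisson_process P eta (fun B => t * fine (m B))%R ->
  forall D, measurable D ->
  P (eta @^-1` D) = \sum_(n <oo) (poisson_pmf' t n)%:E * iid m n D.
Proof.
move=> t0 [meta [pcnt pind]].
pose w n := NngNum (poisson_pmf'_ge0 n t0).
pose mix := mseries (fun n => mscale (w n) (iid m n)) 0.
move=> D mD; change (pushm P meta D = mix D); move: D mD.
apply: config_measure_unique; first by change (P setT < +oo); rewrite probability_setT ltry.
move=> I A k mA partA.
pose N := (\sum_i k i)%N.
apply: (@etrans _ _ ((poisson_pmf' t N)%:E * iid m N (cnt_event A k))); last first.
  apply/esym; change (\sum_(0 <= n <oo) (poisson_pmf' t n)%:E * iid m n (cnt_event A k) =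
    (poisson_pmf' t N)%:E * iid m N (cnt_event A k)).
  rewrite (@nneseriesD1 _ _ N)//; last first.
    by move=> n _; rewrite mule_ge0// lee_fin poisson_pmf'_ge0.
  rewrite eseries0 ?adde0// => n _ /= nN.
  by rewrite iid_cnt_event// -/N eq_sym (negbTE nN) mule0.
rewrite iid_cnt_event// -/N eqxx -EFinM prod_poisson_pmf' ?partition_mass//.
(* The cell of the origin serves as the default element for [nth]. *)
have [i0 _ _] := partA (0%R : 'rV[R]_d).
pose B j := A (nth i0 (enum I) j); pose kk j := k (nth i0 (enum I) j).
have disjB i j : (i < #|I|)%N -> (j < #|I|)%N -> i <> j -> [disjoint B i & B j].
  move=> il jl ij; apply/eqP; rewrite -subset0 => x [Bi Bj].
  have [a _ ha] := partA x; apply: ij; apply/eqP.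
  rewrite -(nth_uniq i0 _ _ (enum_uniq I)) -?cardE//.
  by rewrite (ha _ Bi) (ha _ Bj).
have := pind #|I| B kk (fun i _ => mA _) disjB.
have -> : \bigcap_(i in [set i | (i < #|I|)%N]) eta @^-1` (cnt (B i) @^-1` [set kk i]) =
    eta @^-1` cnt_event A k.
  apply/seteqP; split => o h i.
    have := h (enum_rank i : nat) (ltn_ord _).
    by rewrite /B /kk /= nth_enum_rank.
  by move=> _; exact: h.
move=> hP; change (P (eta @^-1` cnt_event A k) =
  (\prod_i poisson_pmf' (t * fine (m (A i))) (k i))%:E); rewrite hP.
rewrite (eq_bigr (fun i : 'I_#|I| => (poisson_pmf' (t * fine (m (B i))) (kk i))%:E)); last first.
  by move=> i _; exact: (pcnt _ (mA _)).
rewrite prodEFin; congr (_%:E).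
by rewrite -(big_enum _ _ _ (fun i => poisson_pmf' (t * fine (m (A i))) (k i))) (big_nth i0) -cardE big_mkord.
Qed.

(** Independence is given for boxes, whereas the law is tested on counts. The mixed claim [H]
    prescribes a box for each of the first [j] points and counts for the other [l]; induction on [l]
    moves one point from the second group to the first, according to its cell. *)
Lemma binomial_process_law dO (O : measurableType dO) (P : probability O R)
    (eta : O -> Config R d) (K : set 'rV[R]_d) n :
  (forall B : set (RV R d), measurable B -> m B = vol (B `&` K)) ->
  binomial_process P eta K n ->
  forall D, measurable D -> P (eta @^-1` D) = iid m n D.
Proof.
move=> mE [meta [X [mX [XP etaE]]]] D mD; change (pushm P meta D = iid m n D); move: D mD.
apply: config_measure_unique; first by change (P setT < +oo); rewrite probability_setT ltry.
move=> I A k mA partA.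
change (P (eta @^-1` cnt_event A k) = iid m n (cnt_event A k)).
have mXf i : measurable_fun setT (X i : O -> RV R d).
  by move=> _ B mB; rewrite setTI; exact: mX.
pose pre j (B : nat -> set (RV R d)) := \bigcap_(i in [set i | (i < j)%N]) (X i @^-1` B i).
pose suf j : O -> Config R d := fun w => mkseq (fun i => X (j + i)%N w) (n - j)%N.
have sufS j w : (j < n)%N -> suf j w = (X j w : RV R d) :: suf j.+1 w.
  move=> jn; rewrite /suf -(subnSK jn) mkseqSl addn0; congr (_ :: _).
  by apply: eq_map => i; rewrite addSnnS.
have msuf j l : (j + l = n)%N -> measurable_fun setT (suf j).
  elim: l j => [|l ih] j jl.
    apply: (eq_measurable_fun (fun=> [::] : Config R d)) => //.
    by move=> w _; rewrite /suf -jl addn0 subnn.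
  apply: (eq_measurable_fun (fun w => (X j w : RV R d) :: suf j.+1 w : Config R d)).
    by move=> w _; apply/esym/sufS; rewrite -jl; lia.
  by apply: measurable_fun_ccons => //; apply: ih; rewrite addSnnS.
suff H l j (B : nat -> set (RV R d)) q : (j + l = n)%N ->
    (forall i, (i < j)%N -> measurable (B i)) ->
    P (pre j B `&` suf j @^-1` cnt_event A q) =
    (\prod_(i < j) m (B i)) * iid m l (cnt_event A q).
  have := H n 0%N (fun=> setT) k erefl; rewrite big_ord0 mul1e => <-//.
  congr (P _); apply/seteqP; split => w.
    by rewrite /= etaE /suf subn0 => h; split.
  by move=> [_]; rewrite /suf /= subn0 etaE.
elim: l j B q => [|l ih] j B q jl mB.
  rewrite addn0 in jl; subst j.
  have sufn w : suf n w = [::] by rewrite /suf subnn.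
  rewrite /= diracE; have [h|h] := boolP (([::] : Config R d) \in cnt_event A q).
    rewrite mule1 (_ : _ `&` _ = pre n B).
      by rewrite XP//; apply: eq_bigr => i _; rewrite mE//; exact: mB.
    by apply/seteqP; split => [w []//|w pw]; split => //=; rewrite sufn; exact: set_mem.
  rewrite mule0 (_ : _ `&` _ = set0) ?measure0//.
  rewrite -subset0 => w [_ /=]; rewrite sufn => h'.
  by move/negP : h; apply; rewrite inE.
have jn : (j < n)%N by rewrite -jl; lia.
have mpre : measurable (pre j B).
  by apply: fin_bigcap_measurable => [|i /= ij]; [exact: finite_II|exact: mX (mB i ij)].
have mS : measurable (pre j B `&` suf j @^-1` cnt_event A q).
  apply: measurableI => //; apply: (measurable_preim (msuf j l.+1 jl)).
  exact: measurable_cnt_event.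
rewrite (measure_split P mA partA mS (mXf j)) iid_cnt_eventS//.
rewrite ge0_sume_distrr; last by move=> a _; rewrite mule_ge0.
apply: eq_bigr => a _.
pose Ba i := if i == j then A a else B i.
have mBa i : (i < j.+1)%N -> measurable (Ba i).
  by rewrite /Ba ltnS leq_eqVlt => /orP[/eqP ->|ij]; rewrite ?eqxx// ltn_eqF//; exact: mB.
have -> : (pre j B `&` suf j @^-1` cnt_event A q) `&` X j @^-1` A a =
    pre j.+1 Ba `&` suf j.+1 @^-1` cnt_event_cons A q a.
  apply/seteqP; split => [w [[pw sw] Xa]|w [pw sw]].
    split; last by rewrite /= -(cnt_event_consP partA q _ Xa) -sufS.
    move=> i /=; rewrite /Ba ltnS leq_eqVlt => /orP[/eqP ->|ij]; first by rewrite eqxx.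
    by rewrite ltn_eqF//; exact: pw.
  have Xa : A a (X j w) by have := pw j (ltnSn j); rewrite /Ba /= eqxx.
  split => //; split; last by rewrite /= sufS// (cnt_event_consP partA q _ Xa).
  move=> i /= ij; have := pw i (ltnW ij : (i < j.+1)%N).
  by rewrite /Ba ltn_eqF.
rewrite muleA.
have -> : (\prod_(i < j) m (B i)) * m (A a) = \prod_(i < j.+1) m (Ba i).
  rewrite big_ord_recr/= /Ba eqxx; congr (_ * _).
  by apply: eq_bigr => i _; rewrite ltn_eqF.
rewrite /cnt_event_cons; case: ifP => _.
  by rewrite preimage_set0 setI0 !measure0 mule0.
by apply: ih => //; rewrite addSnnS.
Qed.

End laws.

(** * Couplings through a common part *)

Section measure_difference.
Context {R : realType} dT (T : measurableType dT).
Local Open Scope ereal_scope.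

Lemma measure_diff_exists (mu nu : {finite_measure set T -> \bar R}) :
  (forall A, measurable A -> nu A <= mu A) ->
  exists del : {finite_measure set T -> \bar R},
    forall A, measurable A -> mu A = nu A + del A.
Proof.
move=> numu.
(* The difference is cut to zero on non-measurable sets because nonnegativity is required of every
   set. *)
pose del A := if `[< measurable A >] then mu A - nu A else 0.
have fnu A : measurable A -> nu A \is a fin_num by move=> mA; exact: fin_num_measure.
have fmu A : measurable A -> mu A \is a fin_num by move=> mA; exact: fin_num_measure.
have delE A : measurable A -> del A = mu A - nu A.
  by move=> mA; rewrite /del asboolT.
have del0 : del set0 = 0 by rewrite delE// !measure0 sube0.
have del_ge0 A : 0 <= del A.
  rewrite /del; case: asboolP => // mA.
  by rewrite sube_ge0 ?fnu ?fmu// numu.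
have del_sigma : semi_sigma_additive del.
  move=> F mF tF mU; rewrite delE//.
  rewrite (_ : (fun n => _) = (fun n => \sum_(0 <= i < n) mu (F i) - \sum_(0 <= i < n) nu (F i))).
    apply: cvgeB.
    - by rewrite fin_num_adde_defl// fin_numN fnu.
    - exact: measure_semi_sigma_additive.
    - exact: measure_semi_sigma_additive.
  apply/funext => n; rewrite -fin_num_sumeN; last by move=> i _; exact: fnu.
  rewrite -big_split/=; apply: eq_bigr => i _; exact: delE.
pose del1 : {measure set T -> \bar R} :=
  HB.pack del (isMeasure.Build _ _ _ del del0 del_ge0 del_sigma).
have delT : del1 setT < +oo.
  change (del setT < +oo).
  by rewrite delE// -ge0_fin_numE ?fin_numB ?fmu ?fnu// sube_ge0 ?fnu ?fmu// numu.
exists (finm delT : {finite_measure set T -> \bar R}) => A mA.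
change (mu A = nu A + del A).
by rewrite delE// addeC subeK// fnu.
Qed.

Definition probm (mu : {measure set T -> \bar R}) (h : mu setT = 1) :
  set T -> \bar R := mu.

Section probm_probability.
Variables (mu : {measure set T -> \bar R}) (h : mu setT = 1).
HB.instance Definition _ := Measure.on (probm h).
HB.instance Definition _ := Measure_isProbability.Build _ _ _ (probm h) h.
End probm_probability.

End measure_difference.

Section coupling.
Context {R : realType} {d : nat}.
Local Open Scope ereal_scope.

Lemma dTV_ge0 (s1 s2 : config R d) : 0 <= dTV s1 s2.
Proof.
apply: (@le_trans _ _ (`| (cnt setT s1)%:R - (cnt setT s2)%:R |%R)%:E) => //.
by apply: ereal_sup_ubound; exists setT => //; exact: (@measurableT _ (RV R d)).
Qed.

Lemma dTV_refl (s : config R d) : dTV s s = 0.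
Proof.
apply/eqP; rewrite eq_le dTV_ge0 andbT; apply: ge_ereal_sup => _ [A _ <-].
by rewrite subrr normr0.
Qed.

Lemma dTV_le_size (s1 s2 : config R d) :
  dTV s1 s2 <= (size s1)%:R%:E + (size s2)%:R%:E.
Proof.
apply: ge_ereal_sup => _ [A _ <-]; rewrite -EFinD lee_fin.
apply: le_trans (ler_normB _ _) _; rewrite !normr_nat lerD// ler_nat;
exact: cnt_le_size.
Qed.

Definition esize (s : Config R d) : \bar R := (size s)%:R%:E.

Lemma measurable_esize : measurable_fun setT esize.
Proof. exact: (measurable_fun_nat1 (fun n => n%:R%:E : \bar R) (@measurable_size R d)). Qed.

Lemma esize_ge0 s : 0 <= esize s.
Proof. by rewrite /esize lee_fin. Qed.

Definition diag (s : Config R d) : Config R d * Config R d := (s, s).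

Lemma measurable_diag : measurable_fun setT diag.
Proof. exact: measurable_fun_pair. Qed.

Import HBNNSimple.

(* [dTV] is not known to be measurable, so its integral is estimated through the simple functions below it; these vanish on the diagonal. *)
Lemma coupling_exists (mu1 mu2 : probability (Config R d) R)
    (nu : {finite_measure set (Config R d) -> \bar R}) (L1 L2 l : R) :
  (forall A, measurable A -> nu A <= mu1 A) ->
  (forall A, measurable A -> nu A <= mu2 A) ->
  \int[mu1]_s esize s <= L1%:E -> \int[mu2]_s esize s <= L2%:E ->
  l%:E <= \int[nu]_s esize s ->
  exists Q : probability (Config R d * Config R d)%type R,
    [/\ forall A, measurable A -> Q (fst @^-1` A) = mu1 A,
        forall A, measurable A -> Q (snd @^-1` A) = mu2 A &
        \int[Q]_z dTV z.1 z.2 <= (L1 + L2 - 2 * l)%:E].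
Proof.
move=> nu1 nu2 hL1 hL2 hl.
have [del1 E1] := measure_diff_exists nu1.
have [del2 E2] := measure_diff_exists nu2.
pose s := fine (del1 setT).
have sE1 : del1 setT = s%:E by rewrite fineK// fin_num_measure.
have sE2 : del2 setT = s%:E.
  have e1 : 1 = nu setT + del1 setT by rewrite -(probability_setT mu1); exact: E1.
  have e2 : 1 = nu setT + del2 setT by rewrite -(probability_setT mu2); exact: E2.
  move: e2 e1; rewrite sE1.
  have -> : nu setT = (fine (nu setT))%:E by rewrite fineK// fin_num_measure.
  have -> : del2 setT = (fine (del2 setT))%:E by rewrite fineK// fin_num_measure.
  by rewrite -!EFinD => -[e2] [e1]; congr (_%:E); lra.
have s0 : (0 <= s)%R by rewrite fine_ge0.
have si0 : (0 <= s^-1)%R by rewrite invr_ge0.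
(* Independent coupling of the remainders, normalised by their common mass [s]. If [s = 0] both
   remainders vanish, and so does [rest]. *)
pose rest : {measure set (Config R d * Config R d) -> \bar R} := mscale (NngNum si0) (prodm del1 del2).
pose Q0 : {measure set (Config R d * Config R d) -> \bar R} := measure_add (pushm nu measurable_diag) rest.
have Q0E A : Q0 A = nu (diag @^-1` A) + s^-1%:E * prodm del1 del2 A.
  exact: (measure_addE (pushm nu measurable_diag) rest).
have cancel_s (del : {finite_measure set (Config R d) -> \bar R}) A : measurable A ->
    del setT = s%:E -> s^-1%:E * (del A * s%:E) = del A.
  move=> mA dT; have [sz|sn] := eqVneq s 0%R.
    rewrite sz mule0 mule0; apply/esym/eqP; rewrite eq_le measure_ge0 andbT.
    by rewrite -[leRHS](_ : s%:E = 0) ?sz// -sz -dT le_measure// inE.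
  by rewrite muleCA -EFinM mulVf// mule1.
have m1 A : measurable A -> Q0 (fst @^-1` A) = mu1 A.
  move=> mA; rewrite Q0E E1//; congr (_ + _).
  rewrite (_ : fst @^-1` A = A `*` setT); last by apply/seteqP; split => z //= -[].
  rewrite prodmX//; change (s^-1%:E * (del1 A * del2 setT) = del1 A).
  by rewrite sE2; exact: cancel_s.
have m2 A : measurable A -> Q0 (snd @^-1` A) = mu2 A.
  move=> mA; rewrite Q0E E2//; congr (_ + _).
  rewrite (_ : snd @^-1` A = setT `*` A); last by apply/seteqP; split => z //= -[].
  rewrite prodmX//; change (s^-1%:E * (del1 setT * del2 A) = del2 A).
  by rewrite sE1 [X in _ * X]muleC; exact: cancel_s.
have Q0T : Q0 setT = 1 by rewrite -(preimage_setT fst) m1// probability_setT.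
exists (probm Q0T); split => //.
pose I1 := \int[del1]_s esize s; pose I2 := \int[del2]_s esize s.
have me := measurable_esize; have e0 := esize_ge0.
have split_int (mu : probability (Config R d) R) (del : {finite_measure set (Config R d) -> \bar R}) L :
    (forall A, measurable A -> mu A = nu A + del A) ->
    \int[mu]_s esize s <= L%:E -> \int[del]_s esize s <= (L - l)%:E.
  move=> E hL; rewrite EFinB leeBrDr//; apply: le_trans hL.
  have -> : \int[mu]_s esize s = \int[measure_add del nu]_s esize s.
    apply: eq_measure_integral => A mA _.
    by apply: (etrans (E A mA)); rewrite addeC; apply/esym; exact: (measure_addE del nu).
  by rewrite ge0_integral_measure_add// leeD2l.
have hI1 : I1 <= (L1 - l)%:E by exact: split_int E1 hL1.
have hI2 : I2 <= (L2 - l)%:E by exact: split_int E2 hL2.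
have rest_int : \int[rest]_z (esize z.1 + esize z.2) <= I1 + I2.
  have mz1 : measurable_fun setT (fun z : Config R d * Config R d => esize z.1) by exact: measurableT_comp.
  have mz2 : measurable_fun setT (fun z : Config R d * Config R d => esize z.2) by exact: measurableT_comp.
  have mz : measurable_fun setT (fun z : Config R d * Config R d => esize z.1 + esize z.2).
    exact: emeasurable_funD.
  rewrite (ge0_integral_mscale _ measurableT (NngNum si0) mz); last first.
    by move=> z _; rewrite adde_ge0.
  rewrite (ge0_integral_prodm _ _ mz); last by move=> z; rewrite adde_ge0.
  have -> : \int[del1]_x \int[del2]_y (esize x + esize y) = \int[del1]_x (esize x * s%:E + I2).
    apply: eq_integral => x _; rewrite ge0_integralD//.
    congr (_ + _); rewrite integral_cst//.
    exact: (congr1 (fun t => esize x * t) sE2).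
  rewrite ge0_integralD//; last 3 first.
  - by move=> x _; rewrite mule_ge0// lee_fin.
  - by apply: emeasurable_funM.
  - by move=> x _; exact: integral_ge0.
  rewrite ge0_integralZr// ?lee_fin// integral_cst//.
  change (s^-1%:E * (I1 * s%:E + I2 * del1 setT) <= I1 + I2); rewrite sE1.
  rewrite -muleDl// ; last by rewrite ge0_adde_def// inE integral_ge0.
  have [->|sn] := eqVneq s 0%R; first by rewrite !mule0 adde_ge0// integral_ge0.
  by rewrite muleCA -EFinM mulVf// mule1.
apply: (@le_trans _ _ (I1 + I2)); last first.
  by apply: (le_trans (leeD hI1 hI2)); rewrite -EFinD lee_fin; lra.
rewrite ge0_integralTE; last by move=> z; exact: dTV_ge0.
apply: ge_ereal_sup => _ [h /= hf <-].
have mh : measurable_fun setT (fun z => (h z)%:E) by exact/measurable_EFinP.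
have h0 z : 0 <= (h z)%:E by rewrite lee_fin.
have -> : sintegral (probm Q0T) h = \int[probm Q0T]_z (h z)%:E.
  by rewrite integral_nnsfun// patch_setT.
change (\int[Q0]_z (h z)%:E <= I1 + I2).
rewrite ge0_integral_measure_add// ge0_integral_pushm//.
rewrite integral0_eq => [|x _]; last first.
  by apply/eqP; rewrite eq_le h0 andbT; apply: le_trans (hf _) _; rewrite dTV_refl.
rewrite add0e; apply: le_trans rest_int; apply: ge0_le_integralT => // z.
by apply: le_trans (hf z) _; exact: dTV_le_size.
Qed.

End coupling.

(** * Estimates for Poisson and binomial weights *)

Section real_estimates.
Context {R : realType}.

(** Weierstrass' product inequality; truncating the factors at zero keeps it valid for large
    [x j]. *)
Lemma prod_ge_one_sub_sum n (x : nat -> R) : (forall j, 0 <= x j) ->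
  1 - \sum_(j < n) x j <= \prod_(j < n) Num.max 0 (1 - x j).
Proof.
move=> x0; elim: n => [|n ih]; first by rewrite !big_ord0 subr0.
rewrite !big_ord_recr/=.
have P0 : 0 <= \prod_(j < n) Num.max 0 (1 - x j).
  by apply: prodr_ge0 => j _; rewrite le_max lexx.
have P1 : \prod_(j < n) Num.max 0 (1 - x j) <= 1.
  apply: prodr_ile1 => j _; rewrite le_max lexx/= ge_max ler01/=.
  by rewrite gerBl.
set P := \prod_(j < n) _ in ih P0 P1 *.
have M : 1 - x n <= Num.max 0 (1 - x n) by rewrite le_max lexx orbT.
have M0 : 0 <= Num.max 0 (1 - x n) by rewrite le_max lexx.
have s0 : 0 <= \sum_(j < n) x j by apply: sumr_ge0.
have y0 := x0 n; set y := x n in M M0 y0 *.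
have : P * (1 - y) <= P * Num.max 0 (1 - y) by rewrite ler_wpM2l.
by nra.
Qed.

(** Since [exp y >= 1 + y], it suffices that [(1 - x) (1 + x + 2 x^2) = 1 + x^2 (1 - 2 x)] is at
    least one. *)
Lemma one_sub_ge_exp (x : R) : 0 <= x -> x <= 1 / 2 -> expR (- (x + 2 * x ^+ 2)) <= 1 - x.
Proof.
move=> x0 x1; rewrite expRN invf_ple ?posrE ?expR_gt0//; last by lra.
apply: le_trans (expR_ge1Dx _); rewrite -[leLHS]mul1r ler_pdivrMr; last by lra.
by nra.
Qed.

(* The factor [4 (1 + lam)] makes the right-hand side nonpositive as soon as some [x j] exceeds [1 / 2]. *)
Lemma prod_lower (lam : R) n (x : nat -> R) : 0 <= lam -> (forall j, 0 <= x j) ->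
  expR (- lam) * (1 + lam - \sum_(j < n) x j - 4 * (1 + lam) * \sum_(j < n) x j ^+ 2)
  <= \prod_(j < n) Num.max 0 (1 - x j).
Proof.
move=> lam0 x0.
have s0 : 0 <= \sum_(j < n) x j by apply: sumr_ge0.
have q0 : 0 <= \sum_(j < n) x j ^+ 2 by apply: sumr_ge0 => j _; exact: sqr_ge0.
have [/forallP small|/forallPn[i]] := boolP [forall j : 'I_n, x j <= 1 / 2].
  apply: (@le_trans _ _ (\prod_(j < n) expR (- (x j + 2 * x j ^+ 2)))); last first.
    apply: ler_prod => j _; rewrite expR_ge0/= le_max.
    by rewrite one_sub_ge_exp ?orbT.
  rewrite -(big_morph _ (@expRD R) (@expR0 R)) sumrN big_split/= -mulr_sumr.
  set s := \sum_(j < n) x j in s0 *; set q := \sum_(j < n) x j ^+ 2 in q0 *.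
  (* The exponential is linearised around [-lam], because the sum [s] is close to [lam] and not to
     zero in the applications. *)
  rewrite (_ : - (s + 2 * q) = - lam + (lam - s - 2 * q)); last by ring.
  rewrite expRD ler_wpM2l ?expR_ge0//.
  by apply: le_trans (expR_ge1Dx _); nra.
rewrite -ltNge => xi.
apply: (@le_trans _ _ 0); last by apply: prodr_ge0 => j _; rewrite le_max lexx.
rewrite mulr_ge0_le0 ?expR_ge0//.
have : 1 / 4 <= \sum_(j < n) x j ^+ 2.
  rewrite (bigD1 i)//=; apply: (@le_trans _ _ (x i ^+ 2)); first by nra.
  by rewrite lerDl sumr_ge0// => j _; exact: sqr_ge0.
by nra.
Qed.

(** [prod_lower] with [x j = (c + j) b]. The linear sum is kept exact because it has to cancel [lam]
    to leading order; the quadratic one is bounded crudely, with [16 (1 + lam) lam^2 / t^4 = 4 (1 +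
    lam) b^2]. *)
Lemma surv_lower (lam t : R) (c n : nat) : 0 <= lam -> 0 < t ->
  expR (- lam) * (1 + lam - (2 * lam / t ^+ 2) * (c%:R * n%:R + n%:R * (n%:R - 1) / 2)
    - 16 * (1 + lam) * lam ^+ 2 / t ^+ 4 * (n%:R * (c%:R + n%:R) ^+ 2))
  <= surv (2 * lam / t ^+ 2) c n.
Proof.
move=> lam0 t0; set b := 2 * lam / t ^+ 2.
have b0 : 0 <= b by rewrite divr_ge0 ?mulr_ge0 ?exprn_ge0// ltW.
have x0 j : 0 <= (c + j)%:R * b by rewrite mulr_ge0.
apply: le_trans (@prod_lower lam n _ lam0 x0).
rewrite ler_wpM2l ?expR_ge0//.
have -> : \sum_(j < n) (c + j)%:R * b = b * (c%:R * n%:R + n%:R * (n%:R - 1) / 2).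
  elim: n => [|n ih]; first by rewrite big_ord0 mul0r mulr0 mul0r addr0 mulr0.
  rewrite big_ord_recr/= ih natrD -[n.+1%:R]natr1; clearbody b.
  by field.
have q : \sum_(j < n) ((c + j)%:R * b) ^+ 2 <= b ^+ 2 * (n%:R * (c%:R + n%:R) ^+ 2).
  apply: (@le_trans _ _ (\sum_(j < n) b ^+ 2 * (c%:R + n%:R) ^+ 2)).
    apply: ler_sum => j _; rewrite exprMn mulrC ler_wpM2l ?sqr_ge0// natrD.
    by rewrite lerXn2r ?nnegrE ?addr_ge0// lerD2l ler_nat ltnW.
  by rewrite sumr_const card_ord -[leLHS]mulr_natl mulrCA lexx.
have -> : 16 * (1 + lam) * lam ^+ 2 / t ^+ 4 = 4 * (1 + lam) * b ^+ 2.
  by rewrite /b; field; exact: lt0r_neq0.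
have L0 : 0 <= 4 * (1 + lam) by rewrite mulr_ge0// addr_ge0.
have := ler_wpM2l L0 q.
set s := \sum_(j < n) _; move: (n%:R * _) => Q.
by rewrite mulrA lerD2l lerN2.
Qed.

(** The factors [N - i] are at least [t - i], and the numbers [i < j] add up to at most [j^2]. For
    [j > t] the bound is negative. *)
Lemma ffact_lower (t : R) (N j : nat) : 0 < t -> t <= N%:R ->
  1 - (j ^ 2)%:R / t <= (N ^_ j)%:R / t ^+ j.
Proof.
move=> t0 tN; elim: j => [|j ih]; first by rewrite ffactn0 mul0r subr0 expr0 divr1.
have x0 : 0 <= (N ^_ j)%:R / t ^+ j by rewrite divr_ge0 ?exprn_ge0// ltW.
have -> : (N ^_ j.+1)%:R / t ^+ j.+1 = (N ^_ j)%:R / t ^+ j * ((N - j)%:R / t).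
  by rewrite ffactnSr natrM exprSr; field; rewrite expf_neq0 gt_eqF.
set x := _ / t ^+ j in ih x0 *.
rewrite !natrX in ih *; rewrite -[j.+1%:R]natr1.
have jt0 : 0 <= j%:R / t by rewrite divr_ge0// ltW.
have y0 : 0 <= (N - j)%:R / t by rewrite divr_ge0// ltW.
have [jt|tj] := leP (j%:R) t; last first.
  apply: (@le_trans _ _ 0); last exact: mulr_ge0.
  by rewrite subr_le0 ler_pdivlMr//; have : 0 <= j%:R :> R by []; nra.
have y1 : 1 - j%:R / t <= (N - j)%:R / t.
  rewrite natrB; last by rewrite -(ler_nat R); exact: le_trans tN.
  by rewrite -{1}(divff (lt0r_neq0 t0)) -mulrBl ler_pM2r ?invr_gt0// lerB.
have jt1 : j%:R / t <= 1 by rewrite ler_pdivrMr// mul1r.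
apply: (@le_trans _ _ (x * (1 - j%:R / t))); last exact: ler_wpM2l.
have E : (j%:R + 1) ^+ 2 / t = j%:R ^+ 2 / t + 2 * (j%:R / t) + t^-1.
  by field; exact: lt0r_neq0.
rewrite E; have ti : 0 < t^-1 by rewrite invr_gt0.
have q0 : 0 <= j%:R ^+ 2 / t by rewrite divr_ge0 ?exprn_ge0// ltW.
set p := j%:R / t in jt0 jt1 *; set q := j%:R ^+ 2 / t in ih q0 *.
have : (1 - q) * (1 - p) <= x * (1 - p) by rewrite ler_wpM2r// subr_ge0.
by nra.
Qed.

End real_estimates.

(** * Factorial moments of the Poisson distribution *)

Section poisson_moments.
Context {R : realType}.
Local Open Scope ereal_scope.

(** Singling out [j] of the points costs a factor [t ^+ j] and leaves a Poisson number of others;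
    this is the Mecke formula at the level of totals. *)
Lemma poisson_pmf'_ffact (t : R) (n j : nat) : (0 < t)%R ->
  (poisson_pmf' t (j + n) * ((j + n) ^_ j)%:R = t ^+ j * poisson_pmf' t n)%R.
Proof.
move=> t0; rewrite /poisson_pmf' exprD.
have := @ffact_fact (j + n) j (leq_addr _ _); rewrite addKn => E.
have : (n`!%:R != 0 :> R)%R by rewrite pnatr_eq0 -lt0n fact_gt0.
have : (((j + n) ^_ j)%:R != 0 :> R)%R by rewrite pnatr_eq0 -lt0n ffact_gt0 leq_addr.
by rewrite -E natrM => h1 h2; field; rewrite h1 h2.
Qed.

Lemma poisson_mass (t : R) : (0 < t)%R -> \sum_(n <oo) (poisson_pmf' t n)%:E = 1.
Proof.
move=> t0; have <- := @probability_setT _ _ _ (poisson_prob t 0%N).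
rewrite /= /poisson_prob t0 -nneseries_esumT; last first.
  by move=> n; rewrite lee_fin poisson_pmf_ge0.
by apply: eq_eseriesr => n _; rewrite /poisson_pmf t0.
Qed.

Lemma nneseries_shift (f : nat -> \bar R) j : (forall n, 0 <= f n) ->
  (forall n, (n < j)%N -> f n = 0) ->
  \sum_(n <oo) f n = \sum_(n <oo) f (j + n)%N.
Proof.
move=> f0 fj; rewrite (@nneseries_split _ f 0 j)// add0n.
rewrite big_nat_cond big1 ?add0e; last by move=> i; rewrite andbT => /andP[_ ij]; exact: fj.
by rewrite -nneseries_addn//; apply: eq_eseriesr => n _; rewrite addnC.
Qed.

Lemma poisson_moment (t : R) j : (0 < t)%R ->
  \sum_(n <oo) (poisson_pmf' t n * (n ^_ j)%:R)%:E = (t ^+ j)%:E.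
Proof.
move=> t0; rewrite (@nneseries_shift _ j).
- under eq_eseriesr do rewrite poisson_pmf'_ffact// EFinM.
  rewrite nneseriesZl; last by move=> n _; rewrite lee_fin poisson_pmf'_ge0// ltW.
  by rewrite poisson_mass// mule1.
- by move=> n; rewrite lee_fin mulr_ge0// poisson_pmf'_ge0// ltW.
- by move=> n nj; rewrite ffact_small// mulr0.
Qed.

End poisson_moments.

(** * Lower bounds for the weight of k close pairs *)

Section weights.
Context {R : realType}.

(** One constant for both processes: [4] pays for [(2 k)^2] in [ffact_lower], [4 lam] for the linear
    terms of [surv_lower], and the last summand is eight times its quadratic constant
    [16 (1 + lam) lam^2]. *)
Definition weight_const (lam : R) : R := 4 + 4 * lam + 128 * (1 + lam) * lam ^+ 2.

Definition weight (lam t : R) (k : nat) : R :=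
  expR (- lam) * Num.max 0 (1 - weight_const lam * k.+1%:R ^+ 2 / t).

Lemma weight_ge0 lam t k : 0 <= weight lam t k.
Proof. by rewrite mulr_ge0 ?expR_ge0// le_max lexx. Qed.

Lemma weight_const_ge0 lam : 0 <= lam -> 0 <= weight_const lam.
Proof. by move=> l0; rewrite /weight_const; nra. Qed.

Lemma weight_le lam t k : 0 <= lam -> 0 < t -> weight lam t k <= expR (- lam).
Proof.
move=> l0 t0; rewrite ler_piMr ?expR_ge0// ge_max ler01/= gerBl.
by rewrite divr_ge0 ?mulr_ge0 ?exprn_ge0 ?weight_const_ge0// ltW.
Qed.

Lemma natr_ffactS n m : (n ^_ m.+1)%:R = (n ^_ m)%:R * (n%:R - m%:R) :> R.
Proof.
rewrite ffactnSr natrM; have [mn|nm] := leqP m n; first by rewrite natrB.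
by rewrite ffact_small// !mul0r.
Qed.

(** After [2 k] points are singled out, their number being Poisson again, [surv_lower] is averaged
    over the remaining number [n]. Its loss is a cubic polynomial in [n], whose mean follows from
    the factorial moments [t ^+ j]. *)
Lemma poisson_weight (lam t : R) k : 0 <= lam -> 1 <= t ->
  ((t ^+ k.*2 * weight lam t k)%:E <= \sum_(n <oo)
    (poisson_pmf' t (k.*2 + n) * ((k.*2 + n) ^_ k.*2)%:R * surv (2 * lam / t ^+ 2) k.*2 n)%:E)%E.
Proof.
move=> l0 t1; have t0 : 0 < t by lra.
set b := 2 * lam / t ^+ 2; set c := k.*2; set e := expR (- lam).
have e0 : 0 < e by exact: expR_gt0.
have p0 n : 0 <= poisson_pmf' t n by rewrite poisson_pmf'_ge0// ltW.
have ps0 n : 0 <= poisson_pmf' t n * surv b c n by exact: mulr_ge0 (surv_ge0 _ _ _).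
under eq_eseriesr do rewrite poisson_pmf'_ffact// -mulrA EFinM.
rewrite nneseriesZl; last by move=> n _; rewrite lee_fin.
rewrite EFinM lee_wpmul2l ?lee_fin ?exprn_ge0 ?(ltW t0)//.
set S := (\sum_(n <oo) _)%E; have S0 : (0 <= S)%E by apply: nneseries_ge0 => n _ _; rewrite lee_fin.
rewrite /weight -/e; case: (leP 0 (1 - _)) => _; last by rewrite mulr0.
pose D := 16 * (1 + lam) * lam ^+ 2; have D0 : 0 <= D by rewrite /D; nra.
pose A3 := D / t ^+ 4.
(* Coefficients of the loss in the basis of falling factorials [n ^_ 1], [n ^_ 2], [n ^_ 3]. *)
pose A1 := b * c%:R + A3 * (c%:R + 1) ^+ 2.
pose A2 := b / 2 + A3 * (2 * c%:R + 3).
have A30 : 0 <= A3 by rewrite divr_ge0// exprn_ge0// ltW.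
have b0 : 0 <= b by rewrite divr_ge0 ?mulr_ge0 ?exprn_ge0// ltW.
have c0 : 0 <= c%:R :> R by [].
have A10 : 0 <= A1 by apply: addr_ge0; [exact: mulr_ge0|exact: mulr_ge0 (sqr_ge0 _)].
have A20 : 0 <= A2.
  by apply: addr_ge0; [exact: divr_ge0|apply: mulr_ge0 => //; apply: addr_ge0 => //; exact: mulr_ge0].
pose q n := A1 * (n ^_ 1)%:R + A2 * (n ^_ 2)%:R + A3 * (n ^_ 3)%:R.
have q0 n : 0 <= q n.
  by apply: addr_ge0; [apply: addr_ge0|]; exact: mulr_ge0.
have pq0 n : (0 <= (poisson_pmf' t n * q n)%:E)%E by rewrite lee_fin; exact: mulr_ge0.
have pn0 n j : (0 <= (poisson_pmf' t n * (n ^_ j)%:R)%:E)%E by rewrite lee_fin; exact: mulr_ge0.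
have e0' : (0 <= e%:E)%E by rewrite lee_fin ltW.
have Eq : (\sum_(n <oo) (poisson_pmf' t n * q n)%:E = (A1 * t + A2 * t ^+ 2 + A3 * t ^+ 3)%:E)%E.
  have -> : (A1 * t + A2 * t ^+ 2 + A3 * t ^+ 3)%:E =
    (A1%:E * (t ^+ 1)%:E + A2%:E * (t ^+ 2)%:E + A3%:E * (t ^+ 3)%:E)%E by [].
  rewrite -!poisson_moment// -!nneseriesZl; try by move=> n _; exact: pn0.
  have Ap A j n : 0 <= A -> (0 <= A%:E * (poisson_pmf' t n * (n ^_ j)%:R)%:E)%E.
    by move=> A0; rewrite mule_ge0.
  rewrite -nneseriesD; try by move=> n _ _; exact: Ap.
  rewrite -nneseriesD; last 2 first.
  - by move=> n _ _; rewrite adde_ge0// Ap.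
  - by move=> n _ _; exact: Ap.
  apply: eq_eseriesr => n _; rewrite -!EFinM -!EFinD; congr (_%:E).
  by rewrite /q; ring.
(* The loss stands on the right so that all series have nonnegative terms. *)
have key : ((e * (1 + lam))%:E <= S + (e * (A1 * t + A2 * t ^+ 2 + A3 * t ^+ 3))%:E)%E.
  rewrite [X in (_ <= _ + X)%E]EFinM -Eq -nneseriesZl; last by move=> n _; exact: pq0.
  rewrite /S -nneseriesD; [|by move=> n _ _; rewrite lee_fin|by move=> n _ _; rewrite mule_ge0].
  rewrite -[(_ * _)%:E]mule1 -(poisson_mass t0) -nneseriesZl; last by move=> n _; rewrite lee_fin.
  apply: lee_nneseries => n _.
    by move=> _; apply: mule_ge0; rewrite lee_fin//; apply: mulr_ge0; [exact: ltW|exact: addr_ge0].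
  rewrite -!EFinM -EFinD lee_fin.
  have := @surv_lower R lam t c n l0 t0; rewrite -/b -/e -/D.
  have -> : 1 + lam - b * (c%:R * n%:R + n%:R * (n%:R - 1) / 2) -
      D / t ^+ 4 * (n%:R * (c%:R + n%:R) ^+ 2) = 1 + lam - q n.
    by rewrite /q /A1 /A2 /A3 !natr_ffactS ffactn0; field; exact: lt0r_neq0.
  move/(ler_wpM2l (p0 n)); rewrite !mulrBr !mulrDr; lra.
(* The leading term is [(b / 2) t^2 = lam]; it cancels the [lam] in [1 + lam], and the rest carries
   a factor [1 / t]. *)
have E : A1 * t + A2 * t ^+ 2 + A3 * t ^+ 3 =
    lam + (2 * lam * c%:R + D * ((c%:R + 1) ^+ 2 / t ^+ 2 + (2 * c%:R + 3) / t + 1)) / t.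
  by rewrite /A1 /A2 /A3 /b; field; exact: lt0r_neq0.
have ti0 : 0 < t^-1 by rewrite invr_gt0.
have ti1 : t^-1 <= 1 by rewrite invf_le1.
have B : (2 * lam * c%:R + D * ((c%:R + 1) ^+ 2 / t ^+ 2 + (2 * c%:R + 3) / t + 1)) / t <=
    weight_const lam * k.+1%:R ^+ 2 / t.
  rewrite ler_wpM2r ?(ltW ti0)//.
  have h1 : (c%:R + 1) ^+ 2 / t ^+ 2 <= (c%:R + 1) ^+ 2.
    by rewrite ler_piMr ?sqr_ge0// invf_le1 ?exprn_gt0// exprn_ege1.
  have h2 : (2 * c%:R + 3) / t <= 2 * c%:R + 3 by rewrite ler_piMr// addr_ge0// mulr_ge0.
  apply: (@le_trans _ _ (2 * lam * c%:R + D * ((c%:R + 1) ^+ 2 + (2 * c%:R + 3) + 1))).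
    by rewrite lerD2l ler_wpM2l// lerD2r lerD.
  have -> : c%:R = 2 * k%:R :> R by rewrite /c -mul2n natrM.
  rewrite -[k.+1%:R]natr1 /weight_const (_ : 128 * (1 + lam) * lam ^+ 2 = 8 * D); last by rewrite /D; ring.
  have : 0 <= k%:R :> R by []. move: (k%:R : R) => x x0; clearbody D.
  have : 0 <= D * x by rewrite mulr_ge0.
  have : 0 <= D * x ^+ 2 by rewrite mulr_ge0// sqr_ge0.
  have : 0 <= lam * x by rewrite mulr_ge0.
  have : 0 <= lam * x ^+ 2 by rewrite mulr_ge0// sqr_ge0.
  have : 0 <= x ^+ 2 by rewrite sqr_ge0.
  lra.
move: key; rewrite E -leeBlDr// -EFinB; apply: le_trans; rewrite lee_fin -mulrBr ler_wpM2l ?(ltW e0)//.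
lra.
Qed.

Lemma le_mul_of_deficits (e x y X Y : R) : 0 <= e -> 0 <= x -> 0 <= y -> 0 <= X -> 0 <= Y ->
  1 - x <= X -> e * (1 - y) <= Y -> e * Num.max 0 (1 - (x + y)) <= X * Y.
Proof.
move=> e0 x0 y0 X0 Y0 hX hY.
rewrite maxr_pMr// mulr0 ge_max mulr_ge0//=.
have [x1|x1] := leP 1 x.
  by rewrite (@le_trans _ _ 0) ?mulr_ge0// mulr_ge0_le0//; lra.
have [y1|y1] := leP 1 y.
  by rewrite (@le_trans _ _ 0) ?mulr_ge0// mulr_ge0_le0//; lra.
apply: (@le_trans _ _ ((1 - x) * (e * (1 - y)))).
  by rewrite mulrCA ler_wpM2l//; nra.
by apply: ler_pM => //; [lra|rewrite mulr_ge0//; lra].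
Qed.

(** [ffact_lower] bounds the number of choices of the paired points and [surv_lower] the survival of
    the other [N - 2 k]; the two relative losses add. *)
Lemma binomial_weight (lam t : R) (N k : nat) : 0 <= lam -> 1 <= t ->
  t <= N%:R -> N%:R <= t + 1 ->
  t ^+ k.*2 * weight lam t k <= (N ^_ k.*2)%:R * surv (2 * lam / t ^+ 2) k.*2 (N - k.*2).
Proof.
move=> l0 t1 tN Nt; have t0 : 0 < t by lra.
have ti0 : 0 < t^-1 by rewrite invr_gt0.
set b := 2 * lam / t ^+ 2; set c := k.*2.
have hX := @ffact_lower R t N c t0 tN.
have X0 : 0 <= (N ^_ c)%:R / t ^+ c by rewrite divr_ge0// exprn_ge0// ltW.
suff : weight lam t k <= (N ^_ c)%:R / t ^+ c * surv b c (N - c).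
  by rewrite mulrAC ler_pdivlMr ?exprn_gt0// mulrC.
have Wle (z : R) : z <= weight_const lam * k.+1%:R ^+ 2 / t ->
    weight lam t k <= expR (- lam) * Num.max 0 (1 - z).
  move=> hz; rewrite ler_wpM2l ?expR_ge0// ge_max le_max lexx/= le_max.
  by apply/orP; right; lra.
have k0 : 0 <= k%:R :> R by [].
have w4 : 4 * k.+1%:R ^+ 2 / t <= weight_const lam * k.+1%:R ^+ 2 / t.
  rewrite ler_wpM2r ?(ltW ti0)// ler_wpM2r ?sqr_ge0// /weight_const.
  by rewrite -addrA lerDl; nra.
(* With fewer than [2 k] points the right side is zero, but so is the weight, since then
   [t < 2 k <= 4 (k + 1)^2]. *)
have [Nc|cN] := ltnP N c.
  apply: (@le_trans _ _ 0); last by rewrite mulr_ge0// surv_ge0.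
  have := Wle _ w4; rewrite (_ : Num.max _ _ = 0) ?mulr0//.
  apply/max_idPl; rewrite subr_le0 ler_pdivlMr// mul1r.
  have : N%:R < c%:R :> R by rewrite ltr_nat.
  have -> : c%:R = 2 * k%:R :> R by rewrite /c -mul2n natrM.
  rewrite -[k.+1%:R]natr1; nra.
pose D := 16 * (1 + lam) * lam ^+ 2; have D0 : 0 <= D by rewrite /D; nra.
set n := (N - c)%N; have cn : c%:R + n%:R = N%:R :> R by rewrite -natrD /n subnKC.
have hY := @surv_lower R lam t c n l0 t0; rewrite -/b -/D in hY.
have n0 : 0 <= n%:R :> R by [].
(* Used in [E1]: with [N = c + n], the linear sum equals [(N (N - 1) - c (c - 1)) / 2], hence is at
   most [(t + 1) t / 2]. *)
have c1 : 0 <= c%:R * (c%:R - 1) :> R.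
  case: (c) => [|c']; first by rewrite mul0r.
  by rewrite -[c'.+1%:R]natr1 addrK mulr_ge0.
have E1 : b * (c%:R * n%:R + n%:R * (n%:R - 1) / 2) <= lam + lam / t.
  have -> : lam + lam / t = b * ((t + 1) * t / 2) by rewrite /b; field; exact: lt0r_neq0.
  rewrite ler_wpM2l//; first by rewrite divr_ge0 ?mulr_ge0 ?exprn_ge0// ltW.
  apply: (@le_trans _ _ (N%:R * (N%:R - 1) / 2)); last by nra.
  by rewrite -cn; nra.
have E2 : D / t ^+ 4 * (n%:R * (c%:R + n%:R) ^+ 2) <= 8 * D / t.
  have -> : 8 * D / t = D / t ^+ 4 * (8 * t ^+ 3) by field; exact: lt0r_neq0.
  rewrite ler_wpM2l ?divr_ge0 ?exprn_ge0 ?(ltW t0)// cn.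
  apply: (@le_trans _ _ (N%:R ^+ 3)).
    by rewrite [leRHS]exprS ler_wpM2r ?sqr_ge0// -cn lerDr.
  have -> : 8 * t ^+ 3 = (2 * t) ^+ 3 by ring.
  by rewrite lerXn2r ?nnegrE; lra.
apply: le_trans (@le_mul_of_deficits (expR (- lam)) ((c ^ 2)%:R / t) ((lam + 8 * D) / t) _ _ _ _ _ X0 (surv_ge0 _ _ _) hX _).
- apply: Wle; rewrite -mulrDl ler_wpM2r ?(ltW ti0)//.
  have -> : (c ^ 2)%:R = 4 * k%:R ^+ 2 :> R by rewrite natrX /c -mul2n natrM; ring.
  rewrite -[k.+1%:R]natr1 /weight_const (_ : 128 * (1 + lam) * lam ^+ 2 = 8 * D); last by rewrite /D; ring.
  move: (k%:R : R) k0 => x x0; clearbody D.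
  have : 0 <= D * x by rewrite mulr_ge0.
  have : 0 <= D * x ^+ 2 by rewrite mulr_ge0// sqr_ge0.
  have : 0 <= lam * x by rewrite mulr_ge0.
  have : 0 <= lam * x ^+ 2 by rewrite mulr_ge0// sqr_ge0.
  lra.
- exact: expR_ge0.
- by rewrite divr_ge0// ltW.
- by apply: divr_ge0; [lra|exact: ltW].
- apply: le_trans hY; rewrite ler_wpM2l ?expR_ge0//.
  by rewrite mulrDl; lra.
Qed.

End weights.

(** * Poisson approximation of the midpoint process *)

Section mixtures.
Context {R : realType} d (T : measurableType d).
Local Open Scope ereal_scope.

Lemma ge0_integral_mixture (mu : {measure set T -> \bar R})
    (p : nat -> R) (mu_ : {measure set T -> \bar R}^nat) (f : T -> \bar R) :
  (forall n, 0 <= p n)%R ->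
  (forall D, measurable D -> mu D = \sum_(n <oo) (p n)%:E * mu_ n D) ->
  measurable_fun setT f -> (forall x, 0 <= f x) ->
  \int[mu]_x f x = \sum_(n <oo) (p n)%:E * \int[mu_ n]_x f x.
Proof.
move=> p0 muE mf f0.
rewrite (eq_measure_integral (mseries (fun n => mscale (NngNum (p0 n)) (mu_ n)) 0)); last first.
  by move=> A mA _; exact: muE.
rewrite ge0_integral_measure_series//; apply: eq_eseriesr => n _.
exact: (ge0_integral_mscale _ measurableT (NngNum (p0 n)) mf (fun x _ => f0 x)).
Qed.

Lemma nneseries_tail_le (f : nat -> \bar R) j : (forall n, 0 <= f n) ->
  \sum_(n <oo) f (j + n)%N <= \sum_(n <oo) f n.
Proof.
move=> f0; rewrite [leRHS](@nneseries_split _ f 0 j)// add0n.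
have -> : \sum_(n <oo) f (j + n)%N = \sum_(j <= n <oo) f n.
  apply: etrans (nneseries_addn j f0).
  by apply: eq_eseriesr => n _; rewrite addnC.
by rewrite leeDr// sume_ge0.
Qed.

End mixtures.

Section edge_process.
Context {R : realType} {d : nat}.
Local Open Scope ereal_scope.
Variables (m m' : {finite_measure set RV R d -> \bar R}) (r b : R).
Hypotheses (r0 : (0 <= r)%R) (m1 : m setT = 1) (b0 : (0 <= b)%R).
Hypothesis mb : forall x, m [set y | closeb r x y] <= b%:E.
Hypothesis mm' : forall g : RV R d -> \bar R,
  measurable_fun setT g -> (forall z, 0 <= g z) ->
  b%:E * \int[m']_z g z <= \int[m]_x \int[m]_y (ind (closeb r x y) * g (mid x y)).

Lemma far_nil (q : R) (s : Config R d) : far q [::] s.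
Proof. by elim: s. Qed.

Definition sparse : set (Config R d) := [set s | size (midpoints (2 * r) s) == 0%N].

Lemma measurable_sparse : measurable sparse.
Proof. by apply: measurable_setb; exact: measurable_size_eq. Qed.

Definition edges (k : nat) (A : set (Config R d)) : set (Config R d) :=
  (midpoints r @^-1` A) `&` [set s | size (midpoints r s) == k].

Lemma measurable_edges k A : measurable A -> measurable (edges k A).
Proof.
move=> mA; apply: measurableI.
  exact: (measurable_preim (@measurable_midpoints R d r) mA).
by apply: measurable_setb; exact: measurable_size_eq.
Qed.

Lemma integral_indset (mu : {measure set (Config R d) -> \bar R}) (D : set (Config R d)) :
  measurable D -> \int[mu]_s ind `[< D s >] = mu D.
Proof.
move=> mD; rewrite integral_ind; last exact: measurable_asbool.
by congr (mu _); apply/seteqP; split => s /asboolP.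
Qed.

Lemma edges_lower k n A : measurable A ->
  (((k.*2 + n) ^_ k.*2)%:R * (b / 2) ^+ k * surv b k.*2 n)%:E * iid m' k (A `&` sparse) <=
  (k`!)%:R%:E * iid m (k.*2 + n) (edges k A).
Proof.
move=> mA.
have mi : measurable_fun setT (fun s : Config R d => ind `[< A s >] : \bar R).
  by apply: measurable_ind; exact: measurable_asbool.
have := @edgeF_lower _ _ m r r0 m' b m1 b0 mb mm' k n (fun s => ind `[< A s >]) [::] [::] mi
  (fun s => ind_ge0 _) isT.
rewrite add0n -(integral_indset (iid m' k)); last exact: measurableI measurable_sparse.
rewrite -(integral_indset (iid m (k.*2 + n))); last exact: measurable_edges.
have -> : (fun z : Config R d => sepF r (fun s => ind `[< A s >]) [::] z) =
    (fun z => ind `[< (A `&` sparse) z >]).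
  apply/funext => z; rewrite /sepF far_nil mule1 -ind_andb; congr ind.
  by apply/andP/asboolP => [[/asboolP Az sz]|[Az sz]]; split => //; exact/asboolP.
have -> : (fun s : Config R d => edgeF r k (fun s => ind `[< A s >]) [::] s) =
    (fun s => ind `[< edges k A s >]).
  apply/funext => s; rewrite /edgeF far_nil mule1 -ind_andb; congr ind.
  by apply/andP/asboolP => [[/asboolP As ss]|[As ss]]; split => //; exact/asboolP.
by [].
Qed.

(** [mecke_pairs] with [G = 1]: each of the [n (n - 1)] ordered pairs is close with probability at
    most [b]. Fewer than two points have to be treated apart. *)
Lemma size_midpoints_iid n :
  \int[iid m n]_s (size (midpoints r s))%:R%:E <= ((n ^_ 2)%:R * (b / 2))%:E.
Proof.
have mf : measurable_fun setT (fun s : Config R d => (size (midpoints r s))%:R%:E : \bar R).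
  exact: (measurable_fun_nat1 (fun n => n%:R%:E : \bar R) (measurable_size_midpoints r)).
case: n => [|[|n]].
- by rewrite iid0// mul0r.
- rewrite iidS// mul0r.
  rewrite integral0_eq// => x _.
  by apply: (etrans (iid0 m (measurable_cons_fun x mf))); rewrite midpoints_cons.
have := @mecke_pairs _ _ m r r0 n (fun=> 1) (measurable_cst _) (fun=> lee01).
under eq_integral do rewrite mule1 -mul2n natrM EFinM.
rewrite ge0_integral_cstl// => E.
rewrite -(@lee_pmul2l _ 2%:E)// ?lte_fin// E.
rewrite [leRHS](_ : _ = ((n.+2 * n.+1)%:R%:E * b%:E)); last first.
  by rewrite -!EFinM ffactnS ffactn1 /=; congr (_%:E); field.
apply: lee_wpmul2l => //.
have iidT l : iid m l setT = 1 by rewrite iid_measure m1 expr1n.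
apply: (@le_trans _ _ (\int[m]_x b%:E)); last first.
  by rewrite integral_cst//; change (b%:E * m setT <= b%:E); rewrite m1 mule1.
apply: ge0_le_integralT => x.
  by apply: integral_ge0 => y _; apply: integral_ge0 => s _; rewrite mule1 ind_ge0.
apply: le_trans (mb x).
rewrite -[leRHS]integral_ind; last exact: measurable_closeb.
apply: ge0_le_integralT => y.
  by apply: integral_ge0 => s _; rewrite mule1 ind_ge0.
under eq_integral do rewrite mule1.
rewrite integral_cst//; change (ind (closeb r x y) * iid m n setT <= ind (closeb r x y)).
by rewrite iidT mule1.
Qed.

Variables (p : nat -> R) (mu : {measure set (Config R d) -> \bar R}).
Hypothesis p0 : forall n, (0 <= p n)%R.
Hypothesis muE : forall D, measurable D -> mu D = \sum_(n <oo) (p n)%:E * iid m n D.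

(** Averages [edges_lower] over the number of points, dropping the terms with fewer than [2 k] of
    them. As [b / 2 = lam / t^2], the power [t^(2 k)] in the hypothesis on [p] turns [(b / 2)^k]
    into [lam^k]. *)
Lemma mixture_edges_lower k A (w t lam : R) : measurable A -> (0 <= w)%R -> (0 < t)%R ->
  b = (2 * lam / t ^+ 2)%R ->
  (t ^+ k.*2 * w)%:E <=
    \sum_(n <oo) (p (k.*2 + n)%N * ((k.*2 + n) ^_ k.*2)%:R * surv b k.*2 n)%:E ->
  (w * (lam ^+ k / k`!%:R))%:E * iid m' k (A `&` sparse) <= mu (edges k A).
Proof.
move=> mA w0 t0 bE hw.
set x := iid m' k _.
have xfin : x = (fine x)%:E.
  by rewrite fineK// fin_num_measure//; exact: measurableI measurable_sparse.
have x0 : (0 <= fine x)%R by apply: fine_ge0; exact: measure_ge0.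
have lam0 : (0 <= lam)%R.
  move: b0; rewrite bE pmulr_lge0 ?invr_gt0 ?exprn_gt0//; lra.
have kf : (0 < k`!%:R :> R)%R by rewrite ltr0n fact_gt0.
rewrite -(@lee_pmul2l _ (k`!%:R)%:E)// ?lte_fin//.
have -> : k`!%:R%:E * ((w * (lam ^+ k / k`!%:R))%:E * x) =
    ((b / 2) ^+ k * fine x)%:E * (t ^+ k.*2 * w)%:E.
  rewrite xfin -!EFinM /=; congr (_%:E).
  rewrite bE -mul2n exprM; have -> : (2 * lam / t ^+ 2 / 2 = lam / t ^+ 2)%R by field; rewrite gt_eqF.
  rewrite expr_div_n; field; rewrite !gt_eqF ?exprn_gt0//.
apply: (@le_trans _ _ (((b / 2) ^+ k * fine x)%:E *
    \sum_(n <oo) (p (k.*2 + n)%N * ((k.*2 + n) ^_ k.*2)%:R * surv b k.*2 n)%:E)).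
  by rewrite lee_wpmul2l// lee_fin mulr_ge0// exprn_ge0// divr_ge0.
have q0 n : (0 <= p (k.*2 + n)%N * ((k.*2 + n) ^_ k.*2)%:R * surv b k.*2 n)%R.
  by rewrite !mulr_ge0// surv_ge0.
rewrite -nneseriesZl; last by move=> n _; rewrite lee_fin.
have f0 n : 0 <= (p n)%:E * iid m n (edges k A) by rewrite mule_ge0 ?lee_fin.
rewrite muE; last exact: measurable_edges.
apply: (@le_trans _ _ (k`!%:R%:E * \sum_(n <oo) (p (k.*2 + n)%N)%:E * iid m (k.*2 + n) (edges k A))); last first.
  rewrite lee_wpmul2l//.
  exact: (nneseries_tail_le k.*2 f0).
rewrite -nneseriesZl//.
apply: lee_nneseries => n _ => [_|].
  by rewrite -EFinM lee_fin mulr_ge0// mulr_ge0// exprn_ge0// divr_ge0.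
have := lee_wpmul2l (_ : 0 <= (p (k.*2 + n)%N)%:E) (edges_lower k n mA).
rewrite lee_fin => /(_ (p0 _)); rewrite -/x xfin /= => h.
rewrite [leRHS]muleCA; apply: le_trans h.
by rewrite -!EFinM lee_fin le_eqVlt; apply/orP; left; apply/eqP; ring.
Qed.

Lemma mixture_size_midpoints (B : R) :
  \sum_(n <oo) (p n * (n ^_ 2)%:R)%:E <= B%:E ->
  \int[mu]_s (size (midpoints r s))%:R%:E <= (B * (b / 2))%:E.
Proof.
move=> hB.
have mf : measurable_fun setT (fun s : Config R d => (size (midpoints r s))%:R%:E : \bar R).
  exact: (measurable_fun_nat1 (fun n => n%:R%:E : \bar R) (measurable_size_midpoints r)).
rewrite (ge0_integral_mixture p0 muE)//.
apply: (@le_trans _ _ (\sum_(n <oo) (b / 2)%:E * (p n * (n ^_ 2)%:R)%:E)).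
  apply: lee_nneseries => n _ => [_|].
    by rewrite mule_ge0// ?lee_fin// integral_ge0.
  apply: le_trans (lee_wpmul2l _ (size_midpoints_iid n)) _; first by rewrite lee_fin.
  by rewrite -!EFinM lee_fin le_eqVlt; apply/orP; left; apply/eqP; ring.
rewrite nneseriesZl; last by move=> n _; rewrite lee_fin mulr_ge0.
rewrite [leRHS](_ : _ = (b / 2)%:E * B%:E); last by rewrite -EFinM mulrC.
by apply: lee_wpmul2l => //; rewrite lee_fin divr_ge0.
Qed.

End edge_process.

(** * The common part of the two laws, and the coupling *)

Section poisson_approximation.
Context {R : realType} {d : nat}.
Local Open Scope ereal_scope.
Variables (m m' : {finite_measure set RV R d -> \bar R}) (r b b2 delta lam t : R).
Hypotheses (r0 : (0 <= r)%R) (m1 : m setT = 1) (b20 : (0 <= b2)%R) (delta0 : (0 <= delta)%R).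
Hypotheses (lam0 : (0 < lam)%R) (t1 : (1 <= t)%R) (bE : b = (2 * lam / t ^+ 2)%R).
Hypothesis mb : forall x, m [set y | closeb r x y] <= b%:E.
Hypothesis mb2 : forall x, m [set y | closeb (2 * r) x y] <= b2%:E.
Hypothesis mm' : forall g : RV R d -> \bar R,
  measurable_fun setT g -> (forall z, 0 <= g z) ->
  b%:E * \int[m']_z g z <= \int[m]_x \int[m]_y (ind (closeb r x y) * g (mid x y)).
Hypothesis m'm : forall A, measurable A -> m' A <= m A.
Hypothesis m'T : (1 - delta)%:E <= m' setT.

Let t0 : (0 < t)%R. Proof. exact: lt_le_trans t1. Qed.

Let b0 : (0 <= b)%R.
Proof. by rewrite bE divr_ge0 ?mulr_ge0 ?exprn_ge0// ltW. Qed.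

Let mS := @measurable_sparse R d r.

(** The total mass is at least [(1 - delta)^k >= 1 - k delta] when [delta <= 1]. The lists with a
    [2 r]-close pair are estimated under the larger measure [iid m k], as [surv_iid] is for
    probabilities, and have mass at most [k^2 b2]. *)
Lemma sparse_lower k : (1 - (k%:R * delta + k%:R ^+ 2 * b2))%:E <= iid m' k (sparse r).
Proof.
have fin : m' setT = (fine (m' setT))%:E by rewrite fineK// fin_num_measure.
set x := fine (m' setT) in fin.
have x1 : (x <= 1)%R by rewrite -lee_fin -fin -m1; exact: m'm.
have xd : (1 - delta <= x)%R by rewrite -lee_fin -fin.
have x0 : (0 <= x)%R by apply: fine_ge0; exact: measure_ge0.
have xk : (1 - k%:R * delta <= x ^+ k)%R.
  elim: k => [|k ih]; first by rewrite mul0r subr0.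
  rewrite exprS -[k.+1%:R]natr1.
  have : (x ^+ k <= 1)%R by rewrite exprn_ile1.
  have : (0 <= x ^+ k)%R by rewrite exprn_ge0.
  move: (x ^+ k)%R ih => y; nra.
have T : iid m' k setT = (x ^+ k)%:E by rewrite iid_measure.
have mT : iid m k setT = 1 by rewrite iid_measure m1 expr1n.
have := @measureU _ _ _ (iid m' k) (sparse r) (~` sparse r) mS (measurableC mS) (setICr _).
rewrite setUCr => E.
have dC : iid m' k (~` sparse r) <= (k%:R ^+ 2 * b2)%:E.
  apply: (@le_trans _ _ (iid m k (~` sparse r))).
    rewrite -!(integral_indset _ (measurableC mS)).
    apply: le_iid => //; last by move=> s; exact: ind_ge0.
    by apply: measurable_ind; apply: measurable_asbool; exact: measurableC.
  have := @measureU _ _ _ (iid m k) (sparse r) (~` sparse r) mS (measurableC mS) (setICr _).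
  rewrite setUCr => EE.
  have s1 : (1 - k%:R ^+ 2 * b2)%:E <= iid m k (sparse r).
    have := @surv_iid R d m (2 * r) b2 m1 mb2 k [::].
    under eq_integral do rewrite far_nil mule1.
    rewrite integral_ind; last exact: measurable_size_eq.
    apply: le_trans; rewrite lee_fin.
    apply: (@le_trans _ _ (1 - \sum_(j < k) (0 + j)%:R * b2)%R); last first.
      by apply: (@prod_ge_one_sub_sum R k (fun j => (0 + j)%:R * b2)%R) => j; exact: mulr_ge0.
    rewrite lerD2l lerN2; apply: (@le_trans _ _ (\sum_(j < k) k%:R * b2)%R).
      by apply: ler_sum => j _; rewrite ler_wpM2r// ler_nat add0n ltnW.
    by rewrite sumr_const card_ord -[leLHS]mulr_natl mulrA -expr2.
  rewrite leNgt; apply/negP => lt_dC; have : 1 < iid m k setT.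
    rewrite EE (_ : 1 = (1 - k%:R ^+ 2 * b2)%:E + (k%:R ^+ 2 * b2)%:E); last first.
      by rewrite -EFinD subrK.
    apply: (@lt_le_trans _ _ ((1 - k%:R ^+ 2 * b2)%:E + iid m k (~` sparse r))).
      by rewrite lteD2lE.
    exact: leeD2r.
  by rewrite mT ltxx.
rewrite -(@leeD2rE _ (k%:R ^+ 2 * b2)%:E)// -EFinD.
apply: (@le_trans _ _ (iid m' k (sparse r) + iid m' k (~` sparse r))); last exact: leeD2l.
apply: (@le_trans _ _ (iid m' k setT)); last by rewrite E.
by rewrite T lee_fin; lra.
Qed.

Let c k : R := (weight lam t k * (lam ^+ k / k`!%:R))%R.

Let c0 k : (0 <= c k)%R.
Proof. by rewrite mulr_ge0 ?weight_ge0// divr_ge0// exprn_ge0// ltW. Qed.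

(** The common part [nu]; [sparse] enforces that no two midpoints are [2 r]-close. *)
Let core : {measure set (Config R d) -> \bar R} :=
  mseries (fun k => mscale (NngNum (c0 k)) (mrestr (iid m' k) mS)) 0.

Let coreE A : core A = \sum_(k <oo) (c k)%:E * iid m' k (A `&` sparse r).
Proof. by []. Qed.

Variable muz : probability (Config R d) R.
Hypothesis muzE : forall D, measurable D ->
  muz D = \sum_(k <oo) (poisson_pmf' lam k)%:E * iid m k D.

Let core_le_poisson A : measurable A -> core A <= muz A.
Proof.
move=> mA; rewrite coreE muzE//; apply: lee_nneseries => k _ => [_|].
  by apply: mule_ge0 => //; rewrite lee_fin.
apply: lee_pmul => //; first by rewrite lee_fin.
  rewrite lee_fin /c /poisson_pmf' mulrC ler_wpM2l ?weight_le ?(ltW lam0)//.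
  by rewrite divr_ge0// exprn_ge0// ltW.
apply: (@le_trans _ _ (iid m' k A)).
  by apply: le_measure; rewrite ?inE//; exact: measurableI.
rewrite -!(integral_indset _ mA); apply: le_iid => //; last by move=> s; exact: ind_ge0.
by apply: measurable_ind; apply: measurable_asbool.
Qed.

Lemma poisson_size_le : \int[muz]_s esize s <= lam%:E.
Proof.
have p0 n : (0 <= poisson_pmf' lam n)%R by rewrite poisson_pmf'_ge0// ltW.
rewrite (ge0_integral_mixture p0 muzE); [|exact: measurable_esize|exact: esize_ge0].
rewrite -[X in _ <= X%:E]expr1 -(poisson_moment 1 lam0); apply: lee_nneseries => n _ => [_|].
  by apply: mule_ge0; [rewrite lee_fin|apply: integral_ge0 => s _; exact: esize_ge0].
have -> : \int[iid m n]_s esize s = \int[iid m n]_s n%:R%:E.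
  apply: eq_iid => //; first exact: measurable_esize.
  - exact: esize_ge0.
  - by move=> s <-.
rewrite integral_cst//.
have mT : iid m n setT = 1 by rewrite iid_measure m1 expr1n.
change ((poisson_pmf' lam n)%:E * (n%:R%:E * iid m n setT) <= (poisson_pmf' lam n * (n ^_ 1)%:R)%:E).
by rewrite mT mule1 -EFinM ffactn1.
Qed.

(** The mean of [k (k + 1)^2] for a Poisson variable of parameter [lam], from
    [k (k + 1)^2 = k^_3 + 5 k^_2 + 4 k]. *)
Definition moment_const : R := (lam ^+ 3 + 5 * lam ^+ 2 + 4 * lam)%R.

Lemma moment_const_ge0 : (0 <= moment_const)%R.
Proof. by have := ltW lam0; rewrite /moment_const => l0; rewrite !addr_ge0 ?mulr_ge0 ?exprn_ge0. Qed.

(** The losses from the weights, from the mass missing in [m'], and from close midpoints; multiplied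
    by [(k + 1)^2] it bounds the relative loss in the [k]-th term of [core]. *)
Definition error_rate : R := (weight_const lam / t + delta + b2)%R.

(** Without losses the sum would be the Poisson mean [lam]. The [k]-th term loses a proportion of at
    most [error_rate * (k + 1)^2], and weighting by the size [k] leads to the mean of
    [k (k + 1)^2]. *)
Let core_size : (lam - error_rate * moment_const)%:E <= \int[core]_s esize s.
Proof.
have p0 n : (0 <= poisson_pmf' lam n)%R by rewrite poisson_pmf'_ge0// ltW.
have e0 : (0 <= error_rate)%R.
  by rewrite /error_rate !addr_ge0// divr_ge0 ?weight_const_ge0// ltW.
have -> : \int[core]_s esize s = \sum_(k <oo) (c k)%:E * (k%:R%:E * iid m' k (sparse r)).
  rewrite (ge0_integral_mixture c0 (mu_ := fun k => mrestr (iid m' k) mS)) => //; last 2 first.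
  - exact: measurable_esize.
  - exact: esize_ge0.
  apply: eq_eseriesr => k _; congr (_ * _).
  rewrite (ge0_integral_mrestr _ mS measurable_esize (@esize_ge0 R d)).
  have mi : measurable_fun setT (fun s : Config R d => ind `[< sparse r s >] : \bar R).
    by apply: measurable_ind; exact: measurable_asbool.
  rewrite -(integral_indset (iid m' k) mS) -ge0_integral_cstl//; last by move=> s; exact: ind_ge0.
  apply: eq_iid.
  - by apply: emeasurable_funM => //; exact: measurable_esize.
  - exact: measurable_funeM.
  - by move=> s; apply: mule_ge0; [exact: ind_ge0|exact: esize_ge0].
  - by move=> s; apply: mule_ge0; [rewrite lee_fin|exact: ind_ge0].
  - by move=> s <-; rewrite muleC.
pose q k := (poisson_pmf' lam k * (k%:R * k.+1%:R ^+ 2))%R.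
have q0 k : (0 <= q k)%R by apply: mulr_ge0 => //; rewrite mulr_ge0// sqr_ge0.
have Eq : \sum_(k <oo) (q k)%:E = moment_const%:E.
  have -> : moment_const%:E = (lam ^+ 3)%:E + 5%:E * (lam ^+ 2)%:E + 4%:E * (lam ^+ 1)%:E by [].
  have pn0 n j : 0 <= (poisson_pmf' lam n * (n ^_ j)%:R)%:E by rewrite lee_fin; exact: mulr_ge0.
  have Ap A j n : (0 <= A)%R -> 0 <= A%:E * (poisson_pmf' lam n * (n ^_ j)%:R)%:E.
    by move=> A0; rewrite mule_ge0.
  rewrite -!(poisson_moment _ lam0) -!nneseriesZl; try by move=> n _; exact: pn0.
  rewrite -nneseriesD; [|by move=> n _ _|by move=> n _ _; exact: Ap].
  rewrite -nneseriesD; [|by move=> n _ _; rewrite adde_ge0// Ap|by move=> n _ _; exact: Ap].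
  apply: eq_eseriesr => n _; rewrite -!EFinM -!EFinD; congr (_%:E).
  rewrite /q !natr_ffactS ffactn0 -[n.+1%:R]natr1; ring.
rewrite EFinB leeBlDr// EFinM -Eq -nneseriesZl; last by move=> k _; rewrite lee_fin.
have cs0 k : 0 <= (c k)%:E * (k%:R%:E * iid m' k (sparse r)).
  by apply: mule_ge0; [rewrite lee_fin|apply: mule_ge0; rewrite ?lee_fin].
rewrite -nneseriesD; [|by move=> k _ _|by move=> k _ _; rewrite mule_ge0// lee_fin].
rewrite -[X in X%:E <= _]expr1 -(poisson_moment 1 lam0).
apply: lee_nneseries => k _ => [_|]; first by rewrite lee_fin; exact: mulr_ge0.
have fin : iid m' k (sparse r) = (fine (iid m' k (sparse r)))%:E by rewrite fineK// fin_num_measure.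
set x := fine _ in fin.
have x0 : (0 <= x)%R by apply: fine_ge0; exact: measure_ge0.
have xk : (1 - (k%:R * delta + k%:R ^+ 2 * b2) <= x)%R by rewrite -lee_fin -fin sparse_lower.
rewrite fin -!EFinM -EFinD lee_fin ffactn1 /q /c /poisson_pmf'.
have : (0 <= lam ^+ k / k`!%:R)%R by rewrite divr_ge0// exprn_ge0// ltW.
rewrite /weight; set u := (lam ^+ k / k`!%:R)%R; set e := expR (- lam); move=> u0.
have e_ge0 : (0 <= e)%R by exact: expR_ge0.
have C0 := weight_const_ge0 (ltW lam0).
have ti0 : (0 <= t^-1)%R by rewrite invr_ge0 ltW.
have k0 : (0 <= k%:R :> R)%R by [].
have h1 : (0 <= weight_const lam * k.+1%:R ^+ 2 / t)%R by rewrite !mulr_ge0// exprn_ge0.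
have h2 : (0 <= k%:R * delta + k%:R ^+ 2 * b2)%R by rewrite addr_ge0 ?mulr_ge0// exprn_ge0.
have W := weight_ge0 lam t k.
have : (e * (1 - (error_rate * k.+1%:R ^+ 2)) <= weight lam t k * x)%R.
  rewrite [leRHS]mulrC; apply: le_trans (@le_mul_of_deficits R e _ _ x (weight lam t k) e_ge0 h2 h1 x0 W xk _); last first.
    by rewrite ler_wpM2l// le_max lexx orbT.
  rewrite ler_wpM2l// le_max; apply/orP; right.
  rewrite /error_rate lerD2l lerN2 -[k.+1%:R]natr1.
  have : (0 <= delta * k%:R)%R by rewrite mulr_ge0.
  have : (0 <= delta * k%:R ^+ 2)%R by rewrite mulr_ge0// exprn_ge0.
  have : (0 <= b2 * k%:R)%R by rewrite mulr_ge0.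
  by move: delta0 b20; rewrite [(weight_const lam * _ / t)%R]mulrAC; move: (weight_const lam / t)%R (k%:R : R)%R => y z; lra.
have uk : (0 <= u * k%:R)%R by rewrite mulr_ge0.
move/(ler_wpM2l uk); rewrite -/(weight lam t k); lra.
Qed.

Variables (p : nat -> R) (mu : probability (Config R d) R).
Hypothesis p0 : forall n, (0 <= p n)%R.
Hypothesis muE : forall D, measurable D -> mu D = \sum_(n <oo) (p n)%:E * iid m n D.
Hypothesis p_weight : forall k, (t ^+ k.*2 * weight lam t k)%:E <=
  \sum_(n <oo) (p (k.*2 + n)%N * ((k.*2 + n) ^_ k.*2)%:R * surv b k.*2 n)%:E.
Hypothesis p_moment : \sum_(n <oo) (p n * (n ^_ 2)%:R)%:E <= (t ^+ 2 + t)%:E.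

Let core_le_edges A : measurable A -> core A <= mu (midpoints r @^-1` A).
Proof.
move=> mA; have -> : midpoints r @^-1` A = \bigcup_k edges r k A.
  apply/seteqP; split => [s As|s [k _ []]//].
  by exists (size (midpoints r s)) => //; split => //=.
rewrite measure_semi_bigcup; last 3 first.
- by move=> k; exact: measurable_edges.
- by apply/trivIsetP => i j _ _ ij; rewrite -subset0 => s [[_ /= /eqP si] [_ /= /eqP sj]];
    move: ij; rewrite -si sj eqxx.
- by apply: bigcupT_measurable => k; exact: measurable_edges.
rewrite coreE; apply: lee_nneseries => k _ => [_|].
  by apply: mule_ge0 => //; rewrite lee_fin.
exact: (mixture_edges_lower r0 m1 b0 mb mm' p0 muE mA (weight_ge0 lam t k) t0 bE).
Qed.

(** The expected number of midpoints is at most [(t^2 + t) b / 2 = lam + lam / t], that of the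
    Poisson process at most [lam]; twice the size of [core] is subtracted. *)
Lemma edge_process_coupling :
  exists Q : probability (Config R d * Config R d)%type R,
    [/\ forall A, measurable A -> Q (fst @^-1` A) = mu (midpoints r @^-1` A),
        forall A, measurable A -> Q (snd @^-1` A) = muz A &
        \int[Q]_z dTV z.1 z.2 <= (lam / t + 2 * (error_rate * moment_const))%:E].
Proof.
have T : pushm mu (@measurable_midpoints R d r) setT = 1 by exact: (probability_setT mu).
have coreT : core setT < +oo.
  apply: (@le_lt_trans _ _ (mu setT)); last by rewrite probability_setT ltry.
  exact: core_le_edges.
have hL1 : \int[probm T]_s esize s <= (lam + lam / t)%:E.
  change (\int[pushm mu (@measurable_midpoints R d r)]_s esize s <= (lam + lam / t)%:E).
  rewrite ge0_integral_pushm; [|exact: measurable_esize|exact: esize_ge0].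
  apply: (le_trans (mixture_size_midpoints r0 m1 b0 mb p0 muE p_moment)).
  rewrite lee_fin bE le_eqVlt; apply/orP; left; apply/eqP; field; exact: lt0r_neq0.
have [Q [Q1 Q2 Q3]] := @coupling_exists R d (probm T) muz (finm coreT) _ _ _
  core_le_edges core_le_poisson hL1 poisson_size_le core_size.
exists Q; split => //; apply: le_trans Q3 _; rewrite lee_fin; lra.
Qed.

End poisson_approximation.

(** * The binomial process as a degenerate mixture *)

Section binomial_pmf.
Context {R : realType}.
Local Open Scope ereal_scope.

Lemma nneseries_dirac (f : nat -> \bar R) N : (forall n, 0 <= f n) ->
  \sum_(n <oo) ((n == N)%:R : R)%:E * f n = f N.
Proof.
move=> f0; rewrite (@nneseriesD1 _ _ N)//; last by move=> n _; rewrite mule_ge0// lee_fin.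
rewrite eqxx mul1e eseries0 ?adde0// => n _ /= nN.
by rewrite (negbTE nN) mul0e.
Qed.

Lemma nneseries_term_le (f : nat -> \bar R) N : (forall n, 0 <= f n) -> f N <= \sum_(n <oo) f n.
Proof. by move=> f0; rewrite (@nneseriesD1 _ _ N)// leeDl// nneseries_ge0. Qed.

Lemma dirac_weight (lam t : R) (N k : nat) : (0 <= lam)%R -> (1 <= t)%R ->
  (t <= N%:R)%R -> (N%:R <= t + 1)%R ->
  (t ^+ k.*2 * weight lam t k)%:E <= \sum_(n <oo)
    (((k.*2 + n)%N == N)%:R * ((k.*2 + n) ^_ k.*2)%:R * surv (2 * lam / t ^+ 2) k.*2 n)%:E.
Proof.
move=> l0 t1 tN Nt; have := binomial_weight k l0 t1 tN Nt; set b := (2 * lam / t ^+ 2)%R => h.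
pose f n := (((k.*2 + n)%N == N)%:R * ((k.*2 + n) ^_ k.*2)%:R * surv b k.*2 n)%:E.
have f0 n : 0 <= f n.
  by rewrite lee_fin; apply: mulr_ge0 (surv_ge0 _ _ _); exact: mulr_ge0.
have [kN|Nk] := leqP k.*2 N.
  apply: le_trans (nneseries_term_le (N - k.*2) f0).
  by rewrite /f subnKC// eqxx mul1r lee_fin.
apply: (@le_trans _ _ 0); last by apply: nneseries_ge0 => n _ _; exact: f0.
by rewrite lee_fin; apply: (le_trans h); rewrite ffact_small// mul0r.
Qed.

Lemma dirac_moment2 (t : R) (N : nat) : (0 <= t)%R -> (N%:R <= t + 1)%R ->
  \sum_(n <oo) ((n == N)%:R * (n ^_ 2)%:R)%:E <= (t ^+ 2 + t)%:E.
Proof.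
move=> t0 Nt; under eq_eseriesr do rewrite EFinM.
rewrite nneseries_dirac; last by move=> n; rewrite lee_fin.
rewrite lee_fin !natr_ffactS ffactn0 mul1r subr0.
by have : (0 <= N%:R :> R)%R by []; nra.
Qed.

End binomial_pmf.

(** * The interaction radius and the threshold *)

Section radius.
Context {R : realType} (d : nat).
Hypothesis d0 : (0 < d)%N.

Lemma radius_pow (t a : R) : 0 < t -> (t `^ (- (2 / d%:R)) * a) ^+ d = a ^+ d / t ^+ 2.
Proof.
move=> t0; rewrite exprMn mulrC; congr (_ * _).
rewrite -(powR_mulrn d (powR_ge0 _ _)) -powRrM mulNr divfK ?pnatr_eq0 ?gtn_eqF//.
by rewrite powRN powR_mulrn// ltW.
Qed.

Lemma minr_radius (t th a : R) : 1 < t -> 0 < th -> 0 < a -> a ^+ d <= t ^+ 2 * th ^+ d ->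
  Num.min th (t `^ (- (2 / d%:R)) * a) = t `^ (- (2 / d%:R)) * a.
Proof.
move=> t1 th0 a0 h; apply/min_idPr; have t0 : 0 < t by lra.
rewrite -(ler_pXn2r d0) ?nnegrE ?mulr_ge0 ?powR_ge0 ?(ltW th0) ?(ltW a0)//.
by rewrite radius_pow// ler_pdivrMr ?exprn_gt0// mulrC.
Qed.

(** Divergence makes the defining inequality fail beyond some [A], so the supremum is at most
    [max A 1]. *)
Lemma threshold_lty (theta : R -> R) (a : R) :
  (t ^+ 2 * theta t ^+ d @[t --> +oo] --> +oo) ->
  let t0 : \bar R :=
    ereal_sup ([set t%:E | t in [set t : R | 1 <= t /\ t ^+ 2 * theta t ^+ d < a ^+ d]]
               `|` [set 1%E]) in
  (t0 < +oo)%E.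
Proof.
move=> /cvgryPge /(_ (a ^+ d)) [A [_ hA]].
apply: (@le_lt_trans _ _ (Num.max A 1)%:E); last exact: ltry.
apply: ge_ereal_sup => _ [[t [t1 ht] <-]|->]; rewrite lee_fin le_max; last by rewrite lexx orbT.
rewrite leNgt; apply/orP; left; apply/negP => At.
by have := hA t At; rewrite /= leNgt ht.
Qed.

End radius.

Lemma law_of_process (R : realType) dO (O : measurableType dO) dT (T : measurableType dT)
    (P : probability O R) (f : O -> T) : measurable_fun setT f ->
  exists mu : probability T R, forall A, mu A = P (f @^-1` A).
Proof.
move=> mf; have h : pushm P mf setT = 1%E by exact: (probability_setT P).
by exists (probm h).
Qed.

Lemma dKR_le (R : realType) d dO1 dO2 (O1 : measurableType dO1) (O2 : measurableType dO2)
    (P1 : probability O1 R) (P2 : probability O2 R)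
    (eta1 : O1 -> Config R d) (eta2 : O2 -> Config R d)
    (Q : probability (Config R d * Config R d)%type R) :
  coupling P1 P2 eta1 eta2 Q -> (dKR P1 P2 eta1 eta2 <= \int[Q]_z dTV z.1 z.2)%E.
Proof. by move=> h; apply: ereal_inf_lbound; exists Q. Qed.

Unset Implicit Arguments.

Theorem theorem7p13 (R : realType) (d : nat) (K : set 'rV[R]_d) (a : R) :
  (0 < d)%N -> compact K -> convex_set K -> vol K = 1%E -> 0 < a ->
  exists C : R, 0 < C /\
  forall theta : R -> R,
    (forall t, 1 <= t -> 0 < theta t) ->
    (t ^+ 2 * theta t ^+ d @[t --> +oo] --> +oo) ->
    let t0 : \bar R :=
      ereal_sup ([set t%:E | t in [set t : R | 1 <= t /\ t ^+ 2 * theta t ^+ d < a ^+ d]]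
                 `|` [set 1%E]) in
    (t0 < +oo)%E /\
    forall t : R, (t0 < t%:E)%E ->
    forall (dO : measure_display) (O : measurableType dO) (P : probability O R)
           (mu : O -> Config R d),
      (poisson_process P mu (fun B => t * fine (vol (B `&` K)))
       \/ binomial_process P mu K `|Num.ceil t|%N) ->
    forall (dZ : measure_display) (Z : measurableType dZ) (PZ : probability Z R)
           (zeta : Z -> Config R d),
      poisson_process PZ zeta (fun B => kappa R d / 2 * a ^+ d * fine (vol (B `&` K))) ->
      (dKR P PZ (fun w => midpoints (Num.min (theta t) (t `^ (- (2 / d%:R)) * a))%R (mu w)) zeta
       <= ((C * t `^ (- Num.min (2 / d%:R) 1))%R)%:E)%E.
Proof.
move=> d0 kK cK vK a0; have [CK CK0 hCK] := volm_convex_shift kK cK.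
have kap := kappa_gt0 kK vK.
pose lam := kappa R d / 2 * a ^+ d.
have lam0 : 0 < lam by rewrite mulr_gt0 ?exprn_gt0// divr_gt0.
have wc0 := weight_const_ge0 (ltW lam0).
have M0 := moment_const_ge0 lam0.
(* The three summands bound [error_rate] divided by the target rate: [1 / t] carries
   [weight_const lam], the missing mass is [CK * r] with [r = a t^(-2/d)], and
   [b2 = 2^d (2 lam) / t^2]. *)
pose e := weight_const lam + CK * a + 2 ^+ d * (2 * lam).
have e0 : 0 <= e.
  apply: addr_ge0; first by apply: addr_ge0 => //; rewrite mulr_ge0// ltW.
  by apply: mulr_ge0; [exact: exprn_ge0|apply: mulr_ge0 => //; exact: ltW].
exists (lam + 2 * (e * moment_const lam)); split.
  by apply: ltr_wpDr => //; apply: mulr_ge0 => //; exact: mulr_ge0.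
move=> theta th0 thoo t0; split; first exact: threshold_lty.
move=> t t0t dO O P mu hmu dZ Z PZ zeta hz.
have t1 : 1 < t.
  rewrite -lte_fin; apply: le_lt_trans t0t.
  by apply: ereal_sup_ubound; right.
have tpos : 0 < t by lra.
(* Being above the supremum, [t] is outside the set, so the reverse inequality holds and the cut-off
   is inactive. *)
have hth : a ^+ d <= t ^+ 2 * theta t ^+ d.
  rewrite leNgt; apply/negP => h; move: t0t; rewrite ltNge => /negP; apply.
  by apply: ereal_sup_ubound; left; exists t => //; split => //; exact: ltW.
rewrite (minr_radius d0 t1 (th0 _ (ltW t1)) a0 hth).
set r := t `^ _ * a.
have r0 : 0 < r by rewrite mulr_gt0// powR_gt0.
have rd : r ^+ d = a ^+ d / t ^+ 2 by exact: radius_pow.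
have r20 : 0 < 2 * r by rewrite mulr_gt0.
have bE : kappa R d * r ^+ d = 2 * lam / t ^+ 2.
  by rewrite rd /lam; field; rewrite gt_eqF.
have b2E : kappa R d * (2 * r) ^+ d = 2 ^+ d * (2 * lam) / t ^+ 2.
  by rewrite exprMn mulrCA bE !mulrA.
pose m := volK kK vK; pose m' := midm kK vK r0.
have mmu : measurable_fun setT mu by case: hmu => -[].
have [mu1 mu1E] := law_of_process P mmu.
have [mu2 mu2E] := law_of_process PZ (proj1 hz).
have mu2law D : measurable D -> mu2 D = (\sum_(k <oo) (poisson_pmf' lam k)%:E * iid m k D)%E.
  by move=> mD; rewrite mu2E (poisson_process_law (volKT kK vK) (ltW lam0) hz).
(* The distribution [p] of the number of points carries all that differs between the two cases:
   Poisson of mean [t], or concentrated at [N]. *)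
have [p [p0 plaw pw p2]] : exists p : nat -> R, [/\ forall n, 0 <= p n,
    forall D, measurable D -> mu1 D = (\sum_(n <oo) (p n)%:E * iid m n D)%E,
    forall k, ((t ^+ k.*2 * weight lam t k)%:E <= \sum_(n <oo)
      (p (k.*2 + n)%N * ((k.*2 + n) ^_ k.*2)%:R * surv (kappa R d * r ^+ d) k.*2 n)%:E)%E &
    (\sum_(n <oo) (p n * (n ^_ 2)%:R)%:E <= (t ^+ 2 + t)%:E)%E].
  case: hmu => [hP|hB].
    exists (poisson_pmf' t); split.
    - by move=> n; apply: poisson_pmf'_ge0; exact: ltW.
    - by move=> D mD; rewrite mu1E (poisson_process_law (volKT kK vK) (ltW tpos) hP).
    - by move=> k; rewrite bE; apply: poisson_weight => //; exact: ltW.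
    - by rewrite poisson_moment// lee_fin lerDl ltW.
  set N := `|Num.ceil t|%N in hB.
  have tN : t <= N%:R /\ N%:R <= t + 1.
    have c0 : 0 <= Num.ceil t by rewrite ceil_ge0; lra.
    have -> : N%:R = (Num.ceil t)%:~R :> R by rewrite -[in RHS](gez0_abs c0).
    by have /andP[] := ceil_itv t; rewrite rmorphB/= => h1 h2; split => //; lra.
  exists (fun n => (n == N)%:R); split.
  - by [].
  - move=> D mD; rewrite nneseries_dirac// mu1E.
    exact: (binomial_process_law (m := m) (fun B _ => volKE kK vK B) hB).
  - by move=> k; rewrite bE; apply: dirac_weight; rewrite ?(ltW lam0) ?(ltW t1)//; case: tN.
  - by apply: dirac_moment2; [exact: ltW|case: tN].
have [|||Q [Q1 Q2 Q3]] := @edge_process_coupling R d m m' r _ (kappa R d * (2 * r) ^+ d) (CK * r) lam t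
  (ltW r0) (volKT kK vK) _ _ lam0 (ltW t1) bE (volK_ball kK vK r0) (volK_ball kK vK r20) _
  (midm_le kK cK vK r0) (midm_mass kK vK r0 CK0 hCK) mu2 mu2law p mu1 p0 plaw pw p2.
- by apply: mulr_ge0; [exact: ltW|apply: exprn_ge0; exact: ltW].
- by apply: mulr_ge0 => //; exact: ltW.
- by move=> g mg g0; rewrite integral_midm.
apply: (@le_trans _ _ (\int[Q]_z dTV z.1 z.2)%E).
  apply: dKR_le; split => A mA; first by rewrite Q1.
  by rewrite Q2.
apply: le_trans Q3 _; rewrite lee_fin.
(* As [t > 1], this rate dominates [t^(-1)], [t^(-2/d)] and [t^(-2)]. *)
set ep := t `^ (- Num.min _ _).
have ep0 : 0 <= ep by exact: powR_ge0.
have h1 : t^-1 <= ep.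
  by rewrite -powR_inv1 ?(ltW tpos)// ler_powR ?(ltW t1)// lerN2 ge_min lexx orbT.
have h2 : r <= a * ep.
  by rewrite [leRHS]mulrC /r ler_wpM2r ?(ltW a0)// ler_powR ?(ltW t1)// lerN2 ge_min lexx.
have h3 : (t ^+ 2)^-1 <= ep.
  by apply: le_trans h1; rewrite lef_pV2 ?posrE ?exprn_gt0// expr2 ler_peMr// ltW.
have h4 : error_rate (kappa R d * (2 * r) ^+ d) (CK * r) lam t <= e * ep.
  rewrite /error_rate /e b2E [leRHS]mulrDl [X in _ <= X + _]mulrDl; apply: lerD; first apply: lerD.
  - exact: ler_wpM2l.
  - by rewrite -!mulrA; apply: ler_wpM2l.
  - apply: ler_wpM2l => //; apply: mulr_ge0; first exact: exprn_ge0.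
    by apply: mulr_ge0 => //; exact: ltW.
have : lam / t <= lam * ep by rewrite ler_wpM2l// ltW.
have := ler_wpM2r M0 h4; lra.
Qed.
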